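(* Let $f\in L^2(\mathbb{T})$ be a real even function such that the sequence $V_N=\sum_{k=-N}^{N}|\hat{f}(k)|^2|k|^2$, $N=1,2,\ldots$, is slowly varying and diverges to infinity as $N\to\infty$. For each $N$ let $\theta_1,\ldots,\theta_N$ be the eigenvalue angles of an $N\times N$ CUE random matrix and let $S_N(f)=\sum_{1\le i\ne j\le N} f(\theta_i-\theta_j)$. Then, as $N\to\infty$, \[ \frac{S_N(f)-\mathbb{E}\,S_N(f)}{\sqrt{2\sum_{k=-N}^{N}|\hat{f}(k)|^2|k|^2}}\ \xrightarrow{\ \mathcal{D}\ }\ \mathcal{N}(0,1), \] i.e. the left-hand side converges in distribution to a standard real Gaussian random variable.
   Context: $\mathbb{T}$ is the unit circle; functions on $\mathbb{T}$ are identified with $2\pi$-periodic functions on $\mathbb{R}$. Fourier coefficients: $\hat{f}(k)=\frac{1}{2\pi}\int_0^{2\pi} f(x)e^{-ikx}\,dx$, $k\in\mathbb{Z}$. Circular Unitary Ensemble (CUE): the eigenvalues $e^{i\theta_1},\ldots,e^{i\theta_N}$ of an $N\times N$ Haar-distributed random unitary matrix, with $0\le\theta_1,\ldots,\theta_N<2\pi$ having joint probability density $\frac{1}{(2\pi)^N N!}\prod_{1\le j<k\le N}|e^{i\theta_j}-e^{i\theta_k}|^2$. Slowly varying (in the sense of Karamata): a positive sequence $V_N$ is slowly varying if $\lim_{N\to\infty} V_{\lfloor\lambda N\rfloor}/V_N=1$ for every $\lambda>0$, where $\lfloor\cdot\rfloor$ denotes the integer part. *)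

(* Defs.v *)
From mathcomp Require Import all_boot all_order all_algebra.
From mathcomp Require Import complex.
From mathcomp Require Import all_classical all_reals all_analysis.
Set Implicit Arguments.
Unset Strict Implicit.
Unset Printing Implicit Defensive.
Import Order.TTheory GRing.Theory Num.Theory.
Import numFieldNormedType.Exports.

Local Open Scope classical_set_scope.
Local Open Scope ring_scope.
Local Open Scope complex_scope.

Section Fourier.
Context {R : realType}.

(* A function on the circle is a 2 pi-periodic Borel function on R; an element
   of L^2 of the circle is represented by such a function. *)
Definition L2_circle (f : R -> R) : Prop :=
  [/\ measurable_fun setT f,
      forall x, f (x + 2 * pi) = f x
    & (@lebesgue_measure R).-integrable `[0, 2 * pi] (fun x => (f x ^+ 2)%:E)].

(* Evenness of the L^2 class: it does not depend on the representative. *)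
Definition even_ae (f : R -> R) : Prop :=
  {ae @lebesgue_measure R, forall x, f (- x) = f x}.

Definition expi (t : R) : R[i] := (cos t) +i* (sin t).

Definition cintegral (D : set R) (g : R -> R[i]) : R[i] :=
  (\int[@lebesgue_measure R]_(x in D) complex.Re (g x)) +i*
  (\int[@lebesgue_measure R]_(x in D) complex.Im (g x)).

Definition fourier_coef (f : R -> R) (k : int) : R[i] :=
  ((2 * pi)^-1)%:C *
    cintegral `[0, 2 * pi] (fun x => (f x)%:C * expi (- (k%:~R * x))).

(* The sum over the integers -N <= k <= N, with k = i - N for 0 <= i <= 2 N. *)
Definition fourier_energy (f : R -> R) (N : nat) : R :=
  \sum_(i < N.*2.+1)
     (let k := (i%:Z - N%:Z)%R in
      Normc.normc (fourier_coef f k) ^+ 2 * `|k%:~R : R| ^+ 2).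

(* Positivity is only required of all large N, so that finitely many terms of
   the sequence play no role. *)
Definition slowly_varying (V : nat -> R) : Prop :=
  (\forall N \near \oo, 0 < V N) /\
  forall lambda : R, 0 < lambda ->
    V (Num.truncn (lambda * N%:R)) / V N @[N --> \oo] --> (1 : R).

End Fourier.

Section CUE.
Context {R : realType}.

(* On nonnegative Borel functions this iterated integral is the integral with
   respect to the n-dimensional Lebesgue measure, by Tonelli's theorem. *)
Fixpoint tuple_integral (n : nat) : (n.-tuple R -> \bar R) -> \bar R :=
  match n with
  | 0 => fun g => g [tuple]
  | m.+1 => fun g =>
      (\int[@lebesgue_measure R]_x
          tuple_integral (fun t : m.-tuple R => g [tuple of x :: t]))%E
  end.

Definition cue_density (N : nat) (t : N.-tuple R) : R :=
  if [forall i, 0 <= tnth t i < 2 * pi] then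
    ((2 * pi) ^+ N * (N`!)%:R)^-1 *
    \prod_(j < N) \prod_(k < N | (j < k)%N)
       Normc.normc (expi (tnth t j) - expi (tnth t k)) ^+ 2
  else 0.

Definition cue_angles d (T : measurableType d) (P : probability T R) (N : nat)
    (theta : {RV P >-> N.-tuple R}) : Prop :=
  forall A : set (N.-tuple R), measurable A ->
    distribution P theta A =
    tuple_integral (fun t => (cue_density t * \1_A t)%:E).

Definition pair_stat (f : R -> R) (N : nat) (t : N.-tuple R) : R :=
  \sum_(i < N) \sum_(j < N | i != j) f (tnth t i - tnth t j).

End CUE.

Section Convergence.
Context {R : realType}.

Definition cvg_in_distribution (d : nat -> measure_display)
    (T : forall n, measurableType (d n)) (P : forall n, probability (T n) R)
    (X : forall n, T n -> R) (nu : probability (measurableTypeR R) R) : Prop :=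
  forall h : R -> R, continuous h -> bounded_fun h ->
    \int[P n]_w h (X n w) @[n --> \oo] --> \int[nu]_x h x.

End Convergence.

(* Main.v *)
(* Write q_k = |sum_j exp(i k theta_j)|^2 and a_k for the k-th Fourier coefficient of f.
   As f is even, S_N(f) - E S_N(f) = 2 sum_{k>=1} a_k (q_k - E q_k), the series converging
   in mean square because two eigenvalues have a bounded joint density.

   The moments of the q_k are computed with free fermions: multiplication of an
   antisymmetric Laurent polynomial by a power sum moves one particle, so E[prod q_k] is a
   matrix element between Vandermonde determinants. Below total degree N Wick's rule makes
   the q_k behave like independent exponential variables of mean k; without any restriction
   on the degree Var(sum_k a_k q_k) <= 3 N^2 sum_k a_k^2.

   Let W_N = sum_{k<=N} k^2 a_k^2, so that V_N = 2 W_N, and fix K. With M = N / (K + 1) the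
   moments of order at most K of Y_N = W_N^{-1/2} sum_{k<=M} a_k (q_k - k) obey an exact
   recursion, which tends to the Gaussian one: slow variation gives W_M / W_N -> 1 and
   max_{k<=N} k^2 a_k^2 = o(W_N). It also gives N^2 sum_{k>M} a_k^2 = o(W_N), hence the
   normalized statistic is asymptotic to Y_N in mean square. Since K is arbitrary, the
   method of moments applies; bounded continuous test functions are reduced to
   polynomials in sin(s x), whose expectations are compared through Taylor's formula. *)
Require Import Defs.
From mathcomp Require Import all_boot all_order all_algebra all_fingroup.
From mathcomp Require Import complex.
From mathcomp Require Import all_classical all_reals all_analysis.
From mathcomp Require Import measurable_realfun finmap ring lra zify.
Set Implicit Arguments.
Unset Strict Implicit.
Unset Printing Implicit Defensive.
Import Order.TTheory GRing.Theory Num.Theory.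
Import numFieldNormedType.Exports.
Local Open Scope classical_set_scope.
Local Open Scope ring_scope.

(** * Free fermions and moments of power sums *)

(** The CUE density is the squared modulus of a Vandermonde determinant, so an expectation is a
    constant term; pairing with an alternating polynomial leaves a single coefficient, at the
    staircase, and the CUE computations become integer identities. Multiplications by power sums of
    opposite signs commute. The nontrivial terms come from the floor at level 0, where a particle
    can only be lowered after it has been raised; they are explicit as long as the levels near the
    floor stay filled, which is the origin of the degree restriction. The moment recursion is the
    identity E[q g(q)] = k E[g(q)] + k E[q g'(q)] of an exponential variable of mean k. Each use of
    it on a power of sum_k b_k (q_k - k) releases one more factor k b_k, and only the sum of the
    squares of these factors survives in the limit. For the statistic itself only second moments are
    controlled. The approximants, which change with the order K, are therefore compared with it in
    L^2, through test functions that are Lipschitz (sine and cosine) or that err by at most a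
    multiple of x^2. *)

Section Fermions.
Variable N : nat.
Local Notation expo := {ffun 'I_N -> int}.
Implicit Types (J K : expo) (psi chi : expo -> int) (i j : 'I_N) (k l : int).

(* A finitely supported [psi : expo -> int] stands for the Laurent polynomial
   in N variables with these coefficients. Up to normalization an alternating one is a
   state of N fermions, [psi J] being the amplitude of the particles at levels [J i]. *)
Definition unit_expo i l : expo := [ffun j => if j == i then l else 0].

(* Multiplication by the power sum of degree [l]. *)
Definition mul_power l psi J : int := \sum_i psi (J - unit_expo i l).

(* The coefficients of the Vandermonde determinant. *)
Definition vacuum J : int := \det (\matrix_(i, j) ((J i == j%:Z)%:R : int)).

Definition staircase : expo := [ffun j : 'I_N => j%:Z].

Definition altern psi := forall (s : 'S_N) J,
  psi [ffun i => J (s i)] = (-1) ^+ s * psi J.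

Definition nonneg J := forall i, 0 <= J i.

Definition supp_nonneg psi := forall J, psi J != 0 -> nonneg J.

(** The Fermi sea is intact up to level [m] in every configuration carried by [psi]; this licenses
    [exclusion] and the counting of particles near the floor. *)
Definition filled_below (m : int) psi :=
  forall J, psi J != 0 -> forall v, 0 <= v -> v < m -> exists i, J i = v.

Lemma unit_expo0 i : unit_expo i 0 = 0.
Proof. by apply/ffunP => j; rewrite !ffunE; case: eqP. Qed.

Lemma unit_expoD i k l : unit_expo i (k + l) = unit_expo i k + unit_expo i l.
Proof. by apply/ffunP => j; rewrite !ffunE; case: eqP => _ //; rewrite addr0. Qed.

Lemma unit_expoN i l : unit_expo i (- l) = - unit_expo i l.
Proof. by apply/ffunP => j; rewrite !ffunE; case: eqP => _ //; rewrite oppr0. Qed.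

Lemma vacuum_altern : altern vacuum.
Proof.
move=> s J; rewrite /vacuum -det_perm -det_mulmx -row_permE; congr (\det _).
by apply/matrixP => i j; rewrite !mxE ffunE.
Qed.

Lemma vacuum_staircase : vacuum staircase = 1.
Proof.
rewrite /vacuum -[RHS](det1 _ N); congr (\det _).
by apply/matrixP => i j; rewrite !mxE ffunE eqz_nat.
Qed.

Lemma vacuum_neq0 J : vacuum J != 0 -> exists s : 'S_N, forall i, J i = (s i)%:Z.
Proof.
rewrite /vacuum /determinant => h.
have [s hs] : exists s : 'S_N, \prod_i (\matrix_(i, j) ((J i == j%:Z)%:R : int)) i (s i) != 0.
  apply/existsP; apply: contraNT h; rewrite negb_exists => /forallP h.
  by rewrite big1// => s _; move: (h s); rewrite negbK => /eqP ->; rewrite mulr0.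
exists s => i; move/prodf_neq0: hs => /(_ i isT); rewrite mxE.
by have [//|_] := eqVneq (J i) _; rewrite eqxx.
Qed.

Lemma altern_eq0 psi J i j : altern psi -> i != j -> J i = J j -> psi J = 0.
Proof.
move=> apsi ij Jij.
have := apsi (tperm i j) J; rewrite odd_tperm ij expr1 mulN1r.
have -> : [ffun k => J (tperm i j k)] = J.
  by apply/ffunP => k; rewrite ffunE; case: tpermP => // ->.
lia.
Qed.

Lemma altern_inj psi J i j : altern psi -> psi J != 0 -> J i = J j -> i = j.
Proof.
move=> apsi h Jij; apply/eqP; apply: contraNT h => ij.
by rewrite (altern_eq0 apsi ij Jij).
Qed.

Lemma expoBE J i l j : (J - unit_expo i l) j = J j - (if j == i then l else 0).
Proof. by rewrite !ffunE. Qed.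

Lemma expoDE J i l j : (J + unit_expo i l) j = J j + (if j == i then l else 0).
Proof. by rewrite !ffunE. Qed.

Lemma perm_expoB (s : 'S_N) J i l :
  [ffun j => J (s j)] - unit_expo i l = [ffun j => (J - unit_expo (s i) l) (s j)].
Proof. by apply/ffunP => j; rewrite !ffunE (inj_eq perm_inj). Qed.

Lemma mul_power_altern l psi : altern psi -> altern (mul_power l psi).
Proof.
move=> apsi s J; rewrite /mul_power mulr_sumr [RHS](reindex_inj (@perm_inj _ s)).
by apply: eq_bigr => i _; rewrite perm_expoB apsi.
Qed.

Lemma eq_mul_power l psi chi : psi =1 chi -> mul_power l psi =1 mul_power l chi.
Proof. by move=> h J; apply: eq_bigr. Qed.

Lemma mul_powerC k l psi : mul_power k (mul_power l psi) =1 mul_power l (mul_power k psi).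
Proof.
move=> J; rewrite /mul_power exchange_big /=; apply: eq_bigr => i _.
by apply: eq_bigr => j _; rewrite -!addrA [- unit_expo j _ - _]addrC.
Qed.

Lemma mul_power_neq0 l psi J : mul_power l psi J != 0 -> exists i, psi (J - unit_expo i l) != 0.
Proof.
move=> h; apply/existsP; apply: contraNT h; rewrite negb_exists => /forallP h.
by rewrite /mul_power big1// => i _; move: (h i); rewrite negbK => /eqP.
Qed.

Lemma mul_power_supp_nonneg l psi : 0 <= l -> supp_nonneg psi -> supp_nonneg (mul_power l psi).
Proof.
move=> l0 h J /mul_power_neq0[i /h hi] j; have := hi j; rewrite expoBE.
by case: eqP; lia.
Qed.

(** Only the moved particle can vacate a level [v]. It then lands on [v + l], still below [m] and
    hence occupied already by another particle, which alternation forbids. *)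
Lemma mul_power_filled_below l m psi : 0 < l -> altern psi ->
  filled_below m psi -> filled_below (m - l) (mul_power l psi).
Proof.
move=> l0 apsi h J hJ v v0 vm.
have [i hi] := mul_power_neq0 hJ.
have [j] := h _ hi v v0 ltac:(lia).
have [->|ji] := eqVneq j i; last first.
  by rewrite ?expoBE ?expoDE (negbTE ji) => <-; exists j; rewrite subr0.
rewrite ?expoBE ?expoDE eqxx => Ji.
have [k] := h _ hi (v + l) ltac:(lia) ltac:(lia).
have [->|ki] := eqVneq k i; first by rewrite ?expoBE ?expoDE eqxx; lia.
rewrite ?expoBE ?expoDE (negbTE ki) subr0 => Jk.
have := altern_inj (mul_power_altern l apsi) hJ (_ : J k = J i).
by move/(_ ltac:(lia)) => E; rewrite E eqxx in ki.
Qed.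

(** The two multiplications commute. If [J i < l], undoing the raise of particle [i] takes it below
    the floor, and only a lowering of the same particle can have compensated this: the double sum
    collapses to a single displacement by [k - l]. *)
Lemma mul_power_opp k l chi J : supp_nonneg chi -> 0 <= l -> 0 <= k -> nonneg J ->
  mul_power (- k) (mul_power l chi) J =
  (\sum_(i | l <= J i) mul_power (- k) chi (J - unit_expo i l)) +
  \sum_(i | J i < l) chi (J + unit_expo i (k - l)).
Proof.
move=> hchi l0 k0 J0; rewrite mul_powerC {1}/mul_power (bigID (fun i => l <= J i)) /=.
congr (_ + _); apply: eq_big => i; first by rewrite -ltNge.
rewrite -ltNge => Jil; rewrite /mul_power (bigD1 i)//= big1 ?addr0.
  by rewrite -addrA -opprD addrC -unit_expoD -unit_expoN addrC; congr (chi (_ + unit_expo _ _)); lia.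
move=> j ji; apply/eqP/negP => /negP /hchi/(_ i).
rewrite ?expoBE ?expoDE eqxx eq_sym (negbTE ji); lia.
Qed.

(* Pauli exclusion: moving one of the particles occupying a full interval of
   levels inside that interval produces an occupied level. *)
Lemma exclusion (P : pred int) chi k J : k != 0 -> altern chi ->
  (forall K i, chi K != 0 -> P (K i - k) -> exists j, K j = K i - k) ->
  \sum_(i | P (J i)) chi (J + unit_expo i k) = 0.
Proof.
move=> k0 achi h.
(* As a function of [J] the sum alternates, so it vanishes when two particles share a level, and [J]
   may be taken injective. *)
pose C J := \sum_(i | P (J i)) chi (J + unit_expo i k).
have aC : altern C.
  move=> s K; rewrite /C mulr_sumr [RHS](reindex_inj (@perm_inj _ s)) /=.
  apply: eq_big => i; rewrite ?ffunE// => _.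
  by rewrite -[unit_expo i k]opprK -unit_expoN perm_expoB achi unit_expoN opprK.
have [/existsP[i /existsP[j /andP[ij /eqP Jij]]]|] :=
    boolP [exists i, exists j, (i != j) && (J i == J j)].
  exact: (altern_eq0 aC ij Jij).
rewrite negb_exists => /forallP Jinj.
apply: big1 => i Pi; apply/eqP/negP => /negP hi.
have [j] : exists j, (J + unit_expo i k) j = J i.
  by have := h _ i hi; rewrite expoDE eqxx addrK; apply.
rewrite expoDE; have [->|ji] := eqVneq j i; first by lia.
rewrite addr0 => Jij; move: (Jinj j); rewrite negb_exists => /forallP/(_ i).
by rewrite ji Jij eqxx.
Qed.

(** Alternation makes the occupied levels distinct, so each level from 0 to m - 1 holds exactly one
    particle. *)
Lemma card_filled_below (m : nat) psi J : altern psi -> filled_below m%:Z psi ->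
  psi J != 0 -> nonneg J -> #|[pred i | J i < m%:Z]| = m.
Proof.
move=> apsi fpsi hJ J0.
rewrite -[RHS](size_iota 0) cardE -(size_map (fun i => `|J i|%N)).
apply/perm_size/uniq_perm; rewrite ?iota_uniq//.
  rewrite map_inj_in_uniq ?enum_uniq// => i j _ _ Jij.
  by apply: (altern_inj apsi hJ); have := J0 i; have := J0 j; lia.
move=> v; rewrite mem_iota add0n leq0n /=; apply/mapP/idP => [h|vm].
  by case: h => i; rewrite mem_enum inE => Jim ->; have := J0 i; lia.
have [i Ji] := fpsi _ hJ v%:Z isT vm.
by exists i; rewrite ?mem_enum ?inE Ji.
Qed.

Lemma vacuum_supp_nonneg : supp_nonneg vacuum.
Proof. by move=> J /vacuum_neq0[s hs] i; rewrite hs. Qed.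

Lemma vacuum_filled_below : filled_below N vacuum.
Proof.
move=> J /vacuum_neq0[s hs] v v0 vN.
have vN' : (`|v| < N)%N by lia.
by exists (s^-1%g (Ordinal vN')); rewrite hs permKV /=; lia.
Qed.

Definition word (w : seq int) := foldr mul_power vacuum w.

Lemma word_altern w : altern (word w).
Proof. by elim: w => [|l w]; [exact: vacuum_altern|exact: mul_power_altern]. Qed.

Lemma word_catCA u l v : word (u ++ l :: v) =1 word (l :: u ++ v).
Proof.
elim: u => [//|k u IH] J /=; rewrite (eq_mul_power _ IH) /=.
exact: mul_powerC.
Qed.

Lemma perm_word u v : perm_eq u v -> word u =1 word v.
Proof.
elim: u v => [|l u IH] v uv J; first by move: uv; rewrite perm_sym => /perm_nilP ->.
have /splitPr vE : l \in v by rewrite -(perm_mem uv) mem_head.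
case: vE uv => v1 v2; rewrite perm_sym -cat1s perm_catCA /= perm_cons perm_sym => uv.
by rewrite word_catCA /=; apply: eq_mul_power; exact: IH.
Qed.

Definition pos_word (lam : seq nat) := word [seq n%:Z | n <- lam].

Lemma pos_word_supp_nonneg lam : supp_nonneg (pos_word lam).
Proof.
elim: lam => [|l lam IH]; first exact: vacuum_supp_nonneg.
exact: mul_power_supp_nonneg.
Qed.

(** Each multiplication of degree [l] disturbs at most the top [l] levels of the sea that is
    left. *)
Lemma pos_word_filled_below lam : all (leq 1) lam -> (sumn lam <= N)%N ->
  filled_below (N%:Z - (sumn lam)%:Z) (pos_word lam).
Proof.
elim: lam => [_ _|l lam IH /= /andP[l0 lam0] h] /=.
  by rewrite subr0; exact: vacuum_filled_below.
have -> : N%:Z - (l + sumn lam)%:Z = N%:Z - (sumn lam)%:Z - l%:Z by lia.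
by apply: mul_power_filled_below; [|exact: word_altern|apply: IH => //; lia].
Qed.

Lemma mul_power_supp l psi J : supp_nonneg psi ->  nonneg J ->
  \sum_(i | l <= J i) psi (J - unit_expo i l) = mul_power l psi J.
Proof.
move=> hpsi J0; rewrite /mul_power [RHS](bigID (fun i => l <= J i)) /= [X in _ + X]big1 ?addr0//.
move=> i; rewrite -ltNge => Jil; apply/eqP/negP => /negP/hpsi/(_ i).
by rewrite ?expoBE ?expoDE eqxx; lia.
Qed.

Lemma nonneg_sub J i l : nonneg J -> l <= J i -> nonneg (J - unit_expo i l).
Proof. by move=> J0 h j; have := J0 j; rewrite ?expoBE ?expoDE; case: eqP => [->|]; lia. Qed.

Lemma nonneg_add J i l : nonneg J -> 0 <= l -> nonneg (J + unit_expo i l).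
Proof. by move=> J0 h j; have := J0 j; rewrite ?expoBE ?expoDE; case: eqP => [->|]; lia. Qed.

Lemma staircase_nonneg : nonneg staircase.
Proof. by move=> i; rewrite ffunE. Qed.

(* A bosonic Wick rule, valid as long as the total degree does not reach the
   bottom of the Fermi sea. *)
Lemma wick (k : nat) lam J : (0 < k)%N -> all (leq 1) lam -> (sumn lam <= N)%N -> nonneg J ->
  mul_power (- k%:Z) (pos_word lam) J =
  (count_mem k lam * k)%:Z * pos_word (rem k lam) J.
Proof.
move=> k0; elim: lam J => [|l lam IH] J.
  move=> _ _ J0 /=; rewrite mul0r.
  have := @exclusion (fun x => 0 <= x) vacuum k%:Z J ltac:(lia) vacuum_altern.
  rewrite (eq_bigl xpredT) => [<-|i]; last exact: J0.
    by apply: eq_bigr => i _; rewrite unit_expoN opprK.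
  move=> K i hK h0; have [s hs] := vacuum_neq0 hK.
  by apply: (vacuum_filled_below hK) => //; rewrite hs in h0 *; have := ltn_ord (s i); lia.
move=> /= /andP[l0 lam0] hN J0.
rewrite (mul_power_opp (@pos_word_supp_nonneg _))// (eq_bigr (fun i => (count_mem k lam * k)%:Z * pos_word (rem k lam) (J - unit_expo i l%:Z))); last first.
  by move=> i li; rewrite IH//; [lia|exact: nonneg_sub].
rewrite -mulr_sumr (mul_power_supp _ (@pos_word_supp_nonneg _))// [X in X + _]mulrC.
have a := @word_altern [seq n%:Z | n <- lam].
have fil := pos_word_filled_below lam0 ltac:(lia).
(* For [l] different from [k] the boundary term moves a particle lying in the filled interval [0, l)
   and vanishes by exclusion. For [l = k] nothing moves, and the term counts the particles below
   level [k], of which there are [k]. *)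
have [lk|kl] := eqVneq l k; last first.
  rewrite (eq_bigl (fun i => 0 <= J i < l%:Z)); last by move=> i; rewrite J0.
  rewrite (@exclusion (fun x => 0 <= x < l%:Z) _ _ _ _ a); first by rewrite addr0 add0n mulrC.
    by lia.
  by move=> K i hK hi; apply: (fil _ hK); lia.
rewrite lk subrr; under eq_bigr do rewrite unit_expo0 addr0.
have -> : mul_power k (pos_word (rem k lam)) J * (count_mem k lam * k)%:Z =
    pos_word lam J * (count_mem k lam * k)%:Z.
  have [->|c] := posnP (count_mem k lam); first by rewrite mul0n !mulr0.
  have klam : k \in lam by rewrite -has_pred1 has_count.
  congr (_ * _); symmetry.
  by apply: (@perm_word _ (_ :: map Posz _)); exact: (perm_map Posz (perm_to_rem klam)).
rewrite sumr_const.
have [/eqP ->|h] := boolP (pos_word lam J == 0); first by rewrite mul0rn !mulr0 mul0r.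
rewrite (@card_filled_below k _ _ a) //; first by rewrite -mulr_natr natz mulnDl PoszD mul1n; ring.
by move=> K hK v v0 vk; apply: (fil _ hK) => //; lia.
Qed.

(* [moment ks] is the CUE expectation of the product of the [|p_k|^2], for [k] in [ks]. *)
Definition moment (ks : seq nat) : int :=
  word ([seq - n%:Z | n <- ks] ++ [seq n%:Z | n <- ks]) staircase.

(** [wick] holds at nonnegative configurations only. Lowering operators evaluate their argument at
    configurations shifted upwards, so this restriction is preserved under them. *)
Lemma eq_lowering (c : int) (ks : seq nat) psi chi : (forall J, nonneg J -> psi J = c * chi J) ->
  forall J, nonneg J ->
  foldr mul_power psi [seq - n%:Z | n <- ks] J = c * foldr mul_power chi [seq - n%:Z | n <- ks] J.
Proof.
move=> h; elim: ks => [//|k ks IH] J J0 /=; rewrite /mul_power mulr_sumr.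
by apply: eq_bigr => i _; rewrite unit_expoN opprK IH//; exact: nonneg_add.
Qed.

Lemma moment_perm ks ks' : perm_eq ks ks' -> moment ks = moment ks'.
Proof. by move=> h; apply: perm_word; apply: perm_cat; exact: perm_map. Qed.

Lemma momentE ks : moment ks =
  foldr mul_power (pos_word ks) [seq - n%:Z | n <- ks] staircase.
Proof. by rewrite /moment /word foldr_cat. Qed.

(** The factor is the ratio of consecutive moments, m! k^m, of an exponential variable of mean
    [k]. *)
Lemma moment_cons (k : nat) ks : (0 < k)%N -> all (leq 1) ks -> (k + sumn ks <= N)%N ->
  moment (k :: ks) = (k * (count_mem k ks).+1)%:Z * moment ks.
Proof.
move=> k0 ks0 hN.
have -> : moment (k :: ks) =
    foldr mul_power (mul_power (- k%:Z) (pos_word (k :: ks))) [seq - n%:Z | n <- ks] staircase.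
  by rewrite /moment map_cons cat_cons -word_catCA /word foldr_cat.
rewrite (@eq_lowering (k * (count_mem k ks).+1)%:Z ks _ (pos_word ks)) ?momentE//; last first.
  exact: staircase_nonneg.
move=> J J0; rewrite wick//=; last by rewrite k0.
by rewrite eqxx mulnC add1n.
Qed.

(** * Covariances of squared power sums in arbitrary degree *)

Section Covariance.

Lemma vacuum_count (s : nat) J : vacuum J != 0 -> #|[pred i | J i < s%:Z]| = minn s N.
Proof.
move=> hJ.
have [sN|Ns] := leqP s N.
  apply: (card_filled_below vacuum_altern _ hJ (vacuum_supp_nonneg hJ)).
  by move=> K hK v v0 vs; apply: (vacuum_filled_below hK) => //; lia.
have [p hp] := vacuum_neq0 hJ.
rewrite -[RHS]card_ord; apply: eq_card => i; rewrite !inE hp.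
by have := ltn_ord (p i); lia.
Qed.

Lemma lower_vacuum (s : nat) J : (0 < s)%N -> nonneg J -> mul_power (- s%:Z) vacuum J = 0.
Proof.
by move=> s0 J0; rewrite (@wick s [::])//= mul0r.
Qed.

(** The order [t <= s] replaces the degree bound of [wick]: the boundary move aims at a level not
    above an occupied one, hence inside the sea. High degrees only saturate the count at [N]. *)
Lemma lower_raise_vacuum (s t : nat) J : (0 < t)%N -> (t <= s)%N -> nonneg J ->
  mul_power (- s%:Z) (mul_power t%:Z vacuum) J = if s == t then (minn s N)%:Z * vacuum J else 0.
Proof.
move=> t0 ts J0; rewrite (mul_power_opp vacuum_supp_nonneg)//.
rewrite big1 ?add0r; last first.
  by move=> i ti; rewrite lower_vacuum//; [lia|exact: nonneg_sub].
have [<-|st] := eqVneq s t.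
  rewrite subrr; under eq_bigr do rewrite unit_expo0 addr0.
  rewrite sumr_const.
  have [/eqP ->|h] := boolP (vacuum J == 0); first by rewrite mul0rn mulr0.
  by rewrite vacuum_count// -mulr_natr; lia.
rewrite (eq_bigl (fun i => 0 <= J i < t%:Z)); last by move=> i; rewrite J0.
apply: (@exclusion (fun x => 0 <= x < t%:Z)); [lia|exact: vacuum_altern|].
move=> K i hK hi; apply: (vacuum_filled_below hK); first by lia.
by have [p hp] := vacuum_neq0 hK; rewrite hp in hi *; have := ltn_ord (p i); lia.
Qed.

(** Raising level [j] of the staircase by [t] either leaves the sea, and then this is the only way
    to reach the configuration, or lands on an occupied level and is excluded. *)
Lemma raised_vacuum (t : nat) j : (0 < t)%N ->
  mul_power t%:Z vacuum (staircase + unit_expo j t%:Z) = (N <= j + t)%:Z.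
Proof.
move=> t0; have [Nj|jN] := leqP N (j + t).
  rewrite /mul_power (bigD1 j)//= addrK vacuum_staircase big1 ?addr0// => i ij.
  apply/eqP/negP => /negP/vacuum_neq0[p /(_ j)].
  rewrite expoBE expoDE ffunE eqxx eq_sym (negbTE ij).
  by have := ltn_ord (p j); lia.
apply: (@altern_eq0 _ _ j (Ordinal jN)).
- exact: mul_power_altern vacuum_altern.
- by apply/eqP => /(congr1 val) /=; lia.
rewrite !expoDE !ffunE eqxx /= ifF; first by lia.
by apply/negP => /eqP /(congr1 val) /=; lia.
Qed.

Lemma count_raised (s t : nat) j : (0 < t)%N -> (N <= j + t)%N ->
  #|[pred i | (staircase + unit_expo j t%:Z) i < s%:Z]|%:Z =
  (minn s N)%:Z - (j < s <= j + t)%:Z.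
Proof.
move=> t0 Nj.
rewrite -(@vacuum_count s staircase) ?vacuum_staircase//.
rewrite (cardD1 j) [in RHS](cardD1 j) !inE expoDE !ffunE eqxx.
set A := #|_|; set B := #|_|; have -> : B = A.
  apply: eq_card => i; rewrite !inE expoDE !ffunE.
  by case: eqP => //= _; rewrite addr0.
lia.
Qed.

Lemma moment1 (t : nat) : (0 < t)%N -> moment [:: t] = (minn t N)%:Z.
Proof.
move=> t0; rewrite momentE /= lower_raise_vacuum ?eqxx ?vacuum_staircase ?mulr1//.
exact: staircase_nonneg.
Qed.

(** Both sides evaluate the same moment; the left one counts the particles able to leave the sea by
    a jump of [t]. *)
Lemma moment1E (t : nat) : (0 < t)%N -> \sum_(j < N) (N <= j + t)%:Z = (minn t N)%:Z.
Proof.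
move=> t0; rewrite -moment1// momentE /pos_word /word /= {1}/mul_power.
by apply: eq_bigr => j _; rewrite unit_expoN opprK raised_vacuum.
Qed.

(** With the lowering by [t] outermost, only the staircase with one particle raised by [t] has to be
    examined. Moving the lowering by [s] past the raising by [s] counts its particles below [s], one
    fewer than in the sea if the raised particle crossed level [s]. *)
Lemma moment2 (s t : nat) : (0 < t)%N -> (t <= s)%N ->
  moment [:: s; t] = (minn s N)%:Z * (minn t N)%:Z - \sum_(j < N) ((N <= j + t) && (j < s <= j + t))%N%:Z
   + (if s == t then (minn s N)%:Z ^+ 2 else 0).
Proof.
move=> t0 ts.
have -> : moment [:: s; t] =
    mul_power (- t%:Z) (mul_power (- s%:Z) (mul_power s%:Z (mul_power t%:Z vacuum))) staircase.
  exact: mul_powerC.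
have -> : mul_power (- t%:Z) (mul_power (- s%:Z) (mul_power s%:Z (mul_power t%:Z vacuum))) staircase =
  \sum_(j < N) (((minn s N)%:Z - (j < s <= j + t)%:Z) * (N <= j + t)%:Z +
    (if s == t then (minn s N)%:Z else 0) * (N <= j + t)%:Z).
  rewrite {1}/mul_power; apply: eq_bigr => j _; rewrite unit_expoN opprK.
  set J := staircase + _.
  have J0 : nonneg J by apply: nonneg_add => //; exact: staircase_nonneg.
  rewrite (mul_power_opp (mul_power_supp_nonneg _ vacuum_supp_nonneg))// addrC; congr (_ + _).
    rewrite subrr; under eq_bigr do rewrite unit_expo0 addr0.
    rewrite sumr_const raised_vacuum//.
    have [Nj|_] := leqP N (j + t); last by rewrite mul0rn mulr0.
    by rewrite mulr1 -(count_raised s t0 Nj) -mulr_natr mul1r natz.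
  rewrite (eq_bigr (fun i => (if s == t then (minn s N)%:Z else 0) * vacuum (J - unit_expo i s%:Z))); last first.
    move=> i si; rewrite lower_raise_vacuum//; last exact: nonneg_sub.
    by case: eqP => //; rewrite mul0r.
  rewrite -mulr_sumr (mul_power_supp _ vacuum_supp_nonneg)//.
  have [st|] := eqVneq s t; last by rewrite !mul0r.
  by rewrite /J st raised_vacuum.
rewrite big_split /= -mulr_sumr moment1E//.
under eq_bigr do rewrite mulrBl.
rewrite sumrB -mulr_sumr moment1E//.
congr (_ - _ + _).
  by apply: eq_bigr => j _; rewrite -PoszM mulnb andbC.
by have [->|] := eqVneq s t; rewrite ?mul0r// expr2.
Qed.

End Covariance.
End Fermions.

Section CovarianceForm.
Variable N : nat.

Lemma sum_nat_itv (m n u v : nat) : (\sum_(m <= t < n) (u <= t < v) <= v - u)%N.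
Proof.
(* The bound has to depend on [n] for the induction to close. *)
suff : (\sum_(m <= t < n) (u <= t < v) <= minn n v - u)%N.
  by move/leq_trans; apply; rewrite leq_sub2r// geq_minr.
elim: n => [|n IH]; first by rewrite big_geq.
have [mn|nm] := leqP m n; last by rewrite big_geq.
by rewrite big_nat_recr//=; move: IH; set S := bigop _ _ _; lia.
Qed.

(** For 0 < t < s this is minus the covariance of the squared power sums of degrees [s] and [t]. *)
Let crossings (s t : nat) := (\sum_(j < N) ((N <= j + t) && (j < s <= j + t)))%N.

Let cov_bound (s t : nat) :=
  ((s == t) * N ^ 2 + (t < s) * crossings s t + (s < t) * crossings t s)%N.

(** One N^2 comes from the diagonal and one from each side of it: for fixed [s] and [j] the crossing
    condition confines [t] to an interval of length at most [j < N], adjacent to [s]. *)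
Lemma sum_cov_bound (m n s : nat) : (\sum_(m <= t < n) cov_bound s t <= 3 * N ^ 2)%N.
Proof.
rewrite !big_split /= -addnA [leqRHS]mulSn; apply: leq_add.
  rewrite -big_distrl /= -[leqRHS]mul1n leq_mul2r; apply/orP; right.
  apply: (@leq_trans (\sum_(m <= t < n) (s <= t < s.+1))%N).
    by apply: leq_sum => t _; lia.
  by apply: leq_trans (sum_nat_itv m n s s.+1) _; lia.
have N2 : (\sum_(j < N) N = N ^ 2)%N by rewrite sum_nat_const card_ord.
rewrite mul2n -addnn -!N2; apply: leq_add; under eq_bigr do rewrite big_distrr /=;
  rewrite exchange_big /=; apply: leq_sum => j _.
  apply: (@leq_trans (\sum_(m <= t < n) (s - j <= t < s))%N); last first.
    by apply: leq_trans (sum_nat_itv _ _ _ _) _; have := ltn_ord j; lia.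
  by apply: leq_sum => t _; lia.
apply: (@leq_trans (\sum_(m <= t < n) (s.+1 <= t < s.+1 + j))%N); last first.
  by apply: leq_trans (sum_nat_itv _ _ _ _) _; have := ltn_ord j; lia.
by apply: leq_sum => t _; lia.
Qed.

Lemma covarianceC s t : moment N [:: s; t] = moment N [:: t; s].
Proof. by apply: moment_perm; rewrite (perm_catC [:: s] [:: t]). Qed.

Lemma covariance_le (R : realDomainType) (a : nat -> R) (s t : nat) : (0 < s)%N -> (0 < t)%N ->
  a s * a t * (moment N [:: s; t] - moment N [:: s] * moment N [:: t])%:~R *+ 2 <=
  (a s ^+ 2 + a t ^+ 2) * (cov_bound s t)%:R.
Proof.
wlog ts : s t / (t <= s)%N => [th s0 t0|s0 t0].
  have [/th->//|st] := leqP t s.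
  rewrite covarianceC [a s * _]mulrC [moment N [:: s] * _]mulrC.
  apply: le_trans (th t s (ltnW st) t0 s0) _.
  rewrite addrC (_ : cov_bound t s = cov_bound s t)//.
  by rewrite /cov_bound eq_sym; lia.
rewrite moment2// !moment1//.
have -> : \sum_(j < N) ((N <= j + t) && (j < s <= j + t))%N%:Z = (crossings s t)%:Z.
  by rewrite /crossings -[RHS]natz raddf_sum /=; apply: eq_bigr => j _; rewrite natz.
rewrite /cov_bound; case: ltngtP ts => // [ts _|<- _].
  rewrite mul0n mul1n mul0n addn0 add0n addr0 addrAC subrr add0r.
  rewrite rmorphN /= -pmulrn.
  have := sqr_ge0 (a s + a t).
  have : 0 <= (crossings s t)%:R :> R by [].
  set c := _%:R; set x := a s; set y := a t; nra.
set c := (_ + _ + _)%N; have -> : c = (N ^ 2)%N by rewrite /c /=; lia.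
rewrite -!expr2 -mulr2n [leRHS]mulrnAl lerMn2r /=.
apply: ler_wpM2l; first exact: sqr_ge0.
rewrite [leRHS](_ : _ = (N ^ 2)%:Z%:~R) // ler_int.
have : (minn t N)%:Z ^+ 2 <= (N ^ 2)%:Z.
  have : (minn t N <= N)%N by lia.
  by rewrite expr2; nia.
lia.
Qed.

(** Schur's test: a symmetric matrix with row sums at most 3 N^2 defines a quadratic form bounded by
    3 N^2 times the squared norm. *)
Lemma covariance_form_le (R : realFieldType) (a : nat -> R) (m n : nat) : (0 < m)%N ->
  \sum_(m <= s < n) \sum_(m <= t < n)
    a s * a t * (moment N [:: s; t] - moment N [:: s] * moment N [:: t])%:~R <=
  3 * N%:R ^+ 2 * \sum_(m <= s < n) a s ^+ 2.
Proof.
move=> m0.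
have : (\sum_(m <= s < n) \sum_(m <= t < n)
    a s * a t * (moment N [:: s; t] - moment N [:: s] * moment N [:: t])%:~R) *+ 2 <=
  \sum_(m <= s < n) \sum_(m <= t < n) (a s ^+ 2 + a t ^+ 2) * (cov_bound s t)%:R.
  rewrite -sumrMnl; apply: ler_sum_nat => s /andP[ms _].
  rewrite -sumrMnl; apply: ler_sum_nat => t /andP[mt _].
  by apply: covariance_le; [exact: leq_trans ms|exact: leq_trans mt].
have -> : \sum_(m <= s < n) \sum_(m <= t < n) (a s ^+ 2 + a t ^+ 2) * (cov_bound s t)%:R =
  (\sum_(m <= s < n) \sum_(m <= t < n) a s ^+ 2 * (cov_bound s t)%:R) *+ 2.
  under eq_bigr do under eq_bigr do rewrite mulrDl.
  under eq_bigr do rewrite big_split.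
  rewrite big_split /= mulr2n; congr (_ + _).
  rewrite exchange_big /=; apply: eq_bigr => s _; apply: eq_bigr => t _.
  by congr (_ * _%:R); rewrite /cov_bound eq_sym; lia.
rewrite lerMn2r /= => /le_trans; apply.
rewrite mulr_sumr; apply: ler_sum => s _.
rewrite -mulr_sumr mulrC ler_wpM2r ?sqr_ge0// -natr_sum -natrX -natrM ler_nat.
exact: sum_cov_bound.
Qed.

End CovarianceForm.

(** * The law of the eigenvalues *)

Section FunctionalDensity.
Local Open Scope ereal_scope.
Import HBNNSimple.

(* [Phi] is iterated or Lebesgue integration. *)
Lemma functional_density d (T : measurableType d) (R : realType) (m : {measure set T -> \bar R})
    (Phi : (T -> \bar R) -> \bar R) (w : T -> R) :
  (forall (s : seq R) (g : R -> T -> \bar R), (forall i, measurable_fun setT (g i)) ->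
    (forall i t, 0 <= g i t) -> Phi (fun t => \sum_(i <- s) g i t) = \sum_(i <- s) Phi (g i)) ->
  (forall (c : R) g, (0 <= c)%R -> measurable_fun setT g -> (forall t, 0 <= g t) ->
    Phi (fun t => c%:E * g t) = c%:E * Phi g) ->
  (forall (g : (T -> \bar R)^nat) l, (forall k, measurable_fun setT (g k)) ->
    (forall k t, 0 <= g k t) -> (forall t, {homo (g ^~ t) : i j / (i <= j)%N >-> i <= j}) ->
    (forall t, g ^~ t @ \oo --> l t) -> Phi (g k) @[k --> \oo] --> Phi l) ->
  measurable_fun setT w -> (forall t, (0 <= w t)%R) ->
  (forall A, measurable A -> m A = Phi (fun t => (w t * \1_A t)%:E)) ->
  forall g : T -> \bar R, measurable_fun setT g -> (forall t, 0 <= g t) ->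
  \int[m]_t g t = Phi (fun t => (w t)%:E * g t).
Proof.
move=> PhiD PhiZ Phi_cvg mw w0 mE g mg g0.
pose h := nnsfun_approx measurableT mg.
have hg t : (EFin \o h ^~ t) @ \oo --> g t.
  by apply: cvg_nnsfun_approx => // x _; exact: g0.
have ndh t : {homo (fun k => h k t) : i j / (i <= j)%N >-> (i <= j)%R}.
  by move=> i j ij; exact/lefP/nd_nnsfun_approx.
have hint k : \int[m]_t (h k t)%:E = Phi (fun t => (w t)%:E * (h k t)%:E).
  rewrite integralT_nnsfun sintegralE fsbig_finite//=.
  have mi i : measurable_fun setT (fun t => w t * \1_(h k @^-1` [set i]) t)%R.
    by apply: measurable_funM => //; exact: measurable_indic.
  (* A negative [i] is harmless: its level set is empty because [h k] is nonnegative. *)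
  have i0 i t : (0 <= i * (w t * \1_(h k @^-1` [set i]) t))%R.
    rewrite indicE; have [/set_mem/= <-|_] := boolP (t \in _); last by rewrite !mulr0.
    by rewrite !mulr_ge0.
  rewrite (_ : (fun t => _ * _) = fun t => \sum_(x <- fset_set (range (h k)))
      (x * (w t * \1_(h k @^-1` [set x]) t))%:E); last first.
    apply/funext => t; rewrite fimfunE /= fsbig_finite//= -EFinM mulr_sumr -sumEFin.
    by under eq_bigr do rewrite mulrCA.
  rewrite PhiD.
  - apply: eq_big_seq => i; rewrite in_fset_set// => /set_mem[t _ <-].
    rewrite mE// -PhiZ//.
    + by apply/measurable_EFinP; exact: mi.
    + by move=> s; rewrite lee_fin mulr_ge0.
  - by move=> i; apply/measurable_EFinP; apply: measurable_funM.
  - by move=> i t; rewrite lee_fin.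
have l1 : \int[m]_t (h k t)%:E @[k --> \oo] --> \int[m]_t g t.
  rewrite [X in _ --> X](_ : _ = \int[m]_t limn (fun k => (h k t)%:E)); last first.
    by apply: eq_integral => t _; apply/esym/cvg_lim => //; exact: hg.
  apply: cvg_monotone_convergence => //.
  - by move=> k; exact/measurable_EFinP.
  - by move=> k t _; rewrite lee_fin.
  - by move=> t _ i j ij; rewrite lee_fin; exact: ndh.
have l2 : \int[m]_t (h k t)%:E @[k --> \oo] --> Phi (fun t => (w t)%:E * g t).
  rewrite (_ : (fun k => \int[m]_t (h k t)%:E) =
    fun k => Phi (fun t => (w t)%:E * (h k t)%:E)); last by apply/funext => k.
  apply: Phi_cvg.
  - by move=> k; apply: emeasurable_funM; exact/measurable_EFinP.
  - by move=> k t; rewrite mule_ge0// lee_fin.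
  - by move=> t i j ij; rewrite lee_wpmul2l ?lee_fin//; exact: ndh.
  - move=> t; have [->|wt0] := eqVneq (w t) 0%R.
      by rewrite mul0e; under eq_fun do rewrite mul0e; exact: cvg_cst.
    by apply: cvgeZl => //; exact: hg.
by rewrite -(cvg_lim _ l1)// -(cvg_lim _ l2).
Qed.

End FunctionalDensity.

(** * Iterated integrals of nonnegative functions *)

Section TupleIntegral.
Context {R : realType}.
Local Notation mu := (@lebesgue_measure R).
Local Open Scope ereal_scope.

Lemma eq_tuple_integral n (g h : n.-tuple R -> \bar R) :
  g =1 h -> tuple_integral g = tuple_integral h.
Proof. by move=> gh; congr tuple_integral; exact/funext. Qed.

Lemma tuple_integral_ge0 n (g : n.-tuple R -> \bar R) :
  (forall t, 0 <= g t) -> 0 <= tuple_integral g.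
Proof.
elim: n g => [|n IH] g g0 /=; first exact: g0.
by apply: integral_ge0 => x _; exact: IH.
Qed.

(** The parameter space is arbitrary so that the induction can absorb the first coordinate into it
    and then integrate that coordinate by Tonelli. *)
Lemma measurable_fun_tuple_integral d (Z : measurableType d) n
    (g : Z -> n.-tuple R -> \bar R) :
  measurable_fun setT (fun zt : Z * n.-tuple R => g zt.1 zt.2) ->
  (forall z t, 0 <= g z t) ->
  measurable_fun setT (fun z => tuple_integral (g z)).
Proof.
elim: n d Z g => [|n IH] d Z g mg g0 /=.
  have mp : measurable_fun setT (fun z : Z => (z, [tuple] : 0.-tuple R)) by exact: measurable_fun_pair.
  exact: (measurableT_comp mg mp).
pose G (zx : Z * measurableTypeR R) := tuple_integral (fun t : n.-tuple R => g zx.1 [tuple of zx.2 :: t]).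
apply: (@measurable_fun_fubini_tonelli_F _ _ Z (measurableTypeR R) R mu G); last first.
  by move=> zx; apply: tuple_integral_ge0 => t; exact: g0.
apply: IH => [|zx t]; last exact: g0.
have mp : measurable_fun setT (fun zxt : (Z * measurableTypeR R) * n.-tuple R =>
    (zxt.1.1, [tuple of zxt.1.2 :: zxt.2] : n.+1.-tuple R)).
  apply: measurable_fun_pair => /=.
    exact: (measurableT_comp measurable_fst measurable_fst).
  apply: measurable_cons; last by [].
  exact: (measurableT_comp measurable_snd measurable_fst).
exact: (measurableT_comp mg mp).
Qed.

Lemma measurable_tuple_integral_cons n (g : n.+1.-tuple R -> \bar R) :
  measurable_fun setT g -> (forall t, 0 <= g t) ->
  measurable_fun setT (fun x : measurableTypeR R => tuple_integral (fun t : n.-tuple R => g [tuple of x :: t])).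
Proof.
move=> mg g0; apply: measurable_fun_tuple_integral => [|z t]; last exact: g0.
have mp : measurable_fun setT
    (fun xt : measurableTypeR R * n.-tuple R => [tuple of xt.1 :: xt.2] : n.+1.-tuple R).
  exact: measurable_cons.
exact: (measurableT_comp mg mp).
Qed.

Lemma measurable_fun_cons n (g : n.+1.-tuple R -> \bar R) (x : R) :
  measurable_fun setT g -> measurable_fun setT (fun t : n.-tuple R => g [tuple of x :: t]).
Proof.
move=> mg.
have mp : measurable_fun setT (fun t : n.-tuple R => [tuple of x :: t] : n.+1.-tuple R).
  exact: measurable_cons.
exact: (measurableT_comp mg mp).
Qed.

Lemma le_tuple_integral n (g h : n.-tuple R -> \bar R) :
  measurable_fun setT g -> measurable_fun setT h ->
  (forall t, 0 <= g t) -> (forall t, g t <= h t) -> tuple_integral g <= tuple_integral h.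
Proof.
elim: n g h => [|n IH] g h mg mh g0 gh /=; first exact: gh.
have h0 t : 0 <= h t by exact: le_trans (g0 t) (gh t).
apply: ge0_le_integral => //.
- by move=> x _; exact: tuple_integral_ge0.
- exact: measurable_tuple_integral_cons.
- exact: measurable_tuple_integral_cons.
- by move=> x _; apply: IH => //; exact: measurable_fun_cons.
Qed.

Lemma tuple_integralD n (g h : n.-tuple R -> \bar R) :
  measurable_fun setT g -> measurable_fun setT h ->
  (forall t, 0 <= g t) -> (forall t, 0 <= h t) ->
  tuple_integral (fun t => g t + h t) = tuple_integral g + tuple_integral h.
Proof.
elim: n g h => [|n IH] g h mg mh g0 h0 //=.
rewrite -ge0_integralD//.
- by apply: eq_integral => x _; rewrite IH//; exact: measurable_fun_cons.
- by move=> x _; exact: tuple_integral_ge0.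
- exact: measurable_tuple_integral_cons.
- by move=> x _; exact: tuple_integral_ge0.
- exact: measurable_tuple_integral_cons.
Qed.

Lemma tuple_integral0 n : tuple_integral (fun _ : n.-tuple R => 0) = 0.
Proof.
elim: n => [//|n IH] /=.
by rewrite IH integral0.
Qed.

Lemma tuple_integral_sum n (I : Type) (s : seq I) (g : I -> n.-tuple R -> \bar R) :
  (forall i, measurable_fun setT (g i)) -> (forall i t, 0 <= g i t) ->
  tuple_integral (fun t => \sum_(i <- s) g i t) = \sum_(i <- s) tuple_integral (g i).
Proof.
move=> mg g0; elim: s => [|i s IH].
  rewrite big_nil -[RHS](tuple_integral0 n); apply: eq_tuple_integral => t.
  by rewrite big_nil.
rewrite big_cons -IH -tuple_integralD//.
- by apply: eq_tuple_integral => t; rewrite big_cons.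
- exact: emeasurable_sum.
- by move=> t; exact: sume_ge0.
Qed.

Lemma tuple_integralZl n (c : R) (g : n.-tuple R -> \bar R) :
  (0 <= c)%R -> measurable_fun setT g -> (forall t, 0 <= g t) ->
  tuple_integral (fun t => c%:E * g t) = c%:E * tuple_integral g.
Proof.
move=> c0; elim: n g => [//|n IH] g mg g0 /=.
rewrite -ge0_integralZl//.
- by apply: eq_integral => x _; rewrite IH//; exact: measurable_fun_cons.
- exact: measurable_tuple_integral_cons.
- by move=> x _; exact: tuple_integral_ge0.
Qed.

Lemma cvg_tuple_integral n (g : (n.-tuple R -> \bar R)^nat) (l : n.-tuple R -> \bar R) :
  (forall k, measurable_fun setT (g k)) -> (forall k t, 0 <= g k t) ->
  (forall t, {homo (g ^~ t) : i j / (i <= j)%N >-> i <= j}) ->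
  (forall t, g ^~ t @ \oo --> l t) ->
  tuple_integral (g k) @[k --> \oo] --> tuple_integral l.
Proof.
elim: n g l => [|n IH] g l mg g0 ndg gl /=; first exact: gl.
pose G k x := tuple_integral (fun t : n.-tuple R => g k [tuple of x :: t]).
have Gl x : G k x @[k --> \oo] --> tuple_integral (fun t : n.-tuple R => l [tuple of x :: t]).
  by apply: IH => // k; exact: measurable_fun_cons.
rewrite [X in _ --> X](_ : _ = \int[mu]_x limn (G ^~ x)); last first.
  by apply: eq_integral => x _; apply/esym/cvg_lim.
apply: (@cvg_monotone_convergence _ _ _ mu setT measurableT G).
- by move=> k; exact: measurable_tuple_integral_cons.
- by move=> k x _; exact: tuple_integral_ge0.
- move=> x _ i j ij; apply: le_tuple_integral => //.
  + exact: measurable_fun_cons.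
  + exact: measurable_fun_cons.
  + by move=> t; exact: ndg.
Qed.

Import HBNNSimple.

(** [cue_angles] describes the law on measurable sets only; this extends it to nonnegative
    functions. *)
Lemma integral_density n (m : {measure set (n.-tuple R) -> \bar R}) (w : n.-tuple R -> R) :
  measurable_fun setT w -> (forall t, (0 <= w t)%R) ->
  (forall A, measurable A -> m A = tuple_integral (fun t => (w t * \1_A t)%:E)) ->
  forall g : n.-tuple R -> \bar R, measurable_fun setT g -> (forall t, 0 <= g t) ->
  \int[m]_t g t = tuple_integral (fun t => (w t)%:E * g t).
Proof.
apply: functional_density => *; [exact: tuple_integral_sum|exact: tuple_integralZl|].
exact: cvg_tuple_integral.
Qed.

End TupleIntegral.

(** * Integrals of cosines and sines over a period *)

Section RealIntegrals.
Context {R : realType}.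
Local Notation mu := (@lebesgue_measure R).

Lemma continuous_integrable (f : R -> R) (a b : R) :
  continuous f -> mu.-integrable `[a, b] (EFin \o f).
Proof.
move=> cf; apply: continuous_compact_integrable; first exact: segment_compact.
exact: continuous_subspaceT.
Qed.

Lemma integral_derivative (f F : R -> R) (a b : R) : a < b ->
  continuous f -> (forall x : R, is_derive x 1 F (f x)) ->
  \int[mu]_(x in `[a, b]) f x = F b - F a.
Proof.
move=> ab cf dF.
have cF : continuous F.
  by move=> x; apply/differentiable_continuous/derivable1_diffP; exact: ex_derive.
rewrite /Rintegral (@continuous_FTC2 _ f F)//.
- exact: continuous_subspaceT.
- split.
  + by move=> x _; exact: ex_derive.
  + exact/cvg_at_right_filter/cF.
  + exact/cvg_at_left_filter/cF.
- by move=> x _; rewrite derive1E derive_val.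
Qed.

Lemma continuous_cosM (c : R) : continuous (fun x => cos (c * x)).
Proof.
by move=> x; apply: continuous_comp; [exact: mulrl_continuous|exact: continuous_cos].
Qed.

Lemma continuous_sinM (c : R) : continuous (fun x => sin (c * x)).
Proof.
by move=> x; apply: continuous_comp; [exact: mulrl_continuous|exact: continuous_sin].
Qed.

Lemma is_derive_scale (c x : R) : is_derive x 1 (fun y : R => c * y) c.
Proof. by apply: is_derive_eq; rewrite scaler1 // scaler0 addr0. Qed.

Lemma is_derive_sinM (c x : R) : is_derive x 1 (fun y : R => sin (c * y)) (c * cos (c * x)).
Proof.
rewrite mulrC; have := is_derive_scale c x => ?.
exact: (@is_derive1_comp _ sin (fun y => c * y)).
Qed.

Lemma is_derive_cosM (c x : R) : is_derive x 1 (fun y : R => cos (c * y)) (- (c * sin (c * x))).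
Proof.
rewrite mulrC -mulNr; have := is_derive_scale c x => ?.
exact: (@is_derive1_comp _ cos (fun y => c * y)).
Qed.

Lemma integral_cosM (c a b : R) : a < b -> c != 0 ->
  \int[mu]_(x in `[a, b]) cos (c * x) = (sin (c * b) - sin (c * a)) / c.
Proof.
move=> ab c0.
have dF (x : R) : is_derive x 1 (fun y : R => c^-1 * sin (c * y)) (cos (c * x)).
  have ? := is_derive_sinM c x.
  by apply: is_derive_eq; rewrite /GRing.scale /=; field.
by rewrite (integral_derivative ab (@continuous_cosM c) dF); ring.
Qed.

Lemma integral_sinM (c a b : R) : a < b -> c != 0 ->
  \int[mu]_(x in `[a, b]) sin (c * x) = (cos (c * a) - cos (c * b)) / c.
Proof.
move=> ab c0.
have dF (x : R) : is_derive x 1 (fun y : R => - c^-1 * cos (c * y)) (sin (c * x)).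
  have ? := is_derive_cosM c x.
  by apply: is_derive_eq; rewrite /GRing.scale /=; field.
by rewrite (integral_derivative ab (@continuous_sinM c) dF); ring.
Qed.

Lemma expiD (x y : R) : expi (x + y) = expi x * expi y.
Proof. by rewrite /expi; simpc; rewrite cosD sinD [sin x * _ + _]addrC. Qed.

Lemma expi0 : expi (0 : R) = 1.
Proof. by rewrite /expi cos0 sin0. Qed.

Lemma expi_sum (I : Type) (s : seq I) (P : pred I) (x : I -> R) :
  expi (\sum_(i <- s | P i) x i) = \prod_(i <- s | P i) expi (x i).
Proof. exact: (big_morph _ expiD expi0). Qed.

Lemma expiMn (x : R) n : expi (x *+ n) = expi x ^+ n.
Proof. by elim: n => [|n IH]; rewrite ?mulr0n ?expr0 ?expi0// mulrS expiD IH exprS. Qed.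

Lemma cos_int2pi (k : int) : cos (k%:~R * (2 * pi)) = 1 :> R.
Proof.
wlog k0 : k / 0 <= k.
  by have [k0 /(_ _ k0)//|k0 /(_ (- k))] := leP 0 k; rewrite rmorphN mulNr cosN; apply; lia.
case: k k0 => // n _.
have : periodic (@cos R) (2 * pi) by move=> x; rewrite mulr_natl; exact: cosD2pi.
by move=> /periodicn /(_ n 0); rewrite add0r cos0 -pmulrn [_ * (2 * pi)]mulr_natl.
Qed.

Lemma sin_int2pi (k : int) : sin (k%:~R * (2 * pi)) = 0 :> R.
Proof.
wlog k0 : k / 0 <= k.
  have [k0 /(_ _ k0)//|k0 /(_ (- k))] := leP 0 k.
  by rewrite rmorphN mulNr sinN => /(_ ltac:(lia)); lra.
case: k k0 => // n _.
have : periodic (@sin R) (2 * pi) by move=> x; rewrite mulr_natl; exact: sinD2pi.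
by move=> /periodicn /(_ n 0); rewrite add0r sin0 -pmulrn [_ * (2 * pi)]mulr_natl.
Qed.

Lemma twopi_gt0 : 0 < 2 * pi :> R.
Proof. by rewrite mulr_gt0// pi_gt0. Qed.

Lemma integral_cos_int (k : int) :
  \int[mu]_(x in `[0, 2 * pi]) cos (k%:~R * x) = if k == 0 then 2 * pi else 0.
Proof.
case: eqP => [->|/eqP k0].
  under eq_Rintegral do rewrite mul0r cos0.
  rewrite Rintegral_cst//= mul1r lebesgue_measure_itv /= lte_fin twopi_gt0.
  by rewrite oppr0 addr0.
rewrite integral_cosM ?twopi_gt0 ?intr_eq0//.
by rewrite sin_int2pi mulr0 sin0 subrr mul0r.
Qed.

Lemma integral_sin_int (k : int) :
  \int[mu]_(x in `[0, 2 * pi]) sin (k%:~R * x) = 0.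
Proof.
case: (eqVneq k 0) => [->|k0].
  under eq_Rintegral do rewrite mul0r sin0.
  by rewrite Rintegral_cst//= mul0r.
rewrite integral_sinM ?twopi_gt0 ?intr_eq0//.
by rewrite cos_int2pi mulr0 cos0 subrr mul0r.
Qed.

Lemma continuous_sum (I : Type) (s : seq I) (P : pred I) (f : I -> R -> R) :
  (forall i, continuous (f i)) -> continuous (fun x => \sum_(i <- s | P i) f i x).
Proof.
move=> cf; elim: s => [|i s IH].
  by rewrite (_ : (fun _ => _) = cst 0); [exact: cst_continuous|apply/funext => x; rewrite big_nil].
rewrite (_ : (fun _ => _) = fun x => (if P i then f i x else 0) + \sum_(j <- s | P j) f j x).
  by move=> x; apply: cvgD; [case: ifP => _; [exact: cf|exact: cvg_cst]|exact: IH].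
by apply/funext => x; rewrite big_cons; case: ifP => // _; rewrite add0r.
Qed.

Lemma Rintegral_sum (I : Type) (s : seq I) (P : pred I) (a b : R) (f : I -> R -> R) :
  (forall i, continuous (f i)) ->
  \int[mu]_(x in `[a, b]) (\sum_(i <- s | P i) f i x) =
  \sum_(i <- s | P i) \int[mu]_(x in `[a, b]) f i x.
Proof.
move=> cf; elim: s => [|i s IH].
  rewrite big_nil; under eq_Rintegral do rewrite big_nil.
  by rewrite Rintegral_cst//= mul0r.
rewrite big_cons -IH; under eq_Rintegral do rewrite big_cons.
case: ifP => // _; rewrite -RintegralD//.
- exact: continuous_integrable.
- by apply: continuous_integrable; exact: continuous_sum.
Qed.

End RealIntegrals.

(** * Orthogonality of characters on the torus *)

Section TrigonometricPolynomials.
Context {R : realType}.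
Local Notation mu := (@lebesgue_measure R).

Definition circle_cube n (t : n.-tuple R) : R :=
  \prod_(i < n) \1_(`[0, 2 * pi[%classic) (tnth t i).

Lemma circle_cube_cons n (x : R) (t : n.-tuple R) :
  circle_cube [tuple of x :: t] = \1_(`[0, 2 * pi[%classic) x * circle_cube t.
Proof.
rewrite /circle_cube big_ord_recl tnth0; congr (_ * _).
by apply: eq_bigr => i _; rewrite tnthS.
Qed.

Lemma circle_cube_ge0 n (t : n.-tuple R) : 0 <= circle_cube t.
Proof. by apply: prodr_ge0 => i _. Qed.

Lemma measurable_circle_cube n : measurable_fun setT (@circle_cube n).
Proof.
apply: measurable_prod => i _; apply: measurableT_comp; last exact: measurable_tnth.
exact: measurable_indic.
Qed.

Definition phase n (J : {ffun 'I_n -> int}) (t : n.-tuple R) : R :=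
  \sum_i (J i)%:~R * tnth t i.

(** Exponents may repeat in the list, so products are plain lists of pairs and [trig_coef] collects
    the repetitions. *)
Definition trig_poly n (s : seq (R[i] * {ffun 'I_n -> int})) (t : n.-tuple R) : R[i] :=
  \sum_(a <- s) a.1 * expi (phase a.2 t).

Definition trig_coef n (s : seq (R[i] * {ffun 'I_n -> int})) (J : {ffun 'I_n -> int}) : R[i] :=
  \sum_(a <- s | a.2 == J) a.1.

Lemma Re_sum (I : Type) (s : seq I) (P : pred I) (f : I -> R[i]) :
  complex.Re (\sum_(i <- s | P i) f i) = \sum_(i <- s | P i) complex.Re (f i).
Proof.
have ReD : {morph @complex.Re R : x y / x + y} by move=> -[a b] [c d].
exact: (big_morph _ ReD erefl).
Qed.

Let tail n (J : {ffun 'I_n.+1 -> int}) : {ffun 'I_n -> int} := [ffun i => J (lift ord0 i)].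

Let phase_cons n (J : {ffun 'I_n.+1 -> int}) (x : R) (t : n.-tuple R) :
  phase J [tuple of x :: t] = (J ord0)%:~R * x + phase (tail J) t.
Proof.
rewrite /phase big_ord_recl tnth0; congr (_ + _).
by apply: eq_bigr => i _; rewrite tnthS ffunE.
Qed.

Let tail_eq0 n (J : {ffun 'I_n.+1 -> int}) :
  (J == 0) = (J ord0 == 0) && (tail J == 0).
Proof.
apply/eqP/andP => [->|[/eqP J0 /eqP /ffunP Jt]].
  by rewrite ffunE; split => //; apply/eqP/ffunP => i; rewrite !ffunE.
apply/ffunP => i; rewrite ffunE.
have [->//|i0] := eqVneq i ord0.
rewrite eq_sym in i0; have [j -> _] := unlift_some i0.
by have := Jt j; rewrite !ffunE.
Qed.

(** Freezing the first coordinate leaves a polynomial [sx x] in the others. Its constant term is a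
    trigonometric polynomial in [x], whose mean is the full constant term. *)
Lemma tuple_integral_trig n (s : seq (R[i] * {ffun 'I_n -> int})) :
  (forall t, 0 <= complex.Re (trig_poly s t)) ->
  tuple_integral (fun t => (circle_cube t * complex.Re (trig_poly s t))%:E) =
  ((2 * pi) ^+ n * complex.Re (trig_coef s 0))%:E.
Proof.
elim: n s => [|n IH] s s0.
  rewrite /= /circle_cube big_ord0 expr0 !mul1r /trig_poly /trig_coef.
  congr (complex.Re _)%:E; apply: eq_big => [a|a _].
    by apply/esym/eqP/ffunP; case.
  by rewrite /phase big_ord0 expi0 mulr1.
pose sx (x : R) := [seq (a.1 * expi ((a.2 ord0)%:~R * x), tail a.2) | a : R[i] * {ffun 'I_n.+1 -> int} <- s].
have sxE x t : trig_poly (sx x) t = trig_poly s [tuple of x :: t].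
  rewrite /trig_poly big_map; apply: eq_bigr => a _.
  by rewrite phase_cons expiD mulrA.
pose F x := complex.Re (trig_coef (sx x) 0).
have FE x : F x = \sum_(a <- s | tail a.2 == 0)
    (complex.Re a.1 * cos ((a.2 ord0)%:~R * x) - complex.Im a.1 * sin ((a.2 ord0)%:~R * x)).
  rewrite /F /trig_coef big_map Re_sum; apply: eq_bigr => -[[p q] J] _ /=.
  by simpc.
have cF : continuous F.
  rewrite (funext FE).
  apply: continuous_sum => a x; apply: cvgB; apply: cvgM; try exact: cvg_cst.
  + exact: continuous_cosM.
  + exact: continuous_sinM.
transitivity (\int[mu]_(x in `[0%R, (2 * pi)%R[) ((2 * pi) ^+ n * F x)%:E)%E.
  rewrite /= [RHS]integral_mkcond; apply: eq_integral => x _.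
  rewrite patchE; case: ifPn => xI.
    rewrite -IH => [|t]; last by rewrite sxE.
    apply: eq_tuple_integral => t.
    by rewrite circle_cube_cons indicE xI mul1r sxE.
  rewrite -[RHS](tuple_integral0 n); apply: eq_tuple_integral => t.
  by rewrite circle_cube_cons indicE (negbTE xI) !mul0r.
have mF : measurable_fun setT F by exact: continuous_measurable_fun.
(* The cube is half-open, as in the density; the closed interval is compact, which gives
   integrability. *)
rewrite integral_itv_bndo_bndc; last first.
  by apply/measurable_EFinP/measurable_funTS/measurable_funM.
have iF : mu.-integrable `[0, 2 * pi] (EFin \o F) by exact: continuous_integrable.
under eq_integral do rewrite EFinM.
rewrite integralZl// -[X in (_ * X)%E]fineK ?integrable_fin_num//.
rewrite -EFinM -/(Rintegral mu `[0, 2 * pi] F); congr EFin.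
rewrite (_ : Rintegral mu `[0, 2 * pi] F = 2 * pi * complex.Re (trig_coef s 0)); last first.
  rewrite (funext FE).
  rewrite Rintegral_sum; last first.
    move=> a x; apply: cvgB; apply: cvgM; try exact: cvg_cst.
      exact: continuous_cosM.
    exact: continuous_sinM.
  rewrite /trig_coef Re_sum mulr_sumr big_mkcond [RHS]big_mkcond.
  apply: eq_bigr => -[[p q] J] _ /=; rewrite tail_eq0 andbC.
  case: eqP => //= _.
  rewrite RintegralB//; last 2 first.
  - apply: continuous_integrable => x; apply: cvgM; [exact: cvg_cst|exact: continuous_cosM].
  - apply: continuous_integrable => x; apply: cvgM; [exact: cvg_cst|exact: continuous_sinM].
  rewrite !RintegralZl//; last 2 first.
  - by apply: continuous_integrable; exact: continuous_sinM.
  - by apply: continuous_integrable; exact: continuous_cosM.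
  rewrite integral_cos_int integral_sin_int mulr0 subr0.
  by case: eqP; rewrite ?mulr0// mulrC.
by rewrite mulrA exprSr.
Qed.

End TrigonometricPolynomials.

(** * From expectations to coefficients of alternating polynomials *)

Section CueMoments.
Context {R : realType} (N : nat).
Local Notation mu := (@lebesgue_measure R).
Local Notation expo := {ffun 'I_N -> int}.
Implicit Types (t : N.-tuple R) (h : N.-tuple R -> R[i]) (psi : expo -> int).

(** The bridge between functions on the torus and the integer-valued states of the fermionic
    computation. *)
Definition represents h psi := exists s : seq (R[i] * expo),
  (forall t, trig_poly s t = h t) /\ (forall J, trig_coef s J = (psi J)%:~R).

Lemma phaseD (J K : expo) t : phase (J + K) t = phase J t + phase K t.
Proof.
rewrite /phase -big_split /=; apply: eq_bigr => i _.
by rewrite ffunE rmorphD mulrDl.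
Qed.

Lemma phase_unit_expo i l t : phase (unit_expo i l) t = l%:~R * tnth t i.
Proof.
rewrite /phase (bigD1 i)//= ffunE eqxx big1 ?addr0// => j ji.
by rewrite ffunE (negbTE ji) mul0r.
Qed.

Definition power_sum (l : int) t : R[i] := \sum_i expi (l%:~R * tnth t i).

Lemma represents_mul_power l h psi : represents h psi ->
  represents (fun t => power_sum l t * h t) (mul_power l psi).
Proof.
move=> [s [sh spsi]].
exists [seq (a.1, a.2 + unit_expo i l) | i <- enum 'I_N, a : R[i] * expo <- s]; split=> [t|J].
  rewrite /trig_poly big_allpairs_dep /= /power_sum big_enum mulr_suml.
  apply: eq_bigr => i _; rewrite -sh /trig_poly mulr_sumr; apply: eq_bigr => a _ /=.
  by rewrite phaseD expiD phase_unit_expo mulrA mulrC.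
rewrite /trig_coef big_mkcond big_allpairs_dep big_enum /= /mul_power rmorph_sum.
apply: eq_bigr => i _; rewrite /= -spsi /trig_coef [RHS]big_mkcond; apply: eq_bigr => a _ /=.
by rewrite -[in RHS](inj_eq (addIr (unit_expo i l))) subrK.
Qed.

Definition perm_expo (s : 'S_N) : expo := [ffun i => (s i : nat)%:Z].

Definition vandermonde t : R[i] :=
  \sum_(s : 'S_N) (-1) ^+ s * expi (phase (perm_expo s) t).

Lemma vandermondeE t : vandermonde t =
  \prod_(j < N) \prod_(k < N | (j < k)%N) (expi (tnth t k) - expi (tnth t j)).
Proof.
pose a : 'rV[R[i]]_N := \row_i expi (tnth t i).
transitivity (\det (Vandermonde N a)).
  rewrite -det_tr /determinant; apply: eq_bigr => s _; congr (_ * _).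
  rewrite /phase expi_sum; apply: eq_bigr => i _.
  by rewrite !mxE ffunE -pmulrn mulr_natl expiMn.
rewrite det_Vandermonde; apply: eq_bigr => j _; apply: eq_bigr => k _.
by rewrite !mxE.
Qed.

Lemma represents_vandermonde : represents vandermonde (@vacuum N).
Proof.
exists [seq ((-1) ^+ s, perm_expo s) | s : 'S_N <- enum 'S_N]; split=> [t|J].
  by rewrite /trig_poly big_map big_enum.
rewrite /trig_coef big_map /= big_enum_cond /vacuum /determinant rmorph_sum big_mkcond /=.
apply: eq_bigr => s _; rewrite rmorphM rmorphXn /= rmorphN rmorph1.
case: eqP => [<-|Js].
  by rewrite big1 ?mulr1// => i _; rewrite mxE ffunE eqxx.
have [i Ji] : exists i, J i != (s i)%:Z.
  apply/existsP; apply: contra_notT Js; rewrite negb_exists => /forallP h.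
  by apply/ffunP => i; rewrite ffunE; move: (h i); rewrite negbK => /eqP.
by rewrite (bigD1 i)//= mxE (negbTE Ji) mul0r mulr0.
Qed.

Lemma conjc_expi (x : R) : (expi x)^*%C = expi (- x).
Proof. by rewrite /expi cosN sinN. Qed.

Lemma conjc_signM (b : bool) (z : R[i]) : ((-1) ^+ b * z)^*%C = (-1) ^+ b * z^*%C.
Proof. by rewrite rmorphM rmorphXn rmorphN rmorph1. Qed.

(** The conjugate Vandermonde determinant reads the coefficients of [psi] at all permutations of the
    staircase. By alternation the signs cancel and the N! contributions agree. *)
Lemma represents_constant_term h psi : represents h psi -> altern psi ->
  exists s : seq (R[i] * expo),
  (forall t, trig_poly s t = h t * (vandermonde t)^*%C) /\
  trig_coef s 0 = (N`! %:Z * psi (@staircase N))%:~R.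
Proof.
move=> [s [sh spsi]] apsi.
exists [seq ((-1) ^+ p * a.1, a.2 - perm_expo p) | p : 'S_N <- enum 'S_N, a : R[i] * expo <- s].
split=> [t|].
  rewrite /trig_poly big_allpairs_dep big_enum /= /vandermonde rmorph_sum mulr_sumr.
  apply: eq_bigr => p _; rewrite -sh /trig_poly mulr_suml; apply: eq_bigr => a _ /=.
  rewrite conjc_signM conjc_expi phaseD expiD.
  have -> : phase (- perm_expo p) t = - phase (perm_expo p) t.
    by rewrite /phase -sumrN; apply: eq_bigr => i _; rewrite ffunE rmorphN mulNr.
  by rewrite [(-1) ^+ p * a.1]mulrC mulrACA.
rewrite /trig_coef big_mkcond big_allpairs_dep big_enum /=.
transitivity (\sum_(p : 'S_N) (psi (@staircase N))%:~R : R[i]).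
  apply: eq_bigr => p _.
  transitivity ((-1) ^+ p * trig_coef s (perm_expo p)).
    rewrite /trig_coef mulr_sumr [RHS]big_mkcond; apply: eq_bigr => a _ /=.
    by rewrite subr_eq0.
  rewrite spsi.
  have -> : psi (perm_expo p) = (-1) ^+ p * psi (@staircase N).
    by rewrite -apsi; congr psi; apply/ffunP => i; rewrite !ffunE.
  by rewrite rmorphM rmorphXn rmorphN rmorph1 mulrA -exprD addnn -signr_odd odd_double mul1r.
by rewrite sumr_const card_Sn rmorphM /= -pmulrn mulr_natl.
Qed.

(** The squared modulus of the power sum, in real terms so that measurability and bounds follow
    coordinatewise. *)
Definition sq_power_sum (k : nat) t : R :=
  (\sum_i cos (k%:R * tnth t i)) ^+ 2 + (\sum_i sin (k%:R * tnth t i)) ^+ 2.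

Lemma power_sumE (k : nat) t :
  power_sum k%:Z t = ((\sum_i cos (k%:R * tnth t i)) +i* (\sum_i sin (k%:R * tnth t i)))%C.
Proof.
rewrite /power_sum; elim/big_rec3 : _ => //= i a b c _ ->.
by rewrite /expi; simpc; rewrite -pmulrn.
Qed.

Lemma power_sumNE (k : nat) t :
  power_sum (- k%:Z) t = ((\sum_i cos (k%:R * tnth t i)) -i* (\sum_i sin (k%:R * tnth t i)))%C.
Proof.
rewrite /power_sum; elim/big_rec3 : _ => [|i a b c _ ->]; first by rewrite oppr0.
by rewrite mulrNz mulNr -conjc_expi /expi; simpc; rewrite -pmulrn ?opprD.
Qed.

Lemma sq_power_sumE (k : nat) t :
  (sq_power_sum k t)%:C%C = power_sum (- k%:Z) t * power_sum k%:Z t.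
Proof.
rewrite power_sumE power_sumNE /sq_power_sum; simpc.
by congr (_ +i* _)%C; ring.
Qed.

Definition weight t : R := \prod_(j < N) \prod_(k < N | (j < k)%N)
   Normc.normc (expi (tnth t j) - expi (tnth t k)) ^+ 2.

Lemma weightE t : (weight t)%:C%C = vandermonde t * (vandermonde t)^*%C.
Proof.
rewrite vandermondeE /weight !rmorph_prod -big_split; apply: eq_bigr => j _ /=.
rewrite !rmorph_prod -big_split; apply: eq_bigr => k _ /=.
rewrite /expi; simpc; rewrite sqr_sqrtr ?addr_ge0 ?sqr_ge0//.
by congr (_ +i* _)%C; ring.
Qed.

Definition cue_constant : R := ((2 * pi) ^+ N * (N`!)%:R)^-1.

Lemma cue_constant_ge0 : 0 <= cue_constant.
Proof. by rewrite invr_ge0 mulr_ge0 ?exprn_ge0// ltW// twopi_gt0. Qed.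

Lemma cue_densityE t : cue_density t = cue_constant * (circle_cube t * weight t).
Proof.
rewrite /cue_density; case: ifPn => [/forallP h|].
  suff -> : circle_cube t = 1 by rewrite mul1r.
  apply: big1 => i _.
  by rewrite indicE mem_set//= in_itv /= h.
rewrite negb_forall => /existsP[i hi].
rewrite /circle_cube (bigD1 i)//= indicE memNset ?mul0r ?mulr0//=.
by rewrite in_itv /=; exact/negP.
Qed.

Lemma weight_ge0 t : 0 <= weight t.
Proof. by apply: prodr_ge0 => j _; apply: prodr_ge0 => k _; rewrite sqr_ge0. Qed.

Lemma measurable_weight : measurable_fun setT weight.
Proof.
apply: measurable_prod => j _.
rewrite (_ : (fun _ => _) = fun t => \prod_(k < N) (if (j < k)%N then
   (cos (tnth t j) - cos (tnth t k)) ^+ 2 + (sin (tnth t j) - sin (tnth t k)) ^+ 2 else 1)).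
  apply: measurable_prod => k _; case: (j < k)%N; last exact: measurable_cst.
  have mc i : measurable_fun setT (fun t : N.-tuple R => cos (tnth t i)).
    exact: (measurableT_comp (continuous_measurable_fun (@continuous_cos R)) (measurable_tnth i)).
  have ms i : measurable_fun setT (fun t : N.-tuple R => sin (tnth t i)).
    exact: (measurableT_comp (continuous_measurable_fun (@continuous_sin R)) (measurable_tnth i)).
  by apply: measurable_funD; apply: measurable_funX; exact: measurable_funB.
apply/funext => t; rewrite big_mkcond; apply: eq_bigr => k _; case: ifP => // _.
by rewrite /expi; simpc; rewrite sqr_sqrtr ?addr_ge0 ?sqr_ge0.
Qed.

Lemma cue_density_ge0 t : 0 <= cue_density t.
Proof.
by rewrite cue_densityE !mulr_ge0 ?cue_constant_ge0 ?circle_cube_ge0 ?weight_ge0.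
Qed.

Lemma measurable_cue_density : measurable_fun setT (@cue_density R N).
Proof.
rewrite (funext cue_densityE); apply: measurable_funM; first exact: measurable_cst.
by apply: measurable_funM; [exact: measurable_circle_cube|exact: measurable_weight].
Qed.

Lemma measurable_sq_power_sum k : measurable_fun setT (sq_power_sum k).
Proof.
have mc (f : R -> R) : continuous f ->
    measurable_fun setT (fun t : N.-tuple R => \sum_i f (tnth t i)).
  move=> cf; apply: measurable_sum => i.
  exact: (measurableT_comp (continuous_measurable_fun cf) (measurable_tnth i)).
apply: measurable_funD; apply: measurable_funX.
- by apply: (mc (fun x => cos (k%:R * x))); exact: continuous_cosM.
- by apply: (mc (fun x => sin (k%:R * x))); exact: continuous_sinM.
Qed.

Lemma sq_power_sum_ge0 k t : 0 <= sq_power_sum k t.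
Proof. by rewrite addr_ge0 ?sqr_ge0. Qed.

Lemma represents_word (w : seq int) :
  represents (fun t => \prod_(l <- w) power_sum l t * vandermonde t) (@word N w).
Proof.
elim: w => [|l w IH] /=.
  have [s [s1 s2]] := represents_vandermonde.
  by exists s; split => // t; rewrite big_nil mul1r.
have [s [s1 s2]] := represents_mul_power l IH.
by exists s; split => // t; rewrite s1 big_cons mulrA.
Qed.

Section Law.
Context d (T : measurableType d) (P : probability T R) (theta : {RV P >-> N.-tuple R}).
Hypothesis cue : cue_angles theta.

Lemma cue_integral (g : N.-tuple R -> \bar R) :
  measurable_fun setT g -> (forall t, 0 <= g t)%E ->
  (\int[P]_w g (theta w) = tuple_integral (fun t => (cue_density t)%:E * g t))%E.
Proof.
move=> mg g0.
rewrite -(@ge0_integral_distribution _ _ _ _ _ P theta g mg g0).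
apply: integral_density => //; [exact: measurable_cue_density|exact: cue_density_ge0].
Qed.

(** The integrand times the density is a trigonometric polynomial up to [cue_constant]; the volume
    (2 pi)^N and the N! of [represents_constant_term] cancel that constant. *)
Lemma cue_moment (ks : seq nat) :
  (\int[P]_w (\prod_(k <- ks) sq_power_sum k (theta w))%:E = ((moment N ks)%:~R)%:E)%E.
Proof.
rewrite (cue_integral (g := fun t => (\prod_(k <- ks) sq_power_sum k t)%:E)); last 2 first.
- by apply/measurable_EFinP; apply: measurable_prod => k _; exact: measurable_sq_power_sum.
- by move=> t; rewrite lee_fin prodr_ge0// => k _; exact: sq_power_sum_ge0.
have [s [s1 s2]] := represents_constant_term
  (represents_word ([seq - k%:Z | k <- ks] ++ [seq k%:Z | k <- ks])) (@word_altern N _).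
have sE t : trig_poly s t = (\prod_(k <- ks) sq_power_sum k t * weight t)%:C%C.
  rewrite s1 rmorphM /= weightE mulrA; congr (_ * _ * _).
  rewrite big_cat /= !big_map -big_split rmorph_prod; apply: eq_bigr => k _ /=.
  by rewrite sq_power_sumE.
under eq_tuple_integral.
  move=> t.
  rewrite cue_densityE -EFinM -!mulrA [weight t * _]mulrC (_ : _ * weight t = complex.Re (trig_poly s t)); last by rewrite sE.
  rewrite EFinM.
  over.
rewrite tuple_integralZl ?cue_constant_ge0//; last 2 first.
- apply/measurable_EFinP; apply: measurable_funM; first exact: measurable_circle_cube.
  rewrite (_ : (fun t => _) = fun t => \prod_(k <- ks) sq_power_sum k t * weight t); last first.
    by apply/funext => t; rewrite sE.
  apply: measurable_funM; last exact: measurable_weight.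
  by apply: measurable_prod => k _; exact: measurable_sq_power_sum.
- move=> t; rewrite lee_fin mulr_ge0 ?circle_cube_ge0// sE /=.
  by rewrite mulr_ge0 ?weight_ge0// prodr_ge0// => k _; exact: sq_power_sum_ge0.
rewrite tuple_integral_trig; last first.
  move=> t; rewrite sE /= mulr_ge0 ?weight_ge0// prodr_ge0// => k _.
  exact: sq_power_sum_ge0.
rewrite s2 -EFinM -/(moment N ks); congr EFin.
rewrite (_ : (_%:~R : R[i]) = ((N`!%:Z * moment N ks)%:~R)%:C%C); last by rewrite rmorph_int.
rewrite /= rmorphM /= -pmulrn /cue_constant [_ ^+ N * (_ * _)]mulrA mulKf//.
by rewrite mulf_neq0 ?pnatr_eq0 -?lt0n ?fact_gt0// expf_neq0// gt_eqF// twopi_gt0.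
Qed.

End Law.
End CueMoments.

(** * Translation and reflection of Lebesgue measure *)

Section Invariance.
Context {R : realType}.
Local Notation mu := (@lebesgue_measure R).
Local Open Scope ereal_scope.

Lemma lebesgue_measureD (c : R) (A : set R) : measurable A ->
  pushforward mu ((fun x => x + c)%R : _ -> measurableTypeR R) A = mu A.
Proof.
move=> mA.
have mc : measurable_fun setT ((fun x => x + c)%R : measurableTypeR R -> measurableTypeR R).
  exact: measurable_funD.
apply/esym/lebesgue_measure_unique => //= _ [[a b]] _ <-.
rewrite /pushforward (_ : _ @^-1` _ = `](a - c)%R, (b - c)%R]%classic).
  rewrite !lebesgue_measure_itv/= !lte_fin ltrD2r; case: ifP => // _.
  by rewrite -!EFinB; congr EFin; ring.
by apply/seteqP; split=> x /=; rewrite !in_itv /= ltrBlDr lerBrDr.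
Qed.

Lemma ge0_integralT_shift (c : R) (f : R -> \bar R) :
  measurable_fun setT f -> (forall x, 0 <= f x) ->
  \int[mu]_x f (x + c)%R = \int[mu]_x f x.
Proof.
move=> mf f0.
have mc : measurable_fun setT ((fun x => x + c)%R : measurableTypeR R -> measurableTypeR R).
  exact: measurable_funD.
transitivity (\int[pushforward mu ((fun x => x + c)%R : measurableTypeR R -> measurableTypeR R)]_x f x).
  by rewrite ge0_integral_pushforward.
by apply: eq_measure_integral => A mA _; exact: lebesgue_measureD.
Qed.

Lemma ge0_integralT_opp (f : R -> \bar R) :
  measurable_fun setT f -> (forall x, 0 <= f x) ->
  \int[mu]_x f (- x)%R = \int[mu]_x f x.
Proof.
move=> mf f0.
transitivity (\int[pushforward mu (-%R : measurableTypeR R -> measurableTypeR R)]_x f x).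
  by rewrite ge0_integral_pushforward.
by apply: eq_measure_integral => A mA _; exact: lebesgue_measureN.
Qed.
End Invariance.

(** * Integrals of periodic functions of a difference of two angles *)

Section PairBound.
Context {R : realType}.
Local Notation mu := (@lebesgue_measure R).
Local Notation I := (`[0%R, (2 * pi)%R[%classic : set R).
Local Open Scope ereal_scope.

Lemma measurable_shift (c : R) : measurable_fun setT (fun x : R => (x + c)%R).
Proof. exact: measurable_funD. Qed.

Lemma measurable_subl (c : R) : measurable_fun setT (fun x : R => (c - x)%R).
Proof. exact: measurable_funB. Qed.

Lemma measurable_scale_indic (D : set R) (g : R -> R) : measurable D -> measurable_fun setT g ->
  measurable_fun setT (fun x => (\1_D x * g x)%:E).
Proof.
move=> mD mg; apply/measurable_EFinP; apply: measurable_funM => //.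
Qed.

Lemma integral_indicM (D : set R) (g : R -> R) : 
  \int[mu]_x (\1_D x * g x)%:E = \int[mu]_(x in D) (g x)%:E.
Proof.
rewrite [RHS]integral_mkcond; apply: eq_integral => x _.
by rewrite patchE indicE; case: ifP; rewrite ?mul1r ?mul0r.
Qed.

Section Periodic.
Variables (g : R -> R) (mg : measurable_fun setT g) (g0 : (forall x, 0 <= g x)%R).
Hypothesis g2pi : (forall x, g (x + 2 * pi) = g x)%R.
Local Notation J := (`[0%R, (2 * pi)%R]%classic : set R).
Let K := \int[mu]_(x in J) (g x)%:E.
Let F (u : R) := (\1_J u * g u)%:E.

(** Differences of two angles lie in (-2 pi, 2 pi), which is covered by two translates of a period;
    hence the factor 2. *)
Let two_periods (f : R -> R) : measurable_fun setT f -> (forall u, 0 <= f u <= 1)%R ->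
  (forall u, f u != 0 -> - (2 * pi) < u < 2 * pi)%R ->
  \int[mu]_u (f u * g u)%:E <= 2%:E * K.
Proof.
move=> mf f01 fs.
have F0 u : 0 <= F u by rewrite lee_fin mulr_ge0.
have mF : measurable_fun setT F by exact: measurable_scale_indic.
have mF2 : measurable_fun setT (fun u : R => F (u + 2 * pi)%R).
  exact: (measurableT_comp mF (measurable_shift _)).
have -> : 2%:E * K = \int[mu]_u (F u + F (u + 2 * pi)%R).
  rewrite ge0_integralD// (ge0_integralT_shift (2 * pi) mF F0) integral_indicM.
  by rewrite mule_natl mule2n.
apply: ge0_le_integral => //.
- by move=> u _; rewrite lee_fin mulr_ge0//; have /andP[] := f01 u.
- by apply/measurable_EFinP; apply: measurable_funM.
- exact: emeasurable_funD.
move=> u _; rewrite /F -EFinD lee_fin g2pi -mulrDl ler_wpM2r//.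
have [->|/fs hu] := eqVneq (f u) 0%R; first by rewrite addr_ge0.
have /andP[_ /le_trans] := f01 u; apply.
have [u0|u0] := leP 0%R u.
  by rewrite indicE mem_set ?lerDl//= in_itv/=; lra.
by rewrite [X in (_ + X)%R]indicE mem_set ?lerDr//= in_itv/=; lra.
Qed.

Lemma periodic_bound_sub (x : R) : I x -> \int[mu]_(y in I) (g (x - y))%:E <= 2%:E * K.
Proof.
rewrite /= in_itv /= => Ix.
pose f (u : R) := (\1_I (x - u) : R)%R.
have mf : measurable_fun setT f.
  by apply: measurableT_comp; [exact: measurable_indic|exact: measurable_funB].
have mfg : measurable_fun setT (fun u => (f u * g u)%:E).
  by apply/measurable_EFinP; apply: measurable_funM.
have fg0 u : 0 <= (f u * g u)%:E by rewrite lee_fin mulr_ge0.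
rewrite -(integral_indicM _ (fun y => g (x - y))).
rewrite (_ : \int[mu]_y _ = \int[mu]_u (f u * g u)%:E); last first.
  rewrite -(ge0_integralT_shift x mfg fg0) -ge0_integralT_opp//.
    by apply: eq_integral => y _; rewrite /f [(y + x)%R]addrC opprD addNKr opprK.
  - apply: measurable_scale_indic => //.
    exact: (measurableT_comp mg (measurable_subl x)).
  - by move=> y; rewrite lee_fin mulr_ge0.
apply: two_periods => // u; rewrite /f indicE; first by case: (_ \in _); rewrite ?lexx ?ler01.
have [/set_mem /=|] := boolP (x - u \in _)%R; last by rewrite eqxx.
by rewrite in_itv /= => ? _; lra.
Qed.

(** The earlier coordinate of a tuple is always integrated outermost, so both signs of the
    difference occur. *)
Lemma periodic_bound_sub' (x : R) : I x -> \int[mu]_(y in I) (g (y - x))%:E <= 2%:E * K.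
Proof.
rewrite /= in_itv /= => Ix.
pose f (u : R) := (\1_I (u + x) : R)%R.
have mf : measurable_fun setT f.
  by apply: measurableT_comp; [exact: measurable_indic|exact: measurable_funD].
have mfg : measurable_fun setT (fun u => (f u * g u)%:E).
  by apply/measurable_EFinP; apply: measurable_funM.
have fg0 u : 0 <= (f u * g u)%:E by rewrite lee_fin mulr_ge0.
rewrite -(integral_indicM _ (fun y => g (y - x))).
rewrite (_ : \int[mu]_y _ = \int[mu]_u (f u * g u)%:E); last first.
  rewrite -(ge0_integralT_shift (- x) mfg fg0).
  by apply: eq_integral => y _; rewrite /f subrK.
apply: two_periods => // u; rewrite /f indicE; first by case: (_ \in _); rewrite ?lexx ?ler01.
have [/set_mem /=|] := boolP (u + x \in _)%R; last by rewrite eqxx.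
by rewrite in_itv /= => ? _; lra.
Qed.

End Periodic.

Lemma tuple_integral_cube_cons n (F : n.+1.-tuple R -> R) :
  tuple_integral (fun t => (circle_cube t * F t)%:E) =
  \int[mu]_(x in I) tuple_integral (fun t : n.-tuple R => (circle_cube t * F [tuple of x :: t])%:E).
Proof.
rewrite /= [RHS]integral_mkcond; apply: eq_integral => x _; rewrite patchE.
case: ifPn => xI.
  by apply: eq_tuple_integral => t; rewrite circle_cube_cons indicE xI mul1r.
rewrite -[RHS](tuple_integral0 n); apply: eq_tuple_integral => t.
by rewrite circle_cube_cons indicE (negbTE xI) !mul0r.
Qed.

Let int_cst (c : R) : \int[mu]_(x in I) c%:E = (2 * pi * c)%:E.
Proof.
rewrite integral_cst//= lebesgue_measure_itv/= lte_fin twopi_gt0 oppr0 adde0.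
by rewrite -EFinM mulrC.
Qed.

Lemma tuple_integral_cube n : tuple_integral (fun t : n.-tuple R => (circle_cube t)%:E) = ((2 * pi) ^+ n)%:E.
Proof.
elim: n => [|n IH]; first by rewrite /= /circle_cube big_ord0 expr0.
under eq_tuple_integral do rewrite -[circle_cube _]mulr1.
rewrite (tuple_integral_cube_cons (fun _ => 1%R)).
under eq_integral do under eq_tuple_integral do rewrite mulr1.
by under eq_integral do rewrite IH; rewrite int_cst exprS.
Qed.

Let twopi0 n : (0 <= (2 * pi) ^+ n :> R)%R.
Proof. by rewrite exprn_ge0// ltW// twopi_gt0. Qed.

Lemma tuple_integral_cube1 n (h : R -> R) (j : 'I_n) (B : R) :
  measurable_fun setT h -> (forall x, 0 <= h x)%R ->
  \int[mu]_(x in I) (h x)%:E <= B%:E ->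
  tuple_integral (fun t : n.-tuple R => (circle_cube t * h (tnth t j))%:E) <= ((2 * pi) ^+ n.-1 * B)%:E.
Proof.
move=> mh h0 hB; elim: n j => [[]//|n IH] j.
rewrite (tuple_integral_cube_cons (fun t => h (tnth t j))).
have mhj m (i : 'I_m) : measurable_fun setT (fun t : m.-tuple R => (circle_cube t * h (tnth t i))%:E).
  apply/measurable_EFinP; apply: measurable_funM; first exact: measurable_circle_cube.
  exact: (measurableT_comp mh (measurable_tnth i)).
have hj0 m (i : 'I_m) t : 0 <= (circle_cube t * h (tnth t i))%:E.
  by rewrite lee_fin mulr_ge0 ?circle_cube_ge0.
have [->|j0] := eqVneq j ord0.
  rewrite [X in X <= _](_ : _ = \int[mu]_(x in I) ((2 * pi) ^+ n * h x)%:E); last first.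
    apply: eq_integral => x _; under eq_tuple_integral do rewrite tnth0 mulrC EFinM.
    rewrite tuple_integralZl// ?tuple_integral_cube 1?muleC//.
      by apply/measurable_EFinP; exact: measurable_circle_cube.
    by move=> t; rewrite lee_fin circle_cube_ge0.
  under eq_integral do rewrite EFinM.
  rewrite ge0_integralZl//.
  - by rewrite EFinM lee_wpmul2l// lee_fin.
  - by apply/measurable_EFinP/measurable_funTS.
  - by move=> *; rewrite lee_fin.
  - by rewrite lee_fin.
rewrite eq_sym in j0; have [i -> _] := unlift_some j0.
have n0 : (0 < n)%N by apply: leq_ltn_trans (ltn_ord i).
apply: (@le_trans _ _ (\int[mu]_(x in I) ((2 * pi) ^+ n.-1 * B)%:E)).
  apply: ge0_le_integral => //.
  - by move=> x _; apply: tuple_integral_ge0 => t; rewrite tnthS.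
  - apply: measurable_funTS; apply: measurable_fun_tuple_integral => [|x t]; last by rewrite tnthS.
    under eq_fun do rewrite tnthS.
    exact: (measurableT_comp (mhj _ i) measurable_snd).
  - by move=> x _; under eq_tuple_integral do rewrite tnthS; exact: IH.
by rewrite int_cst mulrA -exprS prednK.
Qed.

(** Coordinates before [i] cost a factor 2 pi each. Once [i] is reached its value is frozen, and the
    uniform bound on partial integrals reduces to the case of one coordinate. *)
Lemma tuple_integral_cube2 n (G : R -> R -> R) (i j : 'I_n) (B : R) :
  measurable_fun setT (fun xy : R * R => G xy.1 xy.2) -> (forall x y, 0 <= G x y)%R ->
  (forall x, I x -> \int[mu]_(y in I) (G x y)%:E <= B%:E) -> (i < j)%N ->
  tuple_integral (fun t : n.-tuple R => (circle_cube t * G (tnth t i) (tnth t j))%:E) <=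
  ((2 * pi) ^+ n.-1 * B)%:E.
Proof.
move=> mG G0 GB; elim: n i j => [[]//|n IH] i j ij.
rewrite (tuple_integral_cube_cons (fun t => G (tnth t i) (tnth t j))).
have mGx x : measurable_fun setT (G x).
  have mp : measurable_fun setT (fun y : R => (x, y)) by exact: measurable_fun_pair.
  exact: (measurableT_comp mG mp).
have j0 : ord0 != j by apply/eqP => jE; rewrite -jE in ij.
have [j' jE _] := unlift_some j0; subst j.
have n0 : (0 < n)%N by apply: leq_ltn_trans (ltn_ord j').
apply: (@le_trans _ _ (\int[mu]_(x in I) ((2 * pi) ^+ n.-1 * B)%:E)); last first.
  by rewrite int_cst mulrA -exprS prednK.
apply: ge0_le_integral => //.
- by move=> x _; apply: tuple_integral_ge0 => t; rewrite lee_fin mulr_ge0// circle_cube_ge0.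
- apply: measurable_funTS; apply: measurable_fun_tuple_integral => [|x t].
    apply/measurable_EFinP; apply: measurable_funM.
      have ms : measurable_fun setT (fun zt : measurableTypeR R * n.-tuple R => zt.2) by exact: measurable_snd.
      have mcc := measurableT_comp (@measurable_circle_cube R n) ms; exact: mcc.
    have mc (k : 'I_n.+1) : measurable_fun setT (fun zt : measurableTypeR R * n.-tuple R => tnth [tuple of zt.1 :: zt.2] k).
      have mp : measurable_fun setT (fun zt : measurableTypeR R * n.-tuple R => [tuple of zt.1 :: zt.2]).
        by apply: measurable_cons.
      exact: (measurableT_comp (measurable_tnth k) mp).
    exact: (measurableT_comp mG (measurable_fun_pair (mc i) (mc (lift ord0 j')))).
  by rewrite lee_fin mulr_ge0// circle_cube_ge0.
move=> x Ix; under eq_tuple_integral do rewrite tnthS.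
have [iE|i0] := eqVneq i ord0; first subst i.
  under eq_tuple_integral do rewrite tnth0.
  by apply: tuple_integral_cube1 => //; exact: GB.
rewrite eq_sym in i0; have [i' iE _] := unlift_some i0; subst i.
under eq_tuple_integral do rewrite tnthS.
by apply: IH; move: ij; rewrite /= /bump !add1n.
Qed.

End PairBound.

(** * Moments and variances of power sums *)

Section BoundedRandomVariables.
Context {R : realType} d (T : measurableType d) (P : probability T R).
Implicit Types X Y : T -> R.

(** Unlike integrability, this is stable under products, so polynomial expressions in the power sums
    have expectations automatically. *)
Definition bounded_rv X := measurable_fun setT X /\ exists M : R, forall w, `|X w| <= M.

Lemma bounded_rv_cst (c : R) : bounded_rv (fun _ => c).
Proof. by split; [exact: measurable_cst|exists `|c|]. Qed.

Lemma bounded_rvD X Y : bounded_rv X -> bounded_rv Y -> bounded_rv (fun w => X w + Y w).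
Proof.
move=> [mX [M XM]] [mY [L YL]]; split; first exact: measurable_funD.
by exists (M + L) => w; apply: le_trans (ler_normD _ _) (lerD _ _).
Qed.

Lemma bounded_rvM X Y : bounded_rv X -> bounded_rv Y -> bounded_rv (fun w => X w * Y w).
Proof.
move=> [mX [M XM]] [mY [L YL]]; split; first exact: measurable_funM.
by exists (M * L) => w; rewrite normrM ler_pM.
Qed.

Lemma bounded_rvZ (c : R) X : bounded_rv X -> bounded_rv (fun w => c * X w).
Proof. by apply: bounded_rvM; exact: bounded_rv_cst. Qed.

Lemma bounded_rvB X Y : bounded_rv X -> bounded_rv Y -> bounded_rv (fun w => X w - Y w).
Proof.
move=> bX bY; have := bounded_rvD bX (bounded_rvZ (-1) bY).
by under eq_fun do rewrite mulN1r.
Qed.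

Lemma bounded_rvX X n : bounded_rv X -> bounded_rv (fun w => X w ^+ n).
Proof.
move=> bX; elim: n => [|n IH]; first exact: bounded_rv_cst.
by under eq_fun do rewrite exprS; exact: bounded_rvM.
Qed.

Lemma bounded_rv_sum (I : Type) (s : seq I) (F : I -> T -> R) :
  (forall i, bounded_rv (F i)) -> bounded_rv (fun w => \sum_(i <- s) F i w).
Proof.
move=> bF; elim: s => [|i s IH].
  by under eq_fun do rewrite big_nil; exact: bounded_rv_cst.
by under eq_fun do rewrite big_cons; exact: bounded_rvD.
Qed.

Lemma bounded_rv_prod (I : Type) (s : seq I) (F : I -> T -> R) :
  (forall i, bounded_rv (F i)) -> bounded_rv (fun w => \prod_(i <- s) F i w).
Proof.
move=> bF; elim: s => [|i s IH].
  by under eq_fun do rewrite big_nil; exact: bounded_rv_cst.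
by under eq_fun do rewrite big_cons; exact: bounded_rvM.
Qed.

Lemma bounded_rv_integrable X : bounded_rv X -> P.-integrable setT (EFin \o X).
Proof.
move=> [mX [M XM]]; apply: measurable_bounded_integrable => //.
  by rewrite (le_lt_trans (probability_le1 _ _))// ltry.
exists M; split; rewrite ?num_real// => x Mx w _.
exact: le_trans (XM w) (ltW Mx).
Qed.

Local Notation E X := (Rintegral P setT X).

Lemma bounded_expD X Y : bounded_rv X -> bounded_rv Y -> E (fun w => X w + Y w) = E X + E Y.
Proof. by move=> bX bY; rewrite RintegralD//; exact: bounded_rv_integrable. Qed.

Lemma bounded_expB X Y : bounded_rv X -> bounded_rv Y -> E (fun w => X w - Y w) = E X - E Y.
Proof. by move=> bX bY; rewrite RintegralB//; exact: bounded_rv_integrable. Qed.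

Lemma bounded_expZ (c : R) X : bounded_rv X -> E (fun w => c * X w) = c * E X.
Proof. by move=> bX; rewrite RintegralZl//; exact: bounded_rv_integrable. Qed.

Lemma exp_cst (c : R) : E (fun _ => c) = c.
Proof. by rewrite Rintegral_cst//= probability_setT mulr1. Qed.

Lemma bounded_exp_sum (I : Type) (s : seq I) (F : I -> T -> R) :
  (forall i, bounded_rv (F i)) -> E (fun w => \sum_(i <- s) F i w) = \sum_(i <- s) E (F i).
Proof.
move=> bF; elim: s => [|i s IH].
  by under eq_Rintegral do rewrite big_nil; rewrite exp_cst big_nil.
under eq_Rintegral do rewrite big_cons.
by rewrite bounded_expD ?IH ?big_cons//; exact: bounded_rv_sum.
Qed.

End BoundedRandomVariables.

(** * Variance bound and moment recursion for linear combinations of squared power sums *)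

Section CueStatistics.
Context {R : realType} (N : nat) d (T : measurableType d) (P : probability T R).
Variable theta : {RV P >-> N.-tuple R}.
Hypothesis cue : cue_angles theta.
Local Notation E X := (Rintegral P setT X).
Local Notation q k := (fun w => sq_power_sum k (theta w)).

Lemma bounded_sq_power_sum k : bounded_rv (q k).
Proof.
have mq : measurable_fun setT (q k).
  exact: (measurableT_comp (@measurable_sq_power_sum R N k) (measurable_funPT theta)).
split=> //; exists (N%:R ^+ 2 + N%:R ^+ 2) => w.
rewrite ger0_norm ?sq_power_sum_ge0// /sq_power_sum.
have le_sq (g : R -> R) : (forall x, `|g x| <= 1) ->
    (\sum_i g (k%:R * tnth (theta w) i)) ^+ 2 <= N%:R ^+ 2.
  move=> g1; rewrite -real_normK ?num_real// lerXn2r ?nnegrE//.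
  apply: le_trans (ler_norm_sum _ _ _) _.
  apply: (@le_trans _ _ (\sum_(i < N) 1)); last by rewrite sumr_const card_ord.
  exact: ler_sum.
by apply: lerD; apply: le_sq => x; [exact: cos_max|exact: sin_max].
Qed.

Lemma exp_prod_sq_power_sum ks : E (fun w => \prod_(k <- ks) q k w) = (moment N ks)%:~R.
Proof. by rewrite /Rintegral (cue_moment cue). Qed.

Lemma exp_sq_power_sum k : E (q k) = (moment N [:: k])%:~R.
Proof. by rewrite -exp_prod_sq_power_sum; apply: eq_Rintegral => w _; rewrite big_seq1. Qed.

Lemma variance_linear_le (a : nat -> R) (m n : nat) : (0 < m)%N ->
  E (fun w => (\sum_(m <= k < n) a k * (q k w - (moment N [:: k])%:~R)) ^+ 2) <=
  3 * N%:R ^+ 2 * \sum_(m <= k < n) a k ^+ 2.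
Proof.
move=> m0; apply: le_trans (covariance_form_le N a n m0).
under eq_Rintegral.
  move=> w _; rewrite expr2 mulr_suml; under eq_bigr do rewrite mulr_sumr.
  over.
have bc k : bounded_rv (fun w => q k w - (moment N [:: k])%:~R).
  by apply: bounded_rvB; [exact: bounded_sq_power_sum|exact: bounded_rv_cst].
have bac k := bounded_rvZ (a k) (bc k).
rewrite (@bounded_exp_sum _ _ _ _ _ _ (fun s w => \sum_(m <= t < n)
  a s * (q s w - (moment N [:: s])%:~R) * (a t * (q t w - (moment N [:: t])%:~R)))); last first.
  by move=> s; apply: bounded_rv_sum => t; exact: bounded_rvM.
apply: ler_sum => s _.
rewrite (@bounded_exp_sum _ _ _ _ _ _ (fun t w => 
  a s * (q s w - (moment N [:: s])%:~R) * (a t * (q t w - (moment N [:: t])%:~R)))); last first.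
  by move=> t; exact: bounded_rvM.
apply: ler_sum => t _.
set ms : R := (moment N [:: s])%:~R; set mt : R := (moment N [:: t])%:~R.
under eq_Rintegral.
  move=> w _.
  rewrite (_ : _ * _ = a s * a t * (\prod_(k <- [:: s; t]) q k w + (- mt * q s w + - ms * q t w + ms * mt))); last first.
    by rewrite big_cons big_seq1; ring.
  over.
have bq := bounded_sq_power_sum.
have bp : bounded_rv (fun w => \prod_(k <- [:: s; t]) q k w) by exact: bounded_rv_prod.
have b1 := bounded_rvZ (- mt) (bq s).
have b2 := bounded_rvZ (- ms) (bq t).
have b12 := bounded_rvD b1 b2.
have bm : bounded_rv (fun _ : T => ms * mt) by exact: bounded_rv_cst.
rewrite bounded_expZ; last by apply: bounded_rvD => //; exact: bounded_rvD.
rewrite bounded_expD//; last exact: bounded_rvD.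
rewrite (@bounded_expD _ _ _ _ (fun w => - mt * q s w + - ms * q t w))//.
rewrite (@bounded_expD _ _ _ _ (fun w => - mt * q s w))//.
rewrite exp_cst !bounded_expZ// exp_prod_sq_power_sum !exp_sq_power_sum -/ms -/mt.
by rewrite rmorphB rmorphM /= -/ms -/mt le_eqVlt; apply/orP; left; apply/eqP; ring.
Qed.

Section MomentRecursion.
Variables (M : nat) (b : nat -> R).
Let Y (w : T) := \sum_(1 <= k < M.+1) b k * (q k w - k%:R).

Lemma bounded_Y : bounded_rv Y.
Proof.
apply: bounded_rv_sum => k; apply: bounded_rvZ; apply: bounded_rvB.
  exact: bounded_sq_power_sum.
exact: bounded_rv_cst.
Qed.

Let W ks n := E (fun w => \prod_(k <- ks) q k w * Y w ^+ n).

Let bounded_W ks n : bounded_rv (fun w => \prod_(k <- ks) q k w * Y w ^+ n).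
Proof.
apply: bounded_rvM; last exact/bounded_rvX/bounded_Y.
by apply: bounded_rv_prod => k; exact: bounded_sq_power_sum.
Qed.

Let W_S ks n : W ks n.+1 = \sum_(1 <= l < M.+1) b l * (W (l :: ks) n - l%:R * W ks n).
Proof.
rewrite /W.
transitivity (E (fun w => \sum_(1 <= l < M.+1) b l *
   (\prod_(k <- l :: ks) q k w * Y w ^+ n - l%:R * (\prod_(k <- ks) q k w * Y w ^+ n)))).
  apply: eq_Rintegral => w _; rewrite exprSr {2}/Y mulrA mulr_sumr.
  by apply: eq_bigr => l _; rewrite big_cons; ring.
have bZ l : bounded_rv (fun w => l%:R * (\prod_(k <- ks) q k w * Y w ^+ n)) by exact: bounded_rvZ.
rewrite bounded_exp_sum; last first.
  by move=> l; apply: bounded_rvZ; exact: bounded_rvB.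
apply: eq_bigr => l _; rewrite bounded_expZ; last exact: bounded_rvB.
by rewrite bounded_expB// bounded_expZ.
Qed.

(** For independent exponential variables this is E[q g(q)] = k E[g(q)] + k E[q g'(q)]: the
    repetitions of [k] in [ks] and the power of [Y] are differentiated in turn. The list [ks] is
    general because expanding a factor [Y] inserts a new index. The size condition keeps the total
    degree at most [N]. *)
Let W_rec n ks k : (1 <= k <= M)%N -> all (fun l => 1 <= l <= M)%N ks ->
  ((n + size ks).+1 * M <= N)%N ->
  W (k :: ks) n = (k * (count_mem k ks).+1)%:R * W ks n + (k * n)%:R * b k * W (k :: ks) n.-1.
Proof.
move=> kM; elim: n ks => [|n IH] ks ksM hN.
  rewrite muln0 mul0r mul0r addr0 /W.
  under eq_Rintegral do rewrite expr0 mulr1.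
  under [in RHS]eq_Rintegral do rewrite expr0 mulr1.
  rewrite !exp_prod_sq_power_sum moment_cons; first by rewrite rmorphM /= -pmulrn.
  - by case/andP: kM.
  - by apply: sub_all ksM => l /andP[].
  - have sM : (sumn ks <= size ks * M)%N.
      elim: (ks) ksM => //= l s IHs /andP[/andP[_ lM] /IHs]; rewrite mulSn; lia.
    by move: hN; rewrite add0n mulSn; lia.
rewrite W_S.
(* Inserting [l] raises the multiplicity of [k] exactly when [l == k]; this isolated term supplies
   the increment from [n] to [n.+1] in the last coefficient. *)
transitivity (\sum_(1 <= l < M.+1) (
    (k * (count_mem k ks).+1)%:R * (b l * (W (l :: ks) n - l%:R * W ks n)) +
    (k%:R * (if l == k then b l * W (l :: ks) n else 0) +
    (k * n)%:R * b k * (b l * (W (l :: k :: ks) n.-1 - l%:R * W (k :: ks) n.-1))))).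
  rewrite big_nat [RHS]big_nat; apply: eq_bigr => l /andP[l1 lM].
  have -> : W (l :: k :: ks) n = W (k :: l :: ks) n.
    by rewrite /W; apply: eq_Rintegral => w _; rewrite !big_cons [q l w * _]mulrCA.
  have -> : W (l :: k :: ks) n.-1 = W (k :: l :: ks) n.-1.
    by rewrite /W; apply: eq_Rintegral => w _; rewrite !big_cons [q l w * _]mulrCA.
  rewrite (IH (l :: ks)); last 2 first.
  - by rewrite /= l1 -ltnS lM.
  - by move: hN; rewrite /= addnS -addSn.
  rewrite (IH ks)//; last by apply: leq_trans hN; rewrite leq_mul2r ltnS leq_add2r leqnSn orbT.
  rewrite /=; case: eqP => [->|_]; rewrite ?add1n ?add0n !natrM -?natr1; ring.
rewrite big_split big_split /= -!mulr_sumr -W_S; congr (_ + _).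
rewrite (bigD1_seq k) ?iota_uniq ?mem_index_iota ?ltnS//= eqxx big1 ?addr0; last first.
  by move=> l /negbTE ->.
(* For [n = 0] the value [n.-1] is a dummy, annihilated by the coefficient [k * n]. *)
have [->|n0] := posnP n.
  by rewrite muln0 !mul0r addr0 muln1; ring.
rewrite -W_S prednK// mulnS natrD; ring.
Qed.

Definition power_moment n := E (fun w => Y w ^+ n).

(** These sums close the recursion: [j = 0] gives the next moment of [Y], and each reduction of [n]
    adds a factor [k%:R * b k]. *)
Definition mixed_moment j n := \sum_(1 <= k < M.+1) b k * (k%:R * b k) ^+ j *
  (E (fun w => q k w * Y w ^+ n) - k%:R * power_moment n).

Let WE k n : W [:: k] n = E (fun w => q k w * Y w ^+ n).
Proof. by rewrite /W; apply: eq_Rintegral => w _; rewrite big_seq1. Qed.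

Let W0E n : W [::] n = power_moment n.
Proof. by rewrite /W; apply: eq_Rintegral => w _; rewrite big_nil mul1r. Qed.

Lemma power_moment0 : power_moment 0 = 1.
Proof. by rewrite /power_moment; under eq_Rintegral do rewrite expr0; rewrite exp_cst. Qed.

Lemma power_momentS n : power_moment n.+1 = mixed_moment 0 n.
Proof.
rewrite -W0E W_S; apply: eq_bigr => k _.
by rewrite expr0 mulr1 WE W0E.
Qed.

Lemma mixed_moment0 j : (M <= N)%N -> mixed_moment j 0 = 0.
Proof.
move=> MN; rewrite /mixed_moment big_nat big1// => k /andP[k1 kM].
rewrite -WE -W0E W_rec//=; last 2 first.
- by rewrite k1 -ltnS.
- by rewrite mul1n.
by rewrite muln0 muln1; ring.
Qed.

(** With [ks] empty, [W_rec] turns the centred term into n + 1 times k b_k E[q_k Y^n]; splitting q_k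
    into its centred part and its mean [k] yields the two summands. *)
Lemma mixed_momentS j n : (n.+2 * M <= N)%N ->
  mixed_moment j n.+1 = n.+1%:R * (mixed_moment j.+1 n +
     (\sum_(1 <= k < M.+1) (k%:R * b k) ^+ j.+2) * power_moment n).
Proof.
move=> hN; rewrite /mixed_moment mulr_suml -big_split mulr_sumr /=.
rewrite big_nat [RHS]big_nat; apply: eq_bigr => k /andP[k1 kM].
rewrite -!WE -!W0E [W [:: k] n.+1]W_rec//=; last 2 first.
- by rewrite k1 -ltnS.
- by rewrite addn0.
by rewrite muln1 natrM !exprS; ring.
Qed.

End MomentRecursion.
End CueStatistics.

(** * Square-integrable random variables *)

Section SquareIntegrable.
Context {R : realType} d (T : measurableType d) (P : probability T R).
Implicit Types X Y : T -> R.
Local Notation E X := (Rintegral P setT X).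

Definition square_integrable X :=
  measurable_fun setT X /\ P.-integrable setT (EFin \o (fun w => X w ^+ 2)).

Lemma square_integrable_le X Y : measurable_fun setT X ->
  P.-integrable setT (EFin \o Y) -> (forall w, X w ^+ 2 <= Y w) -> square_integrable X.
Proof.
move=> mX iY XY; split => //; apply: le_integrable iY => //.
  by apply/measurable_EFinP; exact: measurable_funX.
move=> w _; rewrite /= lee_fin !ger0_norm ?sqr_ge0//.
by apply: le_trans (XY w); exact: sqr_ge0.
Qed.

Lemma square_integrableP X : measurable_fun setT X ->
  (\int[P]_w (X w ^+ 2)%:E < +oo)%E -> square_integrable X.
Proof.
move=> mX Xoo; split => //; apply/integrableP; split.
  by apply/measurable_EFinP; exact: measurable_funX.
by under eq_integral => w _ do rewrite /= ger0_norm ?sqr_ge0//.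
Qed.

Lemma square_integrable_integrable X : square_integrable X -> P.-integrable setT (EFin \o X).
Proof.
move=> [mX iX].
have i1 : P.-integrable setT (EFin \o (fun w => 1 + X w ^+ 2)).
  have ic : P.-integrable setT (EFin \o (fun _ : T => (1 : R))).
    exact/bounded_rv_integrable/bounded_rv_cst.
  by have := integrableD measurableT ic iX; apply: eq_integrable.
apply: le_integrable i1 => //; first exact/measurable_EFinP.
move=> w _; rewrite /= lee_fin [leRHS]ger0_norm ?addr_ge0 ?sqr_ge0//.
by have := sqr_ge0 (`|X w| - 1); rewrite -(real_normK (num_real (X w))); nra.
Qed.

Lemma square_integrableD X Y : square_integrable X -> square_integrable Y ->
  square_integrable (fun w => X w + Y w).
Proof.
move=> [mX iX] [mY iY].
have i1 : P.-integrable setT (EFin \o (fun w => 2 * (X w ^+ 2 + Y w ^+ 2))).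
  have := integrableZl measurableT 2 (integrableD measurableT iX iY).
  by apply: eq_integrable => // w _; rewrite /= EFinM.
apply: square_integrable_le i1 _; first exact: measurable_funD.
by move=> w; have := sqr_ge0 (X w - Y w); nra.
Qed.

Lemma square_integrableZ (c : R) X : square_integrable X -> square_integrable (fun w => c * X w).
Proof.
move=> [mX iX].
have i1 : P.-integrable setT (EFin \o (fun w => c ^+ 2 * X w ^+ 2)).
  have := integrableZl measurableT (c ^+ 2) iX.
  by apply: eq_integrable => // w _; rewrite /= EFinM.
apply: square_integrable_le i1 _; first exact: measurable_funM.
by move=> w; rewrite exprMn.
Qed.

Lemma square_integrableB X Y : square_integrable X -> square_integrable Y ->
  square_integrable (fun w => X w - Y w).
Proof.
move=> sX sY; have := square_integrableD sX (square_integrableZ (-1) sY).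
by under eq_fun do rewrite mulN1r.
Qed.

Lemma bounded_square_integrable X : bounded_rv X -> square_integrable X.
Proof.
move=> bX; split; first by case: bX.
by apply: bounded_rv_integrable; exact: bounded_rvX.
Qed.

Lemma variance_le X : square_integrable X ->
  E (fun w => (X w - E X) ^+ 2) <= E (fun w => X w ^+ 2).
Proof.
move=> sX; set e := E X.
have iX := square_integrable_integrable sX.
have iX2 := sX.2.
have ic : P.-integrable setT (EFin \o (fun _ : T => e ^+ 2)).
  exact/bounded_rv_integrable/bounded_rv_cst.
have ieX : P.-integrable setT (EFin \o (fun w => 2 * e * X w)).
  have := integrableZl measurableT (2 * e) iX.
  by apply: eq_integrable => // w _; rewrite /= EFinM.
have iB : P.-integrable setT (EFin \o (fun w => e ^+ 2 - 2 * e * X w)).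
  by have := integrableB measurableT ic ieX; apply: eq_integrable.
rewrite (_ : E _ = E (fun w => X w ^+ 2 + (e ^+ 2 - 2 * e * X w))); last first.
  by apply: eq_Rintegral => w _; ring.
rewrite RintegralD// RintegralB// exp_cst RintegralZl// -/e.
by rewrite gerDl; have := sqr_ge0 e; nra.
Qed.

Lemma square_exp_fine X : square_integrable X ->
  (\int[P]_w (X w ^+ 2)%:E = (E (fun w => X w ^+ 2))%:E)%E.
Proof.
move=> [mX iX]; rewrite /Rintegral fineK//.
exact: integrable_fin_num.
Qed.

Lemma square_expD_le X Y : square_integrable X -> square_integrable Y ->
  E (fun w => (X w + Y w) ^+ 2) <= 2 * E (fun w => X w ^+ 2) + 2 * E (fun w => Y w ^+ 2).
Proof.
move=> sX sY; have iX := sX.2; have iY := sY.2.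
have i2 Z : P.-integrable setT (EFin \o (fun w => Z w ^+ 2)) ->
    P.-integrable setT (EFin \o (fun w => 2 * Z w ^+ 2)).
  move=> iZ; have := integrableZl measurableT 2 iZ.
  by apply: eq_integrable => // w _; rewrite /= EFinM.
have iD : P.-integrable setT (EFin \o (fun w => 2 * X w ^+ 2 + 2 * Y w ^+ 2)).
  by have := integrableD measurableT (i2 _ iX) (i2 _ iY); apply: eq_integrable.
rewrite -!RintegralZl// -RintegralD//; [|exact: i2|exact: i2].
apply: le_Rintegral => //; first exact: (square_integrableD sX sY).2.
by move=> w _; have := sqr_ge0 (X w - Y w); nra.
Qed.

End SquareIntegrable.

(** * The pair statistic of a square-integrable function *)

Section PairStatistic.
Context {R : realType} (N : nat) d (T : measurableType d) (P : probability T R).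
Variable theta : {RV P >-> N.-tuple R}.
Hypothesis cue : cue_angles theta.
Local Notation E X := (Rintegral P setT X).
Local Notation mu := (@lebesgue_measure R).
Local Notation q k := (fun w => sq_power_sum k (theta w)).
Local Notation S g := (fun w => pair_stat g (theta w)).

(** The factors are the normalization, the bound 4 on each squared distance, the volume of the other
    angles, and two periods for a difference. It is crude in [N], but multiplies only an
    approximation error sent to 0 at fixed [N]. *)
Definition pair_constant : R :=
  cue_constant N * (4 ^+ (N * N) * ((2 * pi) ^+ N.-1 * 2)).

Lemma pair_constant_ge0 : 0 <= pair_constant.
Proof.
by rewrite !mulr_ge0 ?cue_constant_ge0 ?exprn_ge0// ltW// twopi_gt0.
Qed.

Lemma weight_le (t : N.-tuple R) : weight t <= 4 ^+ (N * N).
Proof.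
rewrite /weight.
apply: (@le_trans _ _ (\prod_(j < N) \prod_(k < N) (4 : R))); last first.
  by rewrite !prodr_const card_ord -exprM.
apply: ler_prod => j _; apply/andP; split.
  by apply: prodr_ge0 => k _; exact: sqr_ge0.
rewrite big_mkcond; apply: ler_prod => k _; case: ifP => _; last first.
  by rewrite ler01 ler1n.
rewrite sqr_ge0 /= /expi; simpc; rewrite sqr_sqrtr ?addr_ge0 ?sqr_ge0//.
set a := tnth t j; set b := tnth t k.
have := cos2Dsin2 a; have := cos2Dsin2 b.
have := sqr_ge0 (cos a + cos b); have := sqr_ge0 (sin a + sin b).
by nra.
Qed.

Lemma cue_pair_bound (g : R -> R) (B : R) (i j : 'I_N) : measurable_fun setT g ->
  (forall x, 0 <= g x) -> (forall x, g (x + 2 * pi) = g x) ->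
  (\int[mu]_(x in `[0%R, (2 * pi)%R]) (g x)%:E <= B%:E)%E -> i != j ->
  (\int[P]_w (g (tnth (theta w) i - tnth (theta w) j))%:E <= (pair_constant * B)%:E)%E.
Proof.
move=> mg g0 g2pi gB ij.
have mgd (k l : 'I_N) : measurable_fun setT (fun t : N.-tuple R => g (tnth t k - tnth t l)).
  have ms : measurable_fun setT (fun t : N.-tuple R => tnth t k - tnth t l).
    by apply: measurable_funB; exact: measurable_tnth.
  exact: (measurableT_comp mg ms).
have B2 (x : R) : (2%:E * \int[mu]_(x in `[0%R, (2 * pi)%R]) (g x)%:E <= (2 * B)%:E)%E.
  by rewrite EFinM lee_wpmul2l.
rewrite (cue_integral cue (g := fun t => (g (tnth t i - tnth t j))%:E)); last 2 first.
- exact/measurable_EFinP.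
- by move=> t; rewrite lee_fin.
have mc : measurable_fun setT (fun t : N.-tuple R => circle_cube t * g (tnth t i - tnth t j)).
  by apply: measurable_funM => //; exact: measurable_circle_cube.
have c0 : 0 <= cue_constant N * 4 ^+ (N * N) :> R.
  by rewrite mulr_ge0 ?cue_constant_ge0 ?exprn_ge0.
apply: (@le_trans _ _ (tuple_integral (fun t : N.-tuple R =>
    ((cue_constant N * 4 ^+ (N * N)) %:E * (circle_cube t * g (tnth t i - tnth t j))%:E))%E)).
  apply: le_tuple_integral.
  - apply: emeasurable_funM; apply/measurable_EFinP => //.
    exact: measurable_cue_density.
  - by apply: emeasurable_funM => //; exact/measurable_EFinP.
  - by move=> t; rewrite mule_ge0// lee_fin// cue_density_ge0.
  - move=> t; rewrite -!EFinM lee_fin cue_densityE.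
    set u := g _; rewrite (_ : cue_constant N * (circle_cube t * weight t) * u = cue_constant N * (circle_cube t * u) * weight t); last by ring.
    rewrite [leRHS]mulrAC ler_wpM2l ?weight_le//.
    by rewrite !mulr_ge0 ?cue_constant_ge0 ?circle_cube_ge0// /u.
rewrite tuple_integralZl//; last 2 first.
- exact/measurable_EFinP.
- by move=> t; rewrite lee_fin mulr_ge0 ?circle_cube_ge0.
rewrite /pair_constant -!mulrA mulrA [X in (_ <= X)%E]EFinM lee_wpmul2l ?lee_fin//.
case: (ltngtP i j) => [lij|lji|/val_inj ijE]; last by rewrite ijE eqxx in ij.
- apply: (@tuple_integral_cube2 R N (fun x y => g (x - y)) i j (2 * B)) => //.
  + have ms : measurable_fun setT (fun xy : R * R => xy.1 - xy.2) by exact: measurable_funB.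
    exact: (measurableT_comp mg ms).
  + by move=> x Ix; apply: le_trans (B2 x); exact: periodic_bound_sub.
- apply: (@tuple_integral_cube2 R N (fun x y => g (y - x)) j i (2 * B)) => //.
  + have ms : measurable_fun setT (fun xy : R * R => xy.2 - xy.1) by exact: measurable_funB.
    exact: (measurableT_comp mg ms).
  + by move=> x Ix; apply: le_trans (B2 x); exact: periodic_bound_sub'.
Qed.

Lemma measurable_pair_stat (g : R -> R) : measurable_fun setT g -> measurable_fun setT (S g).
Proof.
move=> mg.
have mt (k : 'I_N) : measurable_fun setT (fun w => tnth (theta w) k).
  exact: (measurableT_comp (measurable_tnth k) (measurable_funPT theta)).
apply: measurable_sum => i.
rewrite (_ : (fun _ => _) = fun w => \sum_(j < N) (if i != j then g (tnth (theta w) i - tnth (theta w) j) else 0)).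
  apply: measurable_sum => j; case: (i != j); last exact: measurable_cst.
  exact: (measurableT_comp mg (measurable_funB (mt i) (mt j))).
by apply/funext => w; rewrite big_mkcond.
Qed.

Lemma sqr_sum_le (I : finType) (x : I -> R) : (\sum_i x i) ^+ 2 <= #|I|%:R * \sum_i x i ^+ 2.
Proof.
rewrite expr2 mulr_suml.
apply: (@le_trans _ _ (\sum_i \sum_j (x i ^+ 2 + x j ^+ 2) / 2)).
  apply: ler_sum => i _; rewrite mulr_sumr; apply: ler_sum => j _.
  by have := sqr_ge0 (x i - x j); lra.
under eq_bigr do rewrite -mulr_suml big_split /=.
rewrite -mulr_suml big_split /= exchange_big /=.
rewrite ler_pdivrMr// sumr_const -mulr_natl; lra.
Qed.

Lemma pair_stat_sqr_le (g : R -> R) (t : N.-tuple R) :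
  pair_stat g t ^+ 2 <= (N * N)%:R * \sum_(i < N) \sum_(j < N | i != j) g (tnth t i - tnth t j) ^+ 2.
Proof.
rewrite /pair_stat !pair_big_dep /=.
have -> : (N * N)%:R = #|{: 'I_N * 'I_N}|%:R :> R by rewrite card_prod card_ord.
rewrite big_mkcond [X in _ <= _ * X]big_mkcond.
apply: le_trans (sqr_sum_le _) _; rewrite ler_wpM2l//.
apply: ler_sum => i _; case: ifP => // _; by rewrite expr0n.
Qed.

(** At fixed [N] the pair statistic is a bounded linear map from L^2 of the circle to L^2 of the
    probability space, so mean-square approximation of [f] passes to the statistic. *)
Lemma pair_stat_L2 (g : R -> R) (B : R) : measurable_fun setT g ->
  (forall x, g (x + 2 * pi) = g x) ->
  (\int[mu]_(x in `[0%R, (2 * pi)%R]) (g x ^+ 2)%:E <= B%:E)%E -> 0 <= B ->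
  square_integrable P (S g) /\
  E (fun w => S g w ^+ 2) <= (N * N)%:R * ((N * N)%:R * (pair_constant * B)).
Proof.
move=> mg g2pi gB B0.
have mg2 : measurable_fun setT (fun x => g x ^+ 2) by exact: measurable_funX.
have mt (k : 'I_N) : measurable_fun setT (fun w => tnth (theta w) k).
  exact: (measurableT_comp (measurable_tnth k) (measurable_funPT theta)).
have mij i j : measurable_fun setT (fun w => (g (tnth (theta w) i - tnth (theta w) j) ^+ 2)%:E).
  apply/measurable_EFinP.
  exact: (measurableT_comp mg2 (measurable_funB (mt i) (mt j))).
suff h : (\int[P]_w (S g w ^+ 2)%:E <= ((N * N)%:R * ((N * N)%:R * (pair_constant * B)))%:E)%E.
  have sS : square_integrable P (S g).
    apply: square_integrableP; first exact: measurable_pair_stat.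
    exact: le_lt_trans h (ltry _).
  by split => //; rewrite -lee_fin -square_exp_fine.
apply: (@le_trans _ _ (\int[P]_w ((N * N)%:R%:E * \sum_(i < N) \sum_(j < N | i != j)
    (g (tnth (theta w) i - tnth (theta w) j) ^+ 2)%:E)%E)%E).
  apply: ge0_le_integral => //.
  - by move=> w _; rewrite lee_fin sqr_ge0.
  - by apply/measurable_EFinP; apply: measurable_funX; exact: measurable_pair_stat.
  - apply: emeasurable_funM => //; apply: emeasurable_sum => i.
    under eq_fun do rewrite big_mkcond.
    by apply: emeasurable_sum => j; case: (i != j).
  - move=> w _; under eq_bigr do rewrite sumEFin.
    by rewrite sumEFin -EFinM lee_fin pair_stat_sqr_le.
rewrite ge0_integralZl//; last 2 first.
- apply: emeasurable_sum => i; under eq_fun do rewrite big_mkcond.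
  by apply: emeasurable_sum => j; case: (i != j).
- by move=> w _; apply: sume_ge0 => i _; apply: sume_ge0 => j _; rewrite lee_fin sqr_ge0.
rewrite [X in (_ <= X)%E]EFinM lee_wpmul2l ?lee_fin//.
rewrite ge0_integral_sum//; last 2 first.
- move=> i; under eq_fun do rewrite big_mkcond.
  by apply: emeasurable_sum => j; case: (i != j).
- by move=> i w _; apply: sume_ge0 => j _; rewrite lee_fin sqr_ge0.
apply: (@le_trans _ _ (\sum_(i < N) \sum_(j < N) (pair_constant * B)%:E)%E).
  apply: lee_sum => i _.
  under eq_integral do rewrite big_mkcond.
  rewrite ge0_integral_sum//; last 2 first.
  - by move=> j; case: (i != j).
  - by move=> j w _; case: (i != j) => //; rewrite lee_fin sqr_ge0.
  apply: lee_sum => j _; case: (boolP (i != j)) => ij.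
    apply: (@cue_pair_bound (fun x => g x ^+ 2)) => //; first by move=> x; exact: sqr_ge0.
    by move=> x; rewrite g2pi.
  by rewrite integral0 lee_fin mulr_ge0// pair_constant_ge0.
rewrite (eq_bigr (fun _ => (\sum_(j < N) pair_constant * B)%:E)); last first.
  by move=> i _; rewrite sumEFin.
by rewrite sumEFin lee_fin !sumr_const card_ord -mulrnA -mulr_natl mulr1 mulr_natl.
Qed.

(** The symmetric Fourier partial sum of an even function, frequencies k and -k being merged;
    frequency [n] itself is excluded. *)
Definition cos_sum (a : nat -> R) (n : nat) (x : R) : R :=
  a 0%N + 2 * \sum_(1 <= k < n) a k * cos (k%:R * x).

Lemma pair_stat_cos (k : nat) (t : N.-tuple R) :
  pair_stat (fun x => cos (k%:R * x)) t = sq_power_sum k t - N%:R.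
Proof.
rewrite /pair_stat /sq_power_sum.
have -> : (\sum_i cos (k%:R * tnth t i)) ^+ 2 + (\sum_i sin (k%:R * tnth t i)) ^+ 2 =
    \sum_(i < N) \sum_(j < N) cos (k%:R * (tnth t i - tnth t j)).
  rewrite !expr2 !mulr_suml -big_split; apply: eq_bigr => i _ /=.
  rewrite !mulr_sumr -big_split; apply: eq_bigr => j _ /=.
  by rewrite mulrBr cosB.
rewrite (_ : N%:R = \sum_(i < N) (1 : R)); last by rewrite sumr_const card_ord.
rewrite -sumrB; apply: eq_bigr => i _.
rewrite [in RHS](bigD1 i)//= subrr mulr0 cos0 addrAC subrr add0r.
by apply: eq_bigl => j; rewrite eq_sym.
Qed.

Lemma pair_stat_cos_sum (a : nat -> R) (n : nat) (t : N.-tuple R) :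
  pair_stat (cos_sum a n) t = a 0%N * (N%:R ^+ 2 - N%:R) +
    2 * \sum_(1 <= k < n) a k * (sq_power_sum k t - N%:R).
Proof.
have -> : N%:R ^+ 2 - N%:R = pair_stat (fun=> 1) t :> R.
  have c0 : \sum_(i < N) cos (0%:R * tnth t i) = N%:R.
    rewrite (eq_bigr (fun=> 1)) ?sumr_const ?card_ord// => i _.
    by rewrite mulr0n mul0r cos0.
  have s0 : \sum_(i < N) sin (0%:R * tnth t i) = 0.
    by rewrite big1// => i _; rewrite mulr0n mul0r sin0.
  have := pair_stat_cos 0 t; rewrite /sq_power_sum c0 s0 expr0n addr0 => <-.
  by apply: eq_bigr => i _; apply: eq_bigr => j _; rewrite mulr0n mul0r cos0.
under [X in _ = _ + _ * X]eq_bigr do rewrite -pair_stat_cos.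
rewrite /pair_stat /cos_sum !mulr_sumr.
under [X in _ + X]eq_bigr do rewrite !mulr_sumr.
rewrite [X in _ + X]exchange_big -big_split /=; apply: eq_bigr => i _.
under [X in _ + X]eq_bigr do rewrite !mulr_sumr.
rewrite [X in _ + X]exchange_big mulr_sumr -big_split /=; apply: eq_bigr => j _.
by rewrite mulr1 mulr_sumr.
Qed.

Lemma measurable_cos_sum (a : nat -> R) (n : nat) : measurable_fun setT (cos_sum a n).
Proof.
rewrite /cos_sum; apply: measurable_funD; first exact: measurable_cst.
apply: measurable_funM; first exact: measurable_cst.
apply: measurable_sum => k; apply: measurable_funM; first exact: measurable_cst.
exact: (continuous_measurable_fun (@continuous_cosM R k%:R)).
Qed.

Lemma cos_sum_periodic (a : nat -> R) (n : nat) x : cos_sum a n (x + 2 * pi) = cos_sum a n x.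
Proof.
rewrite /cos_sum; congr (_ + _ * _); apply: eq_bigr => k _; congr (_ * _).
rewrite mulrDr; have := cos_int2pi (R := R) k%:Z; have := sin_int2pi (R := R) k%:Z.
by rewrite -pmulrn cosD => -> ->; rewrite mulr1 mulr0 subr0.
Qed.

(* The statistic splits into a trigonometric polynomial and a remainder whose
   variance is controlled through approximation by longer polynomials. *)
Lemma pair_stat_tail (f : R -> R) (a : nat -> R) (M : nat) (L : R) :
  measurable_fun setT f -> (forall x, f (x + 2 * pi) = f x) ->
  mu.-integrable `[0, 2 * pi] (EFin \o (fun x => f x ^+ 2)) ->
  (forall e : R, 0 < e -> exists2 n, (M < n)%N &
    (\int[mu]_(x in `[0%R, (2 * pi)%R]) ((f x - cos_sum a n x) ^+ 2)%:E <= e%:E)%E) ->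
  (forall n, \sum_(M.+1 <= k < n) a k ^+ 2 <= L) ->
  square_integrable P (S f) /\
  E (fun w => (S f w - E (S f) - 2 * \sum_(1 <= k < M.+1) a k * (q k w - (moment N [:: k])%:~R)) ^+ 2)
   <= 24 * N%:R ^+ 2 * L.
Proof.
move=> mf f2pi if2 fa aL.
have [B fB B0] : exists2 B : R, (\int[mu]_(x in `[0%R, (2 * pi)%R]) (f x ^+ 2)%:E <= B%:E)%E & 0 <= B.
  exists (fine (\int[mu]_(x in `[0%R, (2 * pi)%R]) (f x ^+ 2)%:E)).
    by rewrite fineK//; exact: (integrable_fin_num _ if2).
  by apply/fine_ge0/integral_ge0 => x _; rewrite lee_fin sqr_ge0.
have sf : square_integrable P (S f) by have [] := pair_stat_L2 mf f2pi fB B0.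
split=> //; apply/ler_addgt0Pr => e e0.
pose C := (N * N)%:R * ((N * N)%:R * pair_constant).
have C0 : 0 <= C.
  by apply: mulr_ge0 => //; apply: mulr_ge0 => //; exact: pair_constant_ge0.
(* Twice [C] times this tolerance stays below [e]; adding 1 covers [C = 0]. *)
have e' : 0 < e / (2 * C + 1) by rewrite divr_gt0// ltr_wpDl// mulr_ge0.
have [n nM nB] := fa _ e'.
pose r x := f x - cos_sum a n x.
have mr : measurable_fun setT r by apply: measurable_funB => //; exact: measurable_cos_sum.
have r2pi x : r (x + 2 * pi) = r x by rewrite /r f2pi cos_sum_periodic.
have [sr Er] := pair_stat_L2 mr r2pi nB (ltW e').
pose D w := 2 * \sum_(M.+1 <= k < n) a k * (q k w - (moment N [:: k])%:~R).
have bc k : bounded_rv (fun w => q k w - (moment N [:: k])%:~R).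
  by apply: bounded_rvB; [exact: bounded_sq_power_sum|exact: bounded_rv_cst].
have bD : bounded_rv D.
  by apply: bounded_rvZ; apply: bounded_rv_sum => k; exact: bounded_rvZ.
have bfull : bounded_rv (fun w => 2 * \sum_(1 <= k < n) a k * (q k w - N%:R)).
  apply: bounded_rvZ; apply: bounded_rv_sum => k; apply: bounded_rvZ; apply: bounded_rvB.
    exact: bounded_sq_power_sum.
  exact: bounded_rv_cst.
have SE w : S f w = S r w + (a 0%N * (N%:R ^+ 2 - N%:R) +
    2 * \sum_(1 <= k < n) a k * (q k w - N%:R)).
  rewrite -pair_stat_cos_sum /pair_stat -big_split; apply: eq_bigr => i _ /=.
  by rewrite -big_split; apply: eq_bigr => j _ /=; rewrite /r subrK.
have ESE : E (S f) = E (S r) + (a 0%N * (N%:R ^+ 2 - N%:R) +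
    2 * \sum_(1 <= k < n) a k * ((moment N [:: k])%:~R - N%:R)).
  under eq_Rintegral do rewrite SE.
  have bb : bounded_rv (fun w => a 0%N * (N%:R ^+ 2 - N%:R) +
      2 * \sum_(1 <= k < n) a k * (q k w - N%:R)).
    by apply: bounded_rvD => //; exact: bounded_rv_cst.
  rewrite RintegralD//; [|exact: square_integrable_integrable|exact: bounded_rv_integrable].
  congr (_ + _); rewrite bounded_expD ?exp_cst//; last exact: bounded_rv_cst.
  have bqN k : bounded_rv (fun w => q k w - N%:R).
    by apply: bounded_rvB; [exact: bounded_sq_power_sum|exact: bounded_rv_cst].
  rewrite bounded_expZ; last by apply: bounded_rv_sum => k; exact: bounded_rvZ.
  rewrite (@bounded_exp_sum _ _ _ _ _ _ (fun k w => a k * (q k w - N%:R))); last first.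
    by move=> k; exact: bounded_rvZ.
  congr (_ + _ * _); apply: eq_bigr => k _; rewrite bounded_expZ//.
  rewrite bounded_expB ?exp_cst ?(exp_sq_power_sum cue)//.
    exact: bounded_sq_power_sum.
  exact: bounded_rv_cst.
rewrite (_ : E _ = E (fun w => ((S r w - E (S r)) + D w) ^+ 2)); last first.
  apply: eq_Rintegral => w _; congr (_ ^+ 2).
  rewrite SE ESE /D.
  have split_sum (F : nat -> R) : \sum_(1 <= k < n) F k =
      \sum_(1 <= k < M.+1) F k + \sum_(M.+1 <= k < n) F k.
    by rewrite (@big_cat_nat _ _ _ M.+1).
  have -> : \sum_(1 <= k < n) a k * (q k w - N%:R) =
     \sum_(1 <= k < n) a k * (q k w - (moment N [:: k])%:~R) +
     \sum_(1 <= k < n) a k * ((moment N [:: k])%:~R - N%:R).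
    by rewrite -big_split; apply: eq_bigr => k _ /=; ring.
  by rewrite (split_sum (fun k => a k * (q k w - _))); ring.
have sc : square_integrable P (fun _ : T => E (S r)).
  exact/bounded_square_integrable/bounded_rv_cst.
have sD := bounded_square_integrable P bD.
apply: le_trans (square_expD_le (square_integrableB sr sc) sD) _.
have h1 := le_trans (variance_le sr) Er.
(* Here 12 is 4, from the squared factor 2 in [D], times the 3 of the variance bound; separating off
   the remainder doubles it to 24. *)
have h2 : E (fun w => D w ^+ 2) <= 12 * N%:R ^+ 2 * L.
  rewrite (_ : E _ = 4 * E (fun w => (\sum_(M.+1 <= k < n) a k * (q k w - (moment N [:: k])%:~R)) ^+ 2)).
    have := variance_linear_le cue a n (ltn0Sn M).
    have : 3 * N%:R ^+ 2 * \sum_(M.+1 <= k < n) a k ^+ 2 <= 3 * N%:R ^+ 2 * L.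
      by rewrite ler_wpM2l// mulr_ge0// sqr_ge0.
    lra.
  rewrite -bounded_expZ.
    by apply: eq_Rintegral => w _; rewrite /D exprMn; congr (_ * _); rewrite -natrX.
  by apply: bounded_rvX; apply: bounded_rv_sum => k; exact: bounded_rvZ.
have h3 : 2 * (C * (e / (2 * C + 1))) <= e.
  rewrite (_ : 2 * (C * (e / (2 * C + 1))) = e * (2 * C / (2 * C + 1))); last by ring.
  apply: ler_piMr; first exact: ltW.
  by rewrite ler_pdivrMr ?mul1r ?lerDl// ltr_wpDl// mulr_ge0.
have : 2 * E (fun w => (S r w - E (S r)) ^+ 2) <= e.
  apply: le_trans h3; rewrite ler_wpM2l//; apply: le_trans h1 _.
  by rewrite /C -!mulrA.
lra.
Qed.

End PairStatistic.

(** * The method of moments *)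

Section Taylor.
Context {R : realType}.

(** Derivatives at 0; the factorials are left to [taylor], so differentiation is a mere shift of
    coefficients. *)
Definition cos_coefficient (n : nat) : R := if odd n then 0 else (-1) ^+ n./2.
Definition sin_coefficient (n : nat) : R := if odd n then (-1) ^+ n./2 else 0.

Lemma sin_coefficientS n : sin_coefficient n.+1 = cos_coefficient n.
Proof.
rewrite /sin_coefficient /cos_coefficient /=; case: (boolP (odd n)) => //= on.
by rewrite uphalf_half (negbTE on).
Qed.

Lemma cos_coefficientS n : cos_coefficient n.+1 = - sin_coefficient n.
Proof.
rewrite /sin_coefficient /cos_coefficient /=; case: (boolP (odd n)) => //= on; last by rewrite oppr0.
by rewrite uphalf_half on add1n exprS mulN1r.
Qed.

Definition taylor (c : nat -> R) (n : nat) (x : R) := \sum_(i < n) c i * (x ^+ i / i`!%:R).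

Lemma is_derive_monomial i (x : R) :
  is_derive x 1 (fun x : R => x ^+ i.+1 / i.+1`!%:R) (x ^+ i / i`!%:R).
Proof.
have h : is_derive x 1 (i.+1`!%:R^-1 \*: ((id : R -> R) ^+ i.+1))
    (i.+1`!%:R^-1 *: ((i.+1%:R * x ^+ i) *: (1 : R))).
  by apply: is_deriveZ; exact: is_deriveX.
rewrite (_ : (fun _ => _) = i.+1`!%:R^-1 \*: ((id : R -> R) ^+ i.+1)); last first.
  by apply/funext => y; rewrite mulrC !fctE.
apply: is_derive_eq; rewrite /GRing.scale /= mulr1 factS natrM invfM.
have ? : i.+1%:R != 0 :> R by rewrite pnatr_eq0.
have ? : (i`!)%:R != 0 :> R by rewrite pnatr_eq0 -lt0n fact_gt0.
by field; apply/andP.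
Qed.

Lemma is_derive_taylor (c : nat -> R) n (x : R) :
  is_derive x 1 (taylor c n.+1) (taylor (fun i => c i.+1) n x).
Proof.
have -> : taylor c n.+1 = fun x => c 0%N + \sum_(i < n) c i.+1 * (x ^+ i.+1 / i.+1`!%:R).
  by apply/funext => y; rewrite /taylor big_ord_recl expr0 fact0 divr1 mulr1.
have h : is_derive x 1 (\sum_(i < n) (fun y : R => c i.+1 * (y ^+ i.+1 / i.+1`!%:R)))
    (\sum_(i < n) c i.+1 * (x ^+ i / i`!%:R)).
  apply: is_derive_sum => i; have ? := is_derive_monomial i x.
  exact: is_deriveZ.
rewrite (_ : (fun _ => _) = cst (c 0%N) + \sum_(i < n) (fun y : R => c i.+1 * (y ^+ i.+1 / i.+1`!%:R))); last first.
  by apply/funext => y; rewrite fctE /= fct_sumE.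
by apply: is_derive_eq; rewrite add0r.
Qed.

Lemma derivative_bound_pos (f f' : R -> R) n : (forall x : R, is_derive x 1 f (f' x)) -> f 0 = 0 ->
  (forall x, f' x <= `|x| ^+ n / n`!%:R) -> forall x, 0 <= x -> f x <= x ^+ n.+1 / n.+1`!%:R.
Proof.
move=> df f0 f'b x x0.
have dg (y : R) : is_derive y 1 (fun y : R => y ^+ n.+1 / n.+1`!%:R - f y) (y ^+ n / n`!%:R - f' y).
  have ? := is_derive_monomial n y; have ? := df y.
  exact: is_deriveB.
have := @ger0_derive1_ndecr R (fun y : R => y ^+ n.+1 / n.+1`!%:R - f y) 0 x _ _ _ 0 x (lexx _) x0 (lexx _).
rewrite f0 expr0n /= mul0r subr0 subr_ge0; apply.
- by move=> y _; exact: ex_derive.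
- move=> y; rewrite in_itv /= => /andP[y0 _]; rewrite derive1E (@derive_val _ _ _ _ _ _ _ (dg y)).
  by rewrite subr_ge0 -{2}(gtr0_norm y0).
- apply: continuous_subspaceT => y; apply/differentiable_continuous/derivable1_diffP.
  exact: ex_derive.
Qed.

Lemma derivative_bound (f f' : R -> R) n : (forall x : R, is_derive x 1 f (f' x)) -> f 0 = 0 ->
  (forall x, `|f' x| <= `|x| ^+ n / n`!%:R) -> forall x, `|f x| <= `|x| ^+ n.+1 / n.+1`!%:R.
Proof.
move=> df f0 f'b.
have pos (g g' : R -> R) : (forall x : R, is_derive x 1 g (g' x)) -> g 0 = 0 ->
    (forall x, `|g' x| <= `|x| ^+ n / n`!%:R) -> forall x, 0 <= x -> `|g x| <= x ^+ n.+1 / n.+1`!%:R.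
  move=> dg g0 g'b x x0; rewrite ler_norml; apply/andP; split.
    rewrite lerNl; apply: (@derivative_bound_pos (fun y => - g y) (fun y => - g' y) n) => //.
    - by rewrite g0 oppr0.
    - by move=> y; apply: le_trans (g'b y); rewrite -normrN; exact: ler_norm.
  apply: (@derivative_bound_pos g g' n) => //.
  by move=> y; apply: le_trans (g'b y); exact: ler_norm.
move=> x; have [x0|x0] := leP 0 x; first by rewrite (ger0_norm x0); exact: (pos f f').
rewrite (ltr0_norm x0) -{1}(opprK x).
apply: (pos (fun y => f (- y)) (fun y => - f' (- y))) => [y|||]; last by rewrite oppr_ge0 ltW.
- have ? := df (- y).
  have -> : - f' (- y) = f' (- y) * (-1) by rewrite mulrN1.
  exact: (@is_derive1_comp _ f -%R).
- by rewrite oppr0.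
- by move=> y; rewrite normrN; apply: le_trans (f'b _) _; rewrite normrN.
Qed.

Lemma taylor0 (c : nat -> R) n : taylor c n.+1 0 = c 0%N.
Proof.
rewrite /taylor big_ord_recl expr0 fact0 divr1 mulr1 big1 ?addr0// => i _.
by rewrite expr0n /= mul0r mulr0.
Qed.

(** Cosine and sine are treated together because the remainder of each differentiates, up to sign,
    to the remainder of the other at the previous order. *)
Lemma cos_sin_taylor n (x : R) :
  `|cos x - taylor cos_coefficient n x| <= `|x| ^+ n / n`!%:R /\
  `|sin x - taylor sin_coefficient n x| <= `|x| ^+ n / n`!%:R.
Proof.
elim: n x => [|n IH] x.
  by rewrite /taylor !big_ord0 !subr0 expr0 fact0 divr1 cos_max sin_max.
have ct (y : R) := is_derive_taylor cos_coefficient n y.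
have st (y : R) := is_derive_taylor sin_coefficient n y.
split.
- apply: (@derivative_bound (fun y => cos y - taylor cos_coefficient n.+1 y)
    (fun y => - sin y - taylor (fun i => cos_coefficient i.+1) n y)).
  + by rewrite cos0 taylor0 /cos_coefficient /= expr0 subrr.
  + move=> y; have [_] := IH y; rewrite -normrN; congr (`|_| <= _).
    rewrite opprB addrC; congr (_ + _); rewrite /taylor -sumrN; apply: eq_bigr => i _.
    by rewrite cos_coefficientS mulNr opprK.
- apply: (@derivative_bound (fun y => sin y - taylor sin_coefficient n.+1 y)
    (fun y => cos y - taylor (fun i => sin_coefficient i.+1) n y)).
  + by rewrite sin0 taylor0 /sin_coefficient /= subrr.
  + move=> y; have [+ _] := IH y; congr (`|_| <= _).
    congr (_ - _); apply: eq_bigr => i _.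
    by rewrite sin_coefficientS.
Qed.

End Taylor.

Section DensityIntegral.
Context d (T : measurableType d) {R : realType} (mu m : {measure set T -> \bar R}).
Local Open Scope ereal_scope.
Import HBNNSimple.

Lemma ge0_integral_density (w : T -> R) :
  measurable_fun setT w -> (forall t, (0 <= w t)%R) ->
  (forall A, measurable A -> m A = \int[mu]_(t in A) (w t)%:E) ->
  forall g : T -> \bar R, measurable_fun setT g -> (forall t, 0 <= g t) ->
  \int[m]_t g t = \int[mu]_t ((w t)%:E * g t).
Proof.
move=> mw w0 mE; apply: (functional_density (Phi := fun g => \int[mu]_t g t)) => //.
- by move=> s g mg g0; rewrite ge0_integral_sum.
- by move=> c g c0 mg g0; rewrite ge0_integralZl.
- move=> g l mg g0 ndg gl.
  rewrite [X in _ --> X](_ : _ = \int[mu]_t limn (g ^~ t)); last first.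
    by apply: eq_integral => t _; apply/esym/cvg_lim => //; exact: gl.
  by apply: cvg_monotone_convergence => // t _; exact: ndg.
- move=> A mA; rewrite mE// integral_mkcond; apply: eq_integral => x _.
  by rewrite patchE indicE; case: ifP => _; rewrite ?mulr1 ?mulr0.
Qed.

Lemma integrable_density (w : T -> R) :
  measurable_fun setT w -> (forall t, (0 <= w t)%R) ->
  (forall A, measurable A -> m A = \int[mu]_(t in A) (w t)%:E) ->
  forall g : T -> R, measurable_fun setT g ->
  mu.-integrable setT (fun t => (w t * g t)%:E) ->
  m.-integrable setT (EFin \o g) /\ \int[m]_t (g t)%:E = \int[mu]_t (w t * g t)%:E.
Proof.
move=> mw w0 mE g mg iwg.
have mwg : measurable_fun setT (fun t => (w t * g t)%:E).
  by apply/measurable_EFinP; exact: measurable_funM.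
have ig : m.-integrable setT (EFin \o g).
  apply/integrableP; split; first exact/measurable_EFinP.
  rewrite (ge0_integral_density mw w0 mE)//; last first.
    by apply/measurable_EFinP; apply: measurableT_comp.
  case/integrableP : iwg => _; apply: le_lt_trans.
  apply: ge0_le_integral => //.
  - by move=> t _; rewrite mule_ge0// lee_fin.
  - by apply: emeasurable_funM; apply/measurable_EFinP => //; apply: measurableT_comp.
  - exact: measurableT_comp.
  - by move=> t _; rewrite /= -EFinM normrM (ger0_norm (w0 t)).
split => //; rewrite integralE [RHS]integralE.
have mgp : measurable_fun setT (EFin \o g : T -> \bar R) by exact/measurable_EFinP.
rewrite (ge0_integral_density mw w0 mE (measurable_funepos mgp)) //.
rewrite (ge0_integral_density mw w0 mE (measurable_funeneg mgp)) //.
congr (_ - _); apply: eq_integral => t _.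
- by rewrite !funeposE /= -!EFin_max -EFinM maxr_pMr// mulr0.
- by rewrite !funenegE /= -!EFin_max -EFinM maxr_pMr// mulr0 mulrN.
Qed.

End DensityIntegral.

(** * Moments of the standard normal law *)

Section GaussianMoments.
Context {R : realType}.
Local Notation mu := (@lebesgue_measure R).
Local Notation phi := (@normal_pdf R 0 1).
Local Notation nu := (@normal_prob R 0 1).

Fixpoint gaussian_moment (n : nat) : R :=
  match n with
  | 0 => 1
  | 1 => 0
  | (m.+1 as k).+1 => k%:R * gaussian_moment m
  end.

Lemma gaussian_momentSS n : gaussian_moment n.+2 = n.+1%:R * gaussian_moment n.
Proof. by []. Qed.

Let phiE x : phi x = normal_peak 1 * expR (- x ^+ 2 / 2).
Proof. by rewrite normal_pdfE ?oner_eq0// /normal_fun subr0 expr1n. Qed.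

Let peak_gt0 : 0 < normal_peak (1 : R).
Proof. by rewrite normal_peak_gt0. Qed.

Lemma monomial_le_exp n (x : R) : `|x| ^+ n <= n`!%:R * expR `|x|.
Proof.
case: n => [|n]; first by rewrite expr0 fact0 mul1r -[leLHS]expR0 ler_expR.
rewrite -ler_pdivrMl ?ltr0n ?fact_gt0// mulrC.
apply: le_trans (expR_ge1Dxn n (normr_ge0 x)).
by rewrite lerDr.
Qed.

(** A monomial is dominated by a multiple of exp(x) + exp(-x), and exp(x) or exp(-x) times the
    density is sqrt(e) times the normal density centred at 1 or -1. *)
Lemma integrable_monomial_normal n : mu.-integrable setT (fun x => (x ^+ n * phi x)%:E).
Proof.
have iS (s : R) : mu.-integrable setT (fun x => (n`!%:R * expR (1 / 2) * normal_pdf s 1 x)%:E).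
  have := integrableZl measurableT (n`!%:R * expR (1 / 2)) (integrable_normal_pdf s (1 : R)).
  by apply: eq_integrable => // x _; rewrite EFinM.
have iD := integrableD measurableT (iS 1) (iS (- 1)).
apply: le_integrable iD => //.
  apply/measurable_EFinP; apply: measurable_funM; last exact: measurable_normal_pdf.
  exact: exprn_measurable.
move=> x _; rewrite /= lee_fin normrM normrX (ger0_norm (normal_pdf_ge0 _ _ _)).
rewrite [leRHS]ger0_norm; last first.
  by rewrite addr_ge0// !mulr_ge0 ?expR_ge0 ?normal_pdf_ge0.
rewrite phiE !normal_pdfE ?oner_eq0// /normal_fun !expr1n.
have e1 : expR (1 / 2) * expR (- (x - 1) ^+ 2 / 2) = expR (x - x ^+ 2 / 2).
  by rewrite -expRD; congr expR; field.
have e2 : expR (1 / 2) * expR (- (x - -1) ^+ 2 / 2) = expR (- x - x ^+ 2 / 2).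
  by rewrite -expRD; congr expR; field.
rewrite (_ : n`!%:R * expR (1 / 2) * (normal_peak 1 * expR (- (x - 1) ^+ 2 / 2)) +
  n`!%:R * expR (1 / 2) * (normal_peak 1 * expR (- (x - -1) ^+ 2 / 2)) =
  n`!%:R * normal_peak 1 * (expR (1 / 2) * expR (- (x - 1) ^+ 2 / 2) +
     expR (1 / 2) * expR (- (x - -1) ^+ 2 / 2))); last by ring.
rewrite e1 e2.
apply: (@le_trans _ _ (n`!%:R * expR `|x| * (normal_peak 1 * expR (- x ^+ 2 / 2)))).
  by rewrite ler_wpM2r ?monomial_le_exp// mulr_ge0 ?expR_ge0// ltW.
rewrite (_ : _ * expR `|x| * _ = n`!%:R * normal_peak 1 * (expR `|x| * expR (- x ^+ 2 / 2))); last by ring.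
rewrite ler_wpM2l ?mulr_ge0 ?(ltW peak_gt0)// -expRD mulNr.
have [x0|x0] := leP 0 x; first by rewrite ger0_norm// lerDl expR_ge0.
by rewrite ltr0_norm// lerDr expR_ge0.
Qed.

Lemma normal_continuous : continuous phi.
Proof. by apply: continuous_normal_pdf; rewrite oner_eq0. Qed.

Lemma is_derive_normal (x : R) : is_derive x 1 phi (- x * phi x).
Proof.
have -> : phi = fun x => normal_peak 1 * expR (- x ^+ 2 / 2) by apply/funext => y; exact: phiE.
have h : is_derive x 1 (fun x : R => - x ^+ 2 / 2) (- x).
  rewrite (_ : (fun _ => _) = (- 2^-1) \*: ((id : R -> R) ^+ 2)); last first.
    by apply/funext => y; rewrite !fctE; change (- y ^+ 2 / 2 = - 2^-1 * y ^+ 2); ring.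
  have ? : is_derive x 1 ((id : R -> R) ^+ 2) ((2%:R * x ^+ 1) *: (1 : R)) by exact: is_deriveX.
  by apply: is_derive_eq; rewrite /GRing.scale /=; field.
have h2 : is_derive x 1 (fun x : R => expR (- x ^+ 2 / 2)) (expR (- x ^+ 2 / 2) * - x).
  exact: (@is_derive1_comp _ expR (fun x : R => - x ^+ 2 / 2)).
have h3 := is_deriveZ (normal_peak 1) h2.
by apply: is_derive_eq; rewrite /GRing.scale /=; ring.
Qed.

Definition lebesgue_normal_moment n : R := Rintegral mu setT (fun x => x ^+ n * phi x).

Lemma normal_tail_cvg n : (k%:R ^+ n * phi k%:R) @[k --> \oo] --> 0.
Proof.
have peak0 := peak_gt0.
(* The geometric majorant comes from k - k^2 / 2 <= 2 - k, that is, (k - 2)^2 >= 0. *)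
apply: (@squeeze_cvgr _ _ _ _ (fun=> 0) (fun k => n`!%:R * normal_peak 1 * expR 2 * (expR (-1)) ^+ k)).
- near=> k; rewrite mulr_ge0 ?exprn_ge0 ?normal_pdf_ge0//= phiE.
  have := monomial_le_exp n (k%:R : R); rewrite ger0_norm// => h.
  apply: (@le_trans _ _ (n`!%:R * expR k%:R * (normal_peak 1 * expR (- k%:R ^+ 2 / 2)))).
    by rewrite ler_wpM2r// mulr_ge0 ?expR_ge0// ltW.
  rewrite (_ : _ * expR k%:R * _ = n`!%:R * normal_peak 1 * (expR k%:R * expR (- k%:R ^+ 2 / 2))); last by ring.
  rewrite -[leRHS]mulrA ler_wpM2l ?mulr_ge0 ?(ltW peak_gt0)// -expRM_natl -!expRD ler_expR.
  by have := sqr_ge0 (k%:R - 2 : R); lra.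
- exact: cvg_cst.
- rewrite -[X in _ --> X](mulr0 (n`!%:R * normal_peak 1 * expR 2)).
  apply: cvgM; first exact: cvg_cst.
  by apply: cvg_expr; rewrite ger0_norm ?expR_ge0// -[ltRHS]expR0 ltr_expR; lra.
Unshelve. all: by end_near.
Qed.

Lemma cvg_integral_symmetric (g : R -> R) : measurable_fun setT g -> mu.-integrable setT (EFin \o g) ->
  (\int[mu]_(x in `[- k%:R, k%:R]) g x) @[k --> \oo] --> Rintegral mu setT g.
Proof.
move=> mg ig.
have := @dominated_convergence _ _ R mu setT measurableT
  (fun k x => (g x * \1_(`[- k%:R, k%:R]) x)%:E) (EFin \o g) (fun x => `|g x|%:E).
case.
- by move=> k; apply/measurable_EFinP; apply: measurable_funM => //; exact: measurable_indic.
- exact/measurable_EFinP.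
- apply: aeW => x _.
  apply: cvg_near_cst; near=> k; congr EFin.
  rewrite indicE mem_set ?mulr1//= in_itv /= -ler_norml.
  by near: k; exact: nbhs_infty_ger.
- by have := integrable_abse ig; apply: eq_integrable.
- apply: aeW => x k _; rewrite /= lee_fin normrM ler_piMr// indicE.
  by case: (_ \in _); rewrite ?normr1 ?normr0.
move=> _ _ h.
rewrite (_ : (fun k : nat => _) = fun k => fine (\int[mu]_x (g x * \1_(`[- k%:R, k%:R]) x)%:E)); last first.
  apply/funext => k; rewrite /Rintegral [in LHS]integral_mkcond; congr fine.
  apply: eq_integral => x _; rewrite patchE indicE.
  by case: ifP => _; rewrite ?mulr1 ?mulr0.
apply: fine_cvg; rewrite fineK//; exact: integrable_fin_num.
Unshelve. all: by end_near.
Qed.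

(** Integration by parts: the derivative of x^n phi(x) has integral 0 because the boundary terms
    vanish at infinity. For [n = 0] the factor [n%:R] cancels the dummy index. *)
Lemma lebesgue_normal_moment_rec n :
  lebesgue_normal_moment n.+1 = n%:R * lebesgue_normal_moment n.-1.
Proof.
have i1 m := integrable_monomial_normal m.
pose g x := n%:R * (x ^+ n.-1 * phi x) - x ^+ n.+1 * phi x.
have i2 : mu.-integrable setT (fun x => (n%:R * (x ^+ n.-1 * phi x))%:E).
  by have := integrableZl measurableT n%:R (i1 n.-1); apply: eq_integrable.
have ig : mu.-integrable setT (EFin \o g).
  by have := integrableB measurableT i2 (i1 n.+1); apply: eq_integrable.
have cX m : continuous (fun x : R => x ^+ m * phi x).
  by move=> x; apply: cvgM; [exact: exprn_continuous|exact: normal_continuous].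
have cg : continuous g.
  move=> x; apply: cvgB; last exact: cX.
  by apply: cvgM; [exact: cvg_cst|exact: cX].
have dF (x : R) : is_derive x 1 (fun x : R => x ^+ n * phi x) (g x).
  have ? : is_derive x 1 ((id : R -> R) ^+ n) ((n%:R * x ^+ n.-1) *: (1 : R)) by exact: is_deriveX.
  have ? := is_derive_normal x.
  rewrite (_ : (fun _ => _) = (id : R -> R) ^+ n * phi); last by apply/funext => y; rewrite !fctE.
  by apply: is_derive_eq; rewrite /GRing.scale /= /g !fctE exprSr; ring.
have l1 := cvg_integral_symmetric (continuous_measurable_fun cg) ig.
have l2 : \int[mu]_(x in `[- k%:R, k%:R]) g x @[k --> \oo] --> (0 : R).
  have l : (1 - (-1) ^+ n) * (k%:R ^+ n * phi k%:R) @[k --> \oo] --> (0 : R).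
    rewrite -[X in _ --> X](mulr0 (1 - (-1) ^+ n)); apply: cvgM; first exact: cvg_cst.
    exact: normal_tail_cvg.
  apply: cvg_trans l; apply: near_eq_cvg; near=> k.
  have k0 : 0 < k%:R :> R by rewrite ltr0n; near: k; exact: nbhs_infty_gt.
  rewrite (@integral_derivative _ g (fun x : R => x ^+ n * phi x))//; last by lra.
  by rewrite (phiE (- _)) (phiE k%:R) sqrrN [(- k%:R) ^+ n]exprNn; ring.
have : Rintegral mu setT g = 0 by rewrite -(cvg_lim _ l1)// (cvg_lim _ l2).
rewrite /g RintegralB//; [|exact: i1].
rewrite (@RintegralZl _ _ R mu setT (fun x : R => x ^+ n.-1 * phi x) n%:R)//; last exact: i1.
by rewrite -!/(lebesgue_normal_moment _) => /eqP; rewrite subr_eq0 => /eqP ->.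
Unshelve. all: by end_near.
Qed.

Lemma lebesgue_normal_momentE n : lebesgue_normal_moment n = gaussian_moment n.
Proof.
have h n' : lebesgue_normal_moment n' = gaussian_moment n' /\
    lebesgue_normal_moment n'.+1 = gaussian_moment n'.+1.
  elim: n' => [|m [IH1 IH2]]; last first.
    by split => //; rewrite lebesgue_normal_moment_rec IH1.
  split; last by rewrite lebesgue_normal_moment_rec mul0r.
  rewrite /lebesgue_normal_moment; under eq_Rintegral do rewrite expr0 mul1r.
  by rewrite /Rintegral integral_normal_pdf.
by have [] := h n.
Qed.

Lemma normal_moment n :
  nu.-integrable setT (EFin \o (fun x : R => x ^+ n)) /\
  Rintegral nu setT (fun x : R => x ^+ n) = gaussian_moment n.
Proof.
have mphi : measurable_fun setT phi by exact: measurable_normal_pdf.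
have i1 : mu.-integrable setT (fun x => (phi x * x ^+ n)%:E).
  by have := integrable_monomial_normal n; apply: eq_integrable => // x _; rewrite mulrC.
have [] := integrable_density (mu := mu) (m := nu) mphi (normal_pdf_ge0 0 1)
  (fun A _ => erefl) (@exprn_measurable R setT n) i1.
move=> ? h; split => //; rewrite /Rintegral h -lebesgue_normal_momentE /lebesgue_normal_moment.
by rewrite /Rintegral; congr fine; apply: eq_integral => x _; rewrite mulrC.
Qed.

End GaussianMoments.

(** * Uniform approximation by polynomials in an injective function *)

Section Weierstrass.
Context {R : realType}.

(* The Bernstein polynomial of [k |-> f k], [k <= n], by de Casteljau's recursion. *)
Fixpoint bernstein (n : nat) (f : nat -> R) : {poly R} :=
  if n is m.+1 then (1 - 'X) * bernstein m f + 'X * bernstein m (fun k => f k.+1)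
  else (f 0%N)%:P.

Lemma bernsteinS n f u : (bernstein n.+1 f).[u] =
  (1 - u) * (bernstein n f).[u] + u * (bernstein n (fun k => f k.+1)).[u].
Proof. by rewrite /= !hornerE. Qed.

Lemma bernstein_le n f g u : 0 <= u <= 1 -> (forall k, (k <= n)%N -> f k <= g k) ->
  (bernstein n f).[u] <= (bernstein n g).[u].
Proof.
move=> /andP[u0 u1]; elim: n f g => [|n IH] f g fg; first by rewrite /= !hornerE fg.
rewrite !bernsteinS lerD// ler_wpM2l ?subr_ge0//; apply: IH => k kn.
  by apply: fg; exact: leqW.
exact: fg.
Qed.

Lemma bernsteinD n f g u :
  (bernstein n (fun k => f k + g k)).[u] = (bernstein n f).[u] + (bernstein n g).[u].
Proof.
elim: n f g => [|n IH] f g; first by rewrite /= !hornerE.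
by rewrite !bernsteinS !IH; ring.
Qed.

Lemma bernsteinZ n c f u : (bernstein n (fun k => c * f k)).[u] = c * (bernstein n f).[u].
Proof.
elim: n f => [|n IH] f; first by rewrite /= !hornerE.
by rewrite !bernsteinS !IH; ring.
Qed.

Lemma bernstein_cst n c u : (bernstein n (fun=> c)).[u] = c.
Proof.
elim: n => [|n IH]; first by rewrite /= !hornerE.
by rewrite bernsteinS IH; ring.
Qed.

(** Squared bias plus variance of a binomial variable. The centre [c] is general because the
    recursion shifts it by 1. *)
Lemma bernstein_variance n c u :
  (bernstein n (fun k => (k%:R - c) ^+ 2)).[u] = (n%:R * u - c) ^+ 2 + n%:R * (u * (1 - u)).
Proof.
elim: n c => [|n IH] c; first by rewrite /= !hornerE.
rewrite bernsteinS IH.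
have -> : (fun k : nat => (k.+1%:R - c) ^+ 2) = (fun k => (k%:R - (c - 1)) ^+ 2).
  by apply/funext => k; rewrite -natr1; ring.
by rewrite IH -natr1; ring.
Qed.

(** The quadratic modulus is exactly what the positivity of the Bernstein operator and the variance
    formula can exploit: its average is e + C u (1 - u) / n, and n exceeds C / e. *)
Lemma bernstein_approx (G : R -> R) (e C : R) : 0 < e -> 0 <= C ->
  (forall u v, 0 <= u <= 1 -> 0 <= v <= 1 -> `|G u - G v| <= e + C * (u - v) ^+ 2) ->
  exists p : {poly R}, forall u, 0 <= u <= 1 -> `|G u - p.[u]| <= e + e.
Proof.
move=> e0 C0 GC.
pose n := (Num.truncn (C / e)).+1.
have n0 : 0 < n%:R :> R by rewrite ltr0n.
have Cn : C / n%:R <= e.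
  by rewrite ler_pdivrMr// mulrC -ler_pdivrMr//; exact/ltW/truncnS_gt.
exists (bernstein n (fun k => G (k%:R / n%:R))) => u u01.
have kn01 k : (k <= n)%N -> 0 <= (k%:R / n%:R : R) <= 1.
  by move=> kn; rewrite divr_ge0//= ler_pdivrMr// mul1r ler_nat.
have B : (bernstein n (fun k => (e + C / n%:R ^+ 2 * (k%:R - n%:R * u) ^+ 2))).[u] <= e + e.
  rewrite bernsteinD bernstein_cst bernsteinZ bernstein_variance subrr expr0n add0r lerD2l.
  apply: le_trans Cn.
  rewrite (_ : _ * _ = C / n%:R * (u * (1 - u))); last by field; rewrite gt_eqF.
  apply: ler_piMr; first by rewrite divr_ge0// ltW.
  by move: u01 => /andP[? ?]; nra.
have key k : (k <= n)%N -> `|G u - G (k%:R / n%:R)| <= e + C / n%:R ^+ 2 * (k%:R - n%:R * u) ^+ 2.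
  move=> kn; apply: le_trans (GC _ _ u01 (kn01 k kn)) _; rewrite lerD2l.
  rewrite le_eqVlt; apply/orP; left; apply/eqP; field; by rewrite gt_eqF.
have up : (bernstein n (fun k => G (k%:R / n%:R))).[u] <= G u + (e + e).
  apply: le_trans (_ : _ <= G u + _) _; last by rewrite lerD2l; exact: B.
  rewrite -[G u](bernstein_cst n (G u) u) -bernsteinD; apply: bernstein_le => // k kn.
  by have := key k kn; rewrite ler_norml => /andP[]; lra.
have down : G u - (e + e) <= (bernstein n (fun k => G (k%:R / n%:R))).[u].
  apply: (@le_trans _ _ (G u + -1 * (bernstein n (fun k => (e + C / n%:R ^+ 2 * (k%:R - n%:R * u) ^+ 2))).[u])).
    by move: B; lra.
  rewrite -[G u](bernstein_cst n (G u) u) -bernsteinZ -bernsteinD; apply: bernstein_le => // k kn.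
  by have := key k kn; rewrite ler_norml => /andP[]; lra.
by rewrite ler_norml; apply/andP; split; lra.
Qed.

(** Compactness of the square: near the diagonal continuity of [phi] suffices, and away from it
    [c x - c y] is nonzero, so a large multiple of its square dominates. *)
Lemma injective_modulus (phi c : R -> R) (a b e : R) : 0 < e ->
  continuous phi -> continuous c -> {in `[a, b] &, injective c} ->
  exists2 C, 0 <= C &
  forall x y, x \in `[a, b] -> y \in `[a, b] -> `|phi x - phi y| <= e + C * (c x - c y) ^+ 2.
Proof.
move=> e0 cphi cc inj.
have cpt : compact (`[a, b]%classic `*` `[a, b]%classic : set (R * R)).
  by apply: compact_setX; exact: segment_compact.
have cov : near_covering (`[a, b]%classic `*` `[a, b]%classic : set (R * R)).
  exact/compact_near_coveringP.
have := cov nat \oo (fun n xy => `|phi xy.1 - phi xy.2| <= e + n%:R * (c xy.1 - c xy.2) ^+ 2) _.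
case=> [[x y] /= [xab yab]|n _ nP].
  have lim1 (g : R -> R) : continuous g -> (fun xy : R * R => g xy.1 - g xy.2) @ (x, y) --> g x - g y.
    move=> cg; apply: cvgB.
      by apply: (cvg_comp _ g (@cvg_fst _ _ (nbhs x) (nbhs y) _)); exact: cg.
    by apply: (cvg_comp _ g (@cvg_snd _ _ (nbhs x) (nbhs y) _)); exact: cg.
  have [xy|xy] := eqVneq x y.
    have h : \forall xy \near (x, y), `|phi xy.1 - phi xy.2| < e.
      have /cvgr0_norm_lt : (fun xy : R * R => phi xy.1 - phi xy.2) @ (x, y) --> (0 : R).
        by have := lim1 _ cphi; rewrite xy subrr.
      exact.
    exists ([set uv | `|phi uv.1 - phi uv.2| < e], setT); first by split=> //; exact: filterT.
    move=> [[u v] n] /= [uv _]; apply: le_trans (ltW uv) _.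
    by rewrite lerDl mulr_ge0// sqr_ge0.
  have cxy : 0 < (c x - c y) ^+ 2 / 2.
    rewrite divr_gt0// exprn_even_gt0//= subr_eq0; apply: contra_neq xy.
    exact: inj.
  have h1 : \forall xy \near (x, y), (c x - c y) ^+ 2 / 2 < (c xy.1 - c xy.2) ^+ 2.
    have l : (fun xy : R * R => (c xy.1 - c xy.2) ^+ 2) @ (x, y) --> (c x - c y) ^+ 2.
      by rewrite expr2; under eq_fun do rewrite expr2; apply: cvgM; exact: lim1.
    by apply: (cvgr_gt _ l); lra.
  have h2 : \forall xy \near (x, y), `|phi xy.1 - phi xy.2| < `|phi x - phi y| + 1.
    by apply: (cvgr_lt _ (cvg_norm (lim1 _ cphi))); rewrite ltrDl.
  have h3 : \forall n \near \oo, `|phi x - phi y| + 1 <= n%:R * ((c x - c y) ^+ 2 / 2).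
    near=> n; rewrite -ler_pdivrMr//; near: n; exact: nbhs_infty_ger.
  exists ([set uv | (c x - c y) ^+ 2 / 2 < (c uv.1 - c uv.2) ^+ 2 /\
                `|phi uv.1 - phi uv.2| < `|phi x - phi y| + 1],
          [set n | `|phi x - phi y| + 1 <= n%:R * ((c x - c y) ^+ 2 / 2)]).
    by split => //; exact: filterI.
  move=> [[u v] n] /= [[uv1 uv2] hn].
  apply: le_trans (ltW uv2) _; apply: le_trans hn _.
  by apply: ler_wpDl; [exact: ltW|rewrite ler_wpM2l// ltW].
exists n%:R => // u v uab vab.
exact: (nP n (leqnn n) (u, v)).
Unshelve. all: by end_near.
Qed.

End Weierstrass.

Section WeierstrassVariants.
Context {R : realType}.

(** The function to approximate is [phi] read in the variable [c x]. Its modulus comes from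
    [injective_modulus], so regularity of the inverse [cinv] never has to be established. *)
Lemma weierstrass_change (phi c cinv : R -> R) (a b e : R) : 0 < e ->
  continuous phi -> continuous c -> {in `[a, b] &, injective c} ->
  (forall x, x \in `[a, b] -> -1 <= c x <= 1) ->
  (forall u, -1 <= u <= 1 -> cinv u \in `[a, b] /\ c (cinv u) = u) ->
  exists p : {poly R}, forall x, x \in `[a, b] -> `|phi x - p.[c x]| <= e.
Proof.
move=> e0 cphi cc inj cab ci.
have e2 : 0 < e / 2 by rewrite divr_gt0.
have [C C0 hC] := injective_modulus e2 cphi cc inj.
pose G u := phi (cinv (2 * u - 1)).
(* The 4 is the square of the slope of the map from [0, 1] onto [-1, 1]. *)
have [|u v u01 v01|p hp] := @bernstein_approx R G (e / 2) (4 * C) e2; first by rewrite mulr_ge0.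
  have [] := ci (2 * u - 1); first by lra.
  have [] := ci (2 * v - 1); first by lra.
  move=> hv cv hu cu; apply: le_trans (hC _ _ hu hv) _.
  by rewrite cu cv le_eqVlt; apply/orP; left; apply/eqP; ring.
exists (p \Po (2^-1 *: 'X + (2^-1)%:P)) => x xab.
have cx := cab x xab.
rewrite horner_comp !hornerE /=.
have := hp (2^-1 * c x + 2^-1) ltac:(lra).
rewrite -splitr /G (_ : 2 * (2^-1 * c x + 2^-1) - 1 = c x); last by field.
have [xi cxi] := ci _ cx.
by rewrite (inj _ _ xi xab cxi).
Qed.

Lemma weierstrass_cos (phi : R -> R) (e : R) : 0 < e -> continuous phi ->
  exists p : {poly R}, forall x, 0 <= x <= pi -> `|phi x - p.[cos x]| <= e.
Proof.
move=> e0 cphi.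
have [||u u1|p hp] := @weierstrass_change phi cos acos 0 pi e e0 cphi (@continuous_cos R).
- exact: cos_inj.
- by move=> x _; rewrite cos_geN1 cos_le1.
- by split; [rewrite in_itv /= acos_ge0// acos_lepi|rewrite acosK// in_itv].
by exists p => x x0; apply: hp; rewrite in_itv.
Qed.

Lemma weierstrass_sin (phi : R -> R) (e : R) : 0 < e -> continuous phi ->
  exists p : {poly R}, forall x, - (pi / 2) <= x <= pi / 2 -> `|phi x - p.[sin x]| <= e.
Proof.
move=> e0 cphi.
have [||u u1|p hp] := @weierstrass_change phi sin asin (- (pi / 2)) (pi / 2) e e0 cphi (@continuous_sin R).
- exact: sin_inj.
- by move=> x _; rewrite sin_geN1 sin_le1.
- by split; [rewrite in_itv /= asin_geNpi2// asin_lepi2|rewrite asinK// in_itv].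
by exists p => x x0; apply: hp; rewrite in_itv.
Qed.

(** The scale carries [-L, L] onto [-pi/2, pi/2], where sine is injective. Outside, the polynomial
    only repeats values taken inside, so the error is at most 2 B + e, while x^2 / L^2 exceeds 1. *)
Lemma trigonometric_approx (h : R -> R) (B e L : R) : 0 < e -> 0 < L ->
  continuous h -> (forall x, `|h x| <= B) ->
  exists (p : {poly R}) (s : R), forall x, `|h x - p.[sin (s * x)]| <= e + (2 * B + e) / L ^+ 2 * x ^+ 2.
Proof.
move=> e0 L0 ch hB.
have B0 : 0 <= B by exact: le_trans (hB 0).
have pi0 := pi_gt0 R.
pose M := 2 * L / pi.
have M0 : 0 < M by rewrite divr_gt0// mulr_gt0.
have cphi : continuous (fun y => h (M * y)).
  by move=> y; apply: continuous_comp; [exact: mulrl_continuous|exact: ch].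
have [p hp] := weierstrass_sin e0 cphi.
exists p, M^-1 => x.
have [xL|xL] := leP `|x| L.
  apply: le_trans (_ : e <= _); last first.
    by rewrite lerDl; apply: mulr_ge0; [apply: divr_ge0; [lra|exact: sqr_ge0]|exact: sqr_ge0].
  have := hp (M^-1 * x); rewrite mulVKf ?gt_eqF//; apply.
  rewrite -ler_norml normrM gtr0_norm ?invr_gt0// ler_pdivrMl// /M.
  have ME (r : R) : r != 0 -> 2 * L / r * (r / 2) = L by move=> r0; field.
  by rewrite ME ?gt_eqF.
have s1 : -1 <= sin (M^-1 * x) <= 1 by rewrite sin_geN1 sin_le1.
have hs := hp (asin (sin (M^-1 * x))).
rewrite asin_geNpi2// asin_lepi2// asinK// in hs.
have := hs isT => {}hs.
have ps : `|p.[sin (M^-1 * x)]| <= B + e.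
  rewrite -[p.[_]](subKr (h (M * asin (sin (M^-1 * x))))).
  by apply: le_trans (ler_normB _ _) _; exact: lerD.
have x2 : 1 <= x ^+ 2 / L ^+ 2.
  rewrite ler_pdivlMr ?exprn_gt0// mul1r -[leRHS]real_normK ?num_real//.
  by rewrite ler_sqr ?nnegrE ?(ltW L0)//; exact: ltW.
apply: le_trans (ler_normB _ _) _.
have := hB x.
rewrite -mulrA [L ^- 2 * _]mulrC.
by nra.
Qed.

End WeierstrassVariants.

Section TaylorExpectation.
Context {R : realType} d (T : measurableType d) (Q : probability T R).
Local Notation E X := (Rintegral Q setT X).

Lemma abs_exp_le (A C : T -> R) : Q.-integrable setT (EFin \o A) ->
  Q.-integrable setT (EFin \o C) -> (forall w, `|A w| <= C w) -> `|E A| <= E C.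
Proof.
move=> iA iC AC; apply: le_trans (le_normr_Rintegral measurableT iA) _.
apply: le_Rintegral => //.
by have := integrable_abse iA; apply: eq_integrable.
Qed.

Lemma bounded_comp (u : R -> R) (Z : T -> R) (B : R) : continuous u -> (forall x, `|u x| <= B) ->
  measurable_fun setT Z -> bounded_rv (fun w => u (Z w)).
Proof.
move=> cu u1 mZ; split; first exact: (measurableT_comp (continuous_measurable_fun cu) mZ).
by exists B.
Qed.

Lemma integrableZ_real (c : R) (A : T -> R) : Q.-integrable setT (EFin \o A) ->
  Q.-integrable setT (EFin \o (fun w => c * A w)).
Proof.
move=> iA; have := integrableZl measurableT c iA.
by apply: eq_integrable => // w _; rewrite /= EFinM.
Qed.

Lemma integrableD_real (A B : T -> R) : Q.-integrable setT (EFin \o A) ->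
  Q.-integrable setT (EFin \o B) -> Q.-integrable setT (EFin \o (fun w => A w + B w)).
Proof. by move=> iA iB; have := integrableD measurableT iA iB; apply: eq_integrable. Qed.

Lemma integrable_sum_real n (A : 'I_n -> T -> R) : (forall i, Q.-integrable setT (EFin \o A i)) ->
  Q.-integrable setT (EFin \o (fun w => \sum_i A i w)) /\
  E (fun w => \sum_i A i w) = \sum_i E (A i).
Proof.
elim: n A => [|n IH] A iA.
  rewrite big_ord0 (_ : (fun w => _) = (fun=> 0)); last by apply/funext => w; rewrite big_ord0.
  by rewrite exp_cst; split => //; exact/bounded_rv_integrable/bounded_rv_cst.
have [i1 i2] := IH (fun i => A (lift ord0 i)) (fun i => iA _).
rewrite big_ord_recl -i2.
rewrite (_ : (fun w => _) = (fun w => A ord0 w + \sum_(i < n) A (lift ord0 i) w)); last first.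
  by apply/funext => w; rewrite big_ord_recl.
by split; [exact: integrableD_real|rewrite RintegralD].
Qed.

(** For even [n] the Taylor remainder, an absolute power, is an ordinary moment of [Z]. *)
Lemma taylor_expectation (u : R -> R) (c : nat -> R) (t : R) (Z : T -> R) (n : nat) :
  continuous u -> (forall x, `|u x| <= 1) ->
  (forall x, `|u x - taylor c n x| <= `|x| ^+ n / n`!%:R) -> ~~ odd n ->
  measurable_fun setT Z ->
  (forall j, (j <= n)%N -> Q.-integrable setT (EFin \o (fun w => Z w ^+ j))) ->
  `|E (fun w => u (t * Z w)) - \sum_(i < n) c i * t ^+ i / i`!%:R * E (fun w => Z w ^+ i)| <=
  t ^+ n / n`!%:R * E (fun w => Z w ^+ n).
Proof.
move=> cu u1 uc n_even mZ iZ.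
have mtZ : measurable_fun setT (fun w => t * Z w) by exact: measurable_funM.
have bu := bounded_comp cu u1 mtZ.
have iA (i : 'I_n) : Q.-integrable setT (EFin \o (fun w => c i * t ^+ i / i`!%:R * Z w ^+ i)).
  by apply: integrableZ_real; apply: iZ; exact: ltnW.
have [iS ES] := integrable_sum_real iA.
rewrite (eq_bigr (fun i : 'I_n => E (fun w => c i * t ^+ i / i`!%:R * Z w ^+ i))); last first.
  by move=> i _; rewrite RintegralZl//; apply: iZ; exact: ltnW.
have iu := bounded_rv_integrable Q bu.
rewrite -ES -RintegralB// -RintegralZl//; last exact: iZ.
apply: abs_exp_le.
- by have := integrableB measurableT iu iS; apply: eq_integrable.
- by apply: integrableZ_real; exact: iZ.
move=> w; have := uc (t * Z w); rewrite normrM exprMn.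
have absX (x : R) : `|x| ^+ n = x ^+ n.
  by rewrite -normrX ger0_norm// exprn_even_ge0.
rewrite !absX mulrAC; apply: le_trans; rewrite le_eqVlt; apply/orP; left; apply/eqP.
congr (`|_ - _|); apply: eq_bigr => i _; rewrite exprMn; ring.
Qed.

End TaylorExpectation.

(** * Convergence in law from moments of approximants *)

Section MomentMethod.
Context {R : realType} (d : nat -> measure_display) (T : forall n, measurableType (d n))
  (P : forall n, probability (T n) R) (X : forall n, T n -> R).
Arguments X : clear implicits.
Local Notation E n X := (Rintegral (P n) setT X).
Local Notation nu := (@normal_prob R 0 1).
Hypothesis sX : forall n, square_integrable (P n) (X n).
(** The approximant may change with [K]: each tolerance uses a single Taylor expansion, hence
    finitely many moments. *)
Hypothesis approx : forall K : nat, exists Y : forall n, T n -> R,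
  [/\ forall n, bounded_rv (Y n),
      forall j, (j <= K)%N -> E n (fun w => Y n w ^+ j) @[n --> \oo] --> gaussian_moment j &
      E n (fun w => (X n w - Y n w) ^+ 2) @[n --> \oo] --> (0 : R)].

Lemma gaussian_moment_even k : gaussian_moment k.*2 / (k.*2)`!%:R = (2 ^+ k * k`!%:R)^-1 :> R.
Proof.
elim: k => [|k IH]; first by rewrite expr0 mul1r div1r.
rewrite doubleS gaussian_momentSS !factS !natrM.
rewrite (_ : _ / _ = k.*2.+2%:R^-1 * (gaussian_moment k.*2 / (k.*2)`!%:R)).
  rewrite IH -invfM; congr (_^-1); rewrite exprS.
  rewrite (_ : k.*2.+2%:R = 2 * k.+1%:R); first by ring.
  by rewrite -natrM -doubleS -mul2n.
rewrite !invfM.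
have ? : k.*2.+1%:R != 0 :> R by rewrite pnatr_eq0.
have ? : k.*2.+2%:R != 0 :> R by rewrite pnatr_eq0.
have ? : (k.*2)`!%:R != 0 :> R by rewrite pnatr_eq0 -lt0n fact_gt0.
by field; apply/and3P.
Qed.

(** The Gaussian Taylor remainder is the k-th term of the series of exp(t^2 / 2). *)
Lemma taylor_remainder_small (t e : R) : 0 < e ->
  exists k, t ^+ k.*2 / (k.*2)`!%:R * gaussian_moment k.*2 < e.
Proof.
move=> e0.
have : exp_coeff (t ^+ 2 / 2) n @[n --> \oo] --> (0 : R).
  exact/cvg_series_cvg_0/is_cvg_series_exp_coeff.
move=> /cvgr0_norm_lt /(_ e e0) [k _ /(_ k (leqnn k))] h.
exists k; rewrite mulrAC -mulrA gaussian_moment_even.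
apply: le_lt_trans h; apply: le_trans (ler_norm _); rewrite /exp_coeff /=.
rewrite expr_div_n -exprM mul2n invfM mulrA lexx //.
Qed.

Lemma characteristic_cvg (u : R -> R) (c : nat -> R) (t : R) :
  continuous u -> (forall x, `|u x| <= 1) ->
  (forall x y, `|u x - u y| <= `|x - y|) ->
  (forall n x, `|u x - taylor c n x| <= `|x| ^+ n / n`!%:R) ->
  E n (fun w => u (t * X n w)) @[n --> \oo] --> Rintegral nu setT (fun x => u (t * x)).
Proof.
move=> cu u1 ulip uc; apply/cvgrPdist_le => e e0.
pose e1 := e / 8; have e10 : 0 < e1 by rewrite divr_gt0.
have [k hk] := taylor_remainder_small t e10.
have [Y [bY mY XY]] := approx k.*2.
have odd2k : ~~ odd k.*2 by rewrite odd_double.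
have sumc_le m : (m <= k.*2)%N ->
    \sum_(i < m) c i * t ^+ i / i`!%:R * E n (fun w => Y n w ^+ i) @[n --> \oo] -->
    \sum_(i < m) c i * t ^+ i / i`!%:R * gaussian_moment i.
  elim: m => [_|m IH mk].
    rewrite big_ord0 (_ : (fun n => _) = fun=> 0); first exact: cvg_cst.
    by apply/funext => n; rewrite big_ord0.
  rewrite big_ord_recr /= (_ : (fun n => _) = fun n =>
    \sum_(i < m) c i * t ^+ i / i`!%:R * E n (fun w => Y n w ^+ i) +
    c m * t ^+ m / m`!%:R * E n (fun w => Y n w ^+ m)); last first.
    by apply/funext => n; rewrite big_ord_recr.
  apply: cvgD; first by apply: IH; exact: ltnW.
  by apply: cvgM; [exact: cvg_cst|apply: mY; exact: ltnW].
have sumc := sumc_le _ (leqnn _).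
have remc : t ^+ k.*2 / (k.*2)`!%:R * E n (fun w => Y n w ^+ k.*2) @[n --> \oo] -->
    t ^+ k.*2 / (k.*2)`!%:R * gaussian_moment k.*2.
  by apply: cvgM; [exact: cvg_cst|exact: mY].
have nuT := @taylor_expectation R _ _ nu u c t id k.*2 cu u1 (uc _) odd2k (@measurable_id _ _ _)
  (fun j _ => (normal_moment j).1).
rewrite (normal_moment _).2 in nuT.
rewrite (eq_bigr (fun i : 'I_(k.*2) => c i * t ^+ i / i`!%:R * gaussian_moment i)) in nuT; last first.
  by move=> i _; rewrite (normal_moment _).2.
(* The coefficient comes from |t z| <= e1 + t^2 z^2 / (4 e1), which lets the Lipschitz bound be paid
   for by the mean-square distance. *)
have XYc : t ^+ 2 / (4 * e1) * E n (fun w => (X n w - Y n w) ^+ 2) @[n --> \oo] --> (0 : R).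
  by rewrite -[X in _ --> X](mulr0 (t ^+ 2 / (4 * e1))); apply: cvgM; [exact: cvg_cst|].
near=> n.
have s1 : `|\sum_(i < k.*2) c i * t ^+ i / i`!%:R * gaussian_moment i -
    \sum_(i < k.*2) c i * t ^+ i / i`!%:R * E n (fun w => Y n w ^+ i)| <= e1.
  by near: n; move/cvgrPdist_le : sumc; apply.
have s2 : t ^+ k.*2 / (k.*2)`!%:R * E n (fun w => Y n w ^+ k.*2) <= 2 * e1.
  near: n; apply: (cvgr_le _ remc); lra.
have s3 : t ^+ 2 / (4 * e1) * E n (fun w => (X n w - Y n w) ^+ 2) <= e1.
  by near: n; apply: (cvgr_le _ XYc).
have iY j : (P n).-integrable setT (EFin \o (fun w => Y n w ^+ j)).
  by apply: bounded_rv_integrable; exact: bounded_rvX.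
have s4 := @taylor_expectation R _ _ (P n) u c t (Y n) k.*2 cu u1 (uc _) odd2k (bY n).1 (fun j _ => iY j).
have mX := (sX n).1.
have muX : bounded_rv (fun w => u (t * X n w)).
  by apply: (@bounded_comp R _ _ u _ 1) => //; exact: measurable_funM.
have muY : bounded_rv (fun w => u (t * Y n w)).
  by apply: (@bounded_comp R _ _ u _ 1) => //; apply: measurable_funM => //; exact: (bY n).1.
have s5 : `|E n (fun w => u (t * X n w)) - E n (fun w => u (t * Y n w))| <= 2 * e1.
  have sXY : square_integrable (P n) (fun w => X n w - Y n w).
    by apply: square_integrableB => //; exact: bounded_square_integrable.
  rewrite -bounded_expB//.
  have iq := integrableZ_real (t ^+ 2 / (4 * e1)) sXY.2.
  have ie : (P n).-integrable setT (EFin \o (fun _ : T n => e1)).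
    exact/bounded_rv_integrable/bounded_rv_cst.
  apply: le_trans (abs_exp_le (C := fun w => e1 + t ^+ 2 / (4 * e1) * (X n w - Y n w) ^+ 2) _ _ _) _.
  - by apply: bounded_rv_integrable; exact: bounded_rvB.
  - exact: integrableD_real.
  - move=> w; apply: le_trans (ulip _ _) _; rewrite -mulrBr.
    set z := X n w - Y n w.
    have : 0 <= (`|t * z| - 2 * e1) ^+ 2 / (4 * e1) by rewrite divr_ge0 ?sqr_ge0// mulr_ge0// ltW.
    have -> : (`|t * z| - 2 * e1) ^+ 2 / (4 * e1) = t ^+ 2 / (4 * e1) * z ^+ 2 - `|t * z| + e1.
      have -> : t ^+ 2 / (4 * e1) * z ^+ 2 = `|t * z| ^+ 2 / (4 * e1).
        by rewrite real_normK ?num_real// exprMn; ring.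
      by field; rewrite gt_eqF.
    by lra.
  - rewrite RintegralD// exp_cst RintegralZl//; last exact: sXY.2.
    by move: s3; lra.
have := hk; move: (nuT) s1 s2 s4 s5.
set a := Rintegral nu _ (fun x => u (t * x)).
set a' := E n (fun w => u (t * X n w)); set a'' := E n (fun w => u (t * Y n w)).
set b := \sum_(i < k.*2) c i * t ^+ i / i`!%:R * gaussian_moment i.
set b' := \sum_(i < k.*2) c i * t ^+ i / i`!%:R * E n (fun w => Y n w ^+ i).
move=> h0 s1 s2 s4 s5 h1.
rewrite (_ : a - a' = (a - b) + (b - b') - (a'' - b') - (a' - a'')); last by ring.
have := ler_normB (a - b + (b - b') - (a'' - b')) (a' - a'').
have := ler_normB (a - b + (b - b')) (a'' - b').
have := ler_normD (a - b) (b - b').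
have -> : e = 8 * e1 by rewrite /e1; field.
by lra.
Unshelve. all: by end_near.
Qed.

Lemma sin_le_norm (x : R) : `|sin x| <= `|x|.
Proof.
have [_] := cos_sin_taylor 1 x.
by rewrite /taylor big_ord1 /sin_coefficient /= mul0r subr0 expr1 divr1.
Qed.

Lemma sin_lipschitz (x y : R) : `|sin x - sin y| <= `|x - y|.
Proof.
pose a := (x + y) / 2; pose b := (x - y) / 2.
have -> : x = a + b by rewrite /a /b; field.
have -> : y = a - b by rewrite /a /b; field.
clearbody a b.
rewrite sinD sinB (_ : _ - _ = 2 * (cos a * sin b)); last by ring.
rewrite (_ : a + b - (a - b) = 2 * b); last by ring.
rewrite !normrM ler_wpM2l// -[leRHS]mul1r ler_pM ?cos_max//.
exact: sin_le_norm.
Qed.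

Lemma cos_lipschitz (x y : R) : `|cos x - cos y| <= `|x - y|.
Proof.
pose a := (x + y) / 2; pose b := (x - y) / 2.
have -> : x = a + b by rewrite /a /b; field.
have -> : y = a - b by rewrite /a /b; field.
clearbody a b.
rewrite cosD cosB (_ : _ - _ = - (2 * (sin a * sin b))); last by ring.
rewrite (_ : a + b - (a - b) = 2 * b); last by ring.
rewrite normrN !normrM ler_wpM2l// -[leRHS]mul1r ler_pM ?sin_max//.
exact: sin_le_norm.
Qed.

(** The admissible test functions form a vector space; it remains to show that it contains the
    polynomials in sin(s x). *)
Let good (u : R -> R) := [/\ continuous u, exists B, forall x, `|u x| <= B &
  E n (fun w => u (X n w)) @[n --> \oo] --> Rintegral nu setT u].

Let good_bounded u n : good u -> bounded_rv (fun w => u (X n w)).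
Proof. by case=> cu [B uB] _; apply: bounded_comp => //; exact: (sX n).1. Qed.

Let good_bounded_nu u : good u -> bounded_rv (u : measurableTypeR R -> R).
Proof. by case=> cu [B uB] _; split; [exact: continuous_measurable_fun|exists B]. Qed.

Let goodD u v : good u -> good v -> good (fun x => u x + v x).
Proof.
move=> gu gv; have [cu [B uB] lu] := gu; have [cv [C vC] lv] := gv; split.
- by move=> x; apply: cvgD; [exact: cu|exact: cv].
- by exists (B + C) => x; apply: le_trans (ler_normD _ _) (lerD _ _).
- rewrite bounded_expD; [|exact: good_bounded_nu|exact: good_bounded_nu].
  rewrite (_ : (fun n => _) = fun n => E n (fun w => u (X n w)) + E n (fun w => v (X n w))).
    exact: cvgD.
  by apply/funext => n; rewrite bounded_expD//; exact: good_bounded.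
Qed.

Let goodZ c u : good u -> good (fun x => c * u x).
Proof.
move=> gu; have [cu [B uB] lu] := gu; split.
- by move=> x; apply: cvgM; [exact: cvg_cst|exact: cu].
- by exists (`|c| * B) => x; rewrite normrM ler_wpM2l.
- rewrite bounded_expZ; last exact: good_bounded_nu.
  rewrite (_ : (fun n => _) = fun n => c * E n (fun w => u (X n w))).
    by apply: cvgM; [exact: cvg_cst|].
  by apply/funext => n; rewrite bounded_expZ//; exact: good_bounded.
Qed.

Let good_eq u v : u =1 v -> good u -> good v.
Proof. by move=> /funext ->. Qed.

Let good_cos t : good (fun x => cos (t * x)).
Proof.
split; first exact: continuous_cosM.
- by exists 1 => x; exact: cos_max.
- apply: (@characteristic_cvg cos cos_coefficient t) => //.
  + exact: continuous_cos.
  + exact: cos_max.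
  + exact: cos_lipschitz.
  + by move=> n x; exact: (cos_sin_taylor n x).1.
Qed.

Let good_sin t : good (fun x => sin (t * x)).
Proof.
split; first exact: continuous_sinM.
- by exists 1 => x; exact: sin_max.
- apply: (@characteristic_cvg sin sin_coefficient t) => //.
  + exact: continuous_sin.
  + exact: sin_max.
  + exact: sin_lipschitz.
  + by move=> n x; exact: (cos_sin_taylor n x).2.
Qed.

(** Product-to-sum formulas trade one factor sin(s x) for a shift of the frequency [t] by [s], hence
    the quantification over [t] inside the induction. *)
Let good_pow s k : forall t, good (fun x => sin (s * x) ^+ k * cos (t * x)) /\
  good (fun x => sin (s * x) ^+ k * sin (t * x)).
Proof.
elim: k => [|k IH] t.
  by split; [apply: good_eq (good_cos t)|apply: good_eq (good_sin t)] => x; rewrite expr0 mul1r.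
have [gc1 gs1] := IH (s + t); have [gc2 gs2] := IH (s - t); split.
- apply: good_eq (goodZ (1 / 2) (goodD gs1 gs2)) => x.
  by rewrite [(s + t) * x]mulrDl [(s - t) * x]mulrBl [sin (s * x + t * x)]sinD sinB exprSr; field.
- apply: good_eq (goodZ (1 / 2) (goodD gc2 (goodZ (-1) gc1))) => x.
  by rewrite [(s + t) * x]mulrDl [(s - t) * x]mulrBl [cos (s * x + t * x)]cosD cosB exprSr; field.
Qed.

Let good_poly (p : {poly R}) s : good (fun x => p.[sin (s * x)]).
Proof.
have gX k : good (fun x => sin (s * x) ^+ k).
  apply: good_eq (good_pow s k 0).1 => x.
  by rewrite mul0r cos0 mulr1.
apply: (@good_eq (fun x => \sum_(i < size p) p`_i * sin (s * x) ^+ i)).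
  by move=> x; rewrite horner_coef.
elim: (size p) => [|n IH].
  by apply: good_eq (goodZ 0 (gX 0%N)) => x; rewrite big_ord0 mul0r.
apply: good_eq (goodD IH (goodZ p`_n (gX n))) => x.
by rewrite big_ord_recr.
Qed.

Let second_moment_bounded : \forall n \near \oo, E n (fun w => X n w ^+ 2) <= 6.
Proof.
have [Y [bY mY XY]] := approx 2.
have m2 := mY 2%N (leqnn 2); rewrite /= !mulr1 in m2.
near=> n.
(* The second moment of [Y] tends to 1, so 2 is a safe bound, and the final 6 is 2 * 1 + 2 * 2. *)
have h1 : E n (fun w => Y n w ^+ 2) <= 2 by near: n; apply: (cvgr_le _ m2); lra.
have h2 : E n (fun w => (X n w - Y n w) ^+ 2) <= 1 by near: n; apply: (cvgr_le _ XY); lra.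
have sY := bounded_square_integrable (P n) (bY n).
have := square_expD_le (square_integrableB (sX n) sY) sY.
rewrite (_ : E n (fun w => (X n w - Y n w + Y n w) ^+ 2) = E n (fun w => X n w ^+ 2)); first by lra.
by apply: eq_Rintegral => w _; rewrite subrK.
Unshelve. all: by end_near.
Qed.

Lemma moment_clt (h : R -> R) : continuous h -> (exists B, forall x, `|h x| <= B) ->
  E n (fun w => h (X n w)) @[n --> \oo] --> Rintegral nu setT h.
Proof.
move=> ch [B0 hB0]; pose B := B0 + 1.
have hB x : `|h x| <= B by apply: le_trans (hB0 x) _; rewrite lerDl.
have B1 : 1 <= B by rewrite /B lerDr; exact: le_trans (hB0 0).
apply/cvgrPdist_le => e e0.
pose e1 := Num.min 1 (e / 6).
have e10 : 0 < e1 by rewrite lt_min ltr01 divr_gt0.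
have e11 : e1 <= 1 by rewrite ge_min lexx.
have e1e : 6 * e1 <= e by rewrite -ler_pdivlMl// mulrC ge_min lexx orbT.
clearbody e1.
(* Since e1 <= 1 <= B, 6 (2 B + e1) is at most 18 B <= e1 L <= e1 L^2: the quadratic error weighted
   by the second-moment bound 6 is at most e1. *)
pose L := 18 * B / e1 + 1.
have Be : 18 * B / e1 > 0 by rewrite divr_gt0//; lra.
have L1 : 1 <= L by rewrite /L; lra.
have [p [s ps]] := trigonometric_approx e10 (lt_le_trans ltr01 L1) ch hB.
have := good_poly p s; set q := fun x => p.[sin (s * x)] => gq.
have [cq [C qC] lq] := gq.
pose A := (2 * B + e1) / L ^+ 2.
have A0 : 0 <= A by rewrite divr_ge0 ?sqr_ge0//; lra.
have A6 : A * 6 <= e1.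
  rewrite /A mulrAC ler_pdivrMr ?exprn_gt0//; last by lra.
  have : 18 * B <= e1 * L.
    have -> : e1 * L = 18 * B + e1 by rewrite /L; field; rewrite gt_eqF.
    by rewrite lerDl ltW.
  have : L <= L ^+ 2 by rewrite expr2 ler_peMl//; lra.
  by nra.
have bound (dd : measure_display) (TT : measurableType dd) (Q : probability TT R) (Z : TT -> R) :
    square_integrable Q Z -> Rintegral Q setT (fun w => Z w ^+ 2) <= 6 ->
    `|Rintegral Q setT (fun w => h (Z w)) - Rintegral Q setT (fun w => q (Z w))| <= 2 * e1.
  move=> sZ Z6.
  have bh : bounded_rv (fun w => h (Z w)) by apply: bounded_comp => //; exact: sZ.1.
  have bq : bounded_rv (fun w => q (Z w)) by apply: bounded_comp => //; exact: sZ.1.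
  have iAZ := integrableZ_real A sZ.2.
  have ie : Q.-integrable setT (EFin \o (fun _ : TT => e1)).
    exact/bounded_rv_integrable/bounded_rv_cst.
  rewrite -bounded_expB//.
  apply: le_trans (abs_exp_le (C := fun w => e1 + A * Z w ^+ 2) _ _ _) _.
  - by apply: bounded_rv_integrable; exact: bounded_rvB.
  - exact: integrableD_real.
  - by move=> w; exact: ps.
  - rewrite RintegralD// exp_cst RintegralZl//; last exact: sZ.2.
    have : A * Rintegral Q setT (fun w => Z w ^+ 2) <= A * 6 by rewrite ler_wpM2l.
    by lra.
have snu : square_integrable nu (id : measurableTypeR R -> R).
  by split; [exact: measurable_id|exact: (normal_moment 2).1].
have nu6 : Rintegral nu setT (fun x : R => x ^+ 2) <= 6.
  by rewrite (normal_moment 2).2 /=; lra.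
have bnu := bound _ _ nu id snu nu6.
near=> n.
have n6 : E n (fun w => X n w ^+ 2) <= 6 by near: n; exact: second_moment_bounded.
have bX := bound _ _ (P n) (X n) (sX n) n6.
have lqn : `|Rintegral nu setT q - E n (fun w => q (X n w))| <= e1.
  by near: n; move/cvgrPdist_le : lq; apply.
move: (bnu) bX lqn.
set a := Rintegral nu setT (fun w => h (id w)); set a' := Rintegral nu setT (fun w => q (id w)).
rewrite -/a'.
set b := E n (fun w => h (X n w)); set b' := E n (fun w => q (X n w)).
move=> h1 h2 h3.
rewrite (_ : Rintegral nu setT h - b = (a - a') + (a' - b') - (b - b')); last by rewrite /a; ring.
have := ler_normB (a - a' + (a' - b')) (b - b').
have := ler_normD (a - a') (a' - b').
by lra.
Unshelve. all: by end_near.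
Qed.

End MomentMethod.

(** * Fourier series of even functions *)

Section CosinePolynomials.
Context {R : realType}.
Implicit Types (c a : nat -> R) (g : R -> R).

(** Index 0 is kept even when [n] is 0, because [cos_sum] always contains the constant term. *)
Lemma cos_sum_pad c n n' : (n <= n')%N ->
  cos_sum c n =1 cos_sum (fun k => if (k == 0)%N || (k < n)%N then c k else 0) n'.
Proof.
move=> nn' x; rewrite /cos_sum eqxx /=; congr (_ + _ * _).
have [n1|n1] := leqP 1 n; last first.
  rewrite big_geq; last by lia.
  rewrite big_nat big1// => k /andP[k1 _]; rewrite ifF ?mul0r//; lia.
rewrite (@big_cat_nat _ _ _ n 1 n')//= [X in _ + X]big_nat [X in _ + X]big1 ?addr0; last first.
  by move=> k /andP[nk _]; rewrite ifF ?mul0r//; lia.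
by rewrite big_nat [RHS]big_nat; apply: eq_bigr => k /andP[k1 kn]; rewrite kn orbT.
Qed.

Definition cosine_polynomial g := exists c n, g =1 cos_sum c n.

Lemma cosine_polynomialD g1 g2 : cosine_polynomial g1 -> cosine_polynomial g2 ->
  cosine_polynomial (fun x => g1 x + g2 x).
Proof.
move=> [c1 [n1 h1]] [c2 [n2 h2]].
pose pad c n k := if (k == 0)%N || (k < n)%N then c k else 0 : R.
exists (fun k => pad c1 n1 k + pad c2 n2 k), (maxn n1 n2) => x.
rewrite h1 h2 (cos_sum_pad c1 (leq_maxl n1 n2)) (cos_sum_pad c2 (leq_maxr n1 n2)).
rewrite /cos_sum -!/(pad _ _ _) addrACA -mulrDr -big_split /=; congr (_ + _ * _).
by apply: eq_bigr => k _; rewrite -mulrDl.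
Qed.

Lemma cosine_polynomialZ r g : cosine_polynomial g -> cosine_polynomial (fun x => r * g x).
Proof.
move=> [c [n h]]; exists (fun k => r * c k), n => x; rewrite h /cos_sum mulrDr; congr (_ + _).
by rewrite mulrCA; congr (_ * _); rewrite mulr_sumr; apply: eq_bigr => k _; rewrite mulrA.
Qed.

Lemma cosine_polynomial_eq g1 g2 : g1 =1 g2 -> cosine_polynomial g1 -> cosine_polynomial g2.
Proof. by move=> /funext ->. Qed.

Lemma cosine_polynomial_cos (k : nat) : cosine_polynomial (fun x => cos (k%:R * x)).
Proof.
have [->|k0] := posnP k.
  exists (fun=> 1), 0%N => x; rewrite /cos_sum big_geq// mulr0 addr0.
  by rewrite mulr0n mul0r cos0.
exists (fun j => if j == k then 1 / 2 else 0), k.+1 => x.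
rewrite /cos_sum ifF ?add0r; last by lia.
rewrite big_nat_recr //= eqxx big_nat big1 ?add0r; last first.
  by move=> j /andP[_ jk]; rewrite ifF ?mul0r//; lia.
by field.
Qed.

Lemma cosine_polynomial_pow m : forall k, cosine_polynomial (fun x => cos x ^+ m * cos (k%:R * x)).
Proof.
elim: m => [|m IH] k.
  by apply: cosine_polynomial_eq (cosine_polynomial_cos k) => x; rewrite expr0 mul1r.
(* The product-to-sum formula uses the frequencies k - 1 and k + 1, so frequency 0 is handled
   apart. *)
case: k => [|k].
  apply: cosine_polynomial_eq (IH 1%N) => x.
  by rewrite mulr1n mul1r mulr0n mul0r cos0 mulr1 exprSr.
apply: cosine_polynomial_eq (cosine_polynomialZ (1 / 2) (cosine_polynomialD (IH k) (IH k.+2))) => x.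
set y := k%:R * x.
have -> : k.+1%:R * x = y + x by rewrite -natr1 mulrDl mul1r.
have -> : k.+2%:R * x = y + x + x by rewrite -natr1 mulrDl mul1r -natr1 mulrDl mul1r.
rewrite [cos (y + x + x)]cosD [cos (y + x)]cosD [sin (y + x)]sinD exprSr.
have := cos2Dsin2 x; set cx := cos x; set sx := sin x; set cy := cos y; set sy := sin y.
move=> h; rewrite (_ : (cy * cx - sy * sx) * cx - (sy * cx + cy * sx) * sx =
  2 * cx * (cy * cx - sy * sx) - cy * (cx ^+ 2 + sx ^+ 2)); last by ring.
by rewrite h; field.
Qed.

Lemma cosine_polynomial_horner (p : {poly R}) : cosine_polynomial (fun x => p.[cos x]).
Proof.
have cX k : cosine_polynomial (fun x => cos x ^+ k).
  apply: cosine_polynomial_eq (cosine_polynomial_pow k 0) => x.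
  by rewrite mulr0n mul0r cos0 mulr1.
apply: (@cosine_polynomial_eq (fun x => \sum_(i < size p) p`_i * cos x ^+ i)).
  by move=> x; rewrite horner_coef.
elim: (size p) => [|n IH].
  by apply: cosine_polynomial_eq (cosine_polynomialZ 0 (cX 0%N)) => x; rewrite big_ord0 mul0r.
apply: cosine_polynomial_eq (cosine_polynomialD IH (cosine_polynomialZ p`_n (cX n))) => x.
by rewrite big_ord_recr.
Qed.

End CosinePolynomials.

(** * Best mean-square approximation by cosine sums *)

Section Projection.
Context {R : realType}.
Local Notation mu := (@lebesgue_measure R).
Local Notation J := (`[0%R, (2 * pi)%R]%classic : set R).
Local Notation Int g := (Rintegral mu J g).
Implicit Types (c : nat -> R).

Definition cos_coef (f : R -> R) (k : nat) : R := (2 * pi)^-1 * Int (fun x => f x * cos (k%:R * x)).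

Variables (f : R -> R) (mf : measurable_fun setT f).
Hypothesis if2 : mu.-integrable J (EFin \o (fun x => f x ^+ 2)).
Local Notation a := (cos_coef f).

Lemma measurable_J : measurable (J : set (measurableTypeR R)).
Proof. exact: measurable_itv. Qed.

Lemma integrable_product (g : R -> R) : continuous g -> (forall x, `|g x| <= 1) ->
  mu.-integrable J (EFin \o (fun x => f x * g x)).
Proof.
move=> cg g1.
have i1 : mu.-integrable J (EFin \o (fun x => 1 + f x ^+ 2)).
  have ic : mu.-integrable J (EFin \o (fun _ : R => (1 : R))).
    by apply: continuous_integrable => x; exact: cvg_cst.
  by have := integrableD measurable_J ic if2; apply: eq_integrable.
apply: le_integrable i1 => //.
  apply/measurable_EFinP/measurable_funTS; apply: measurable_funM => //.
  exact: continuous_measurable_fun.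
move=> x _; rewrite /= lee_fin [leRHS]ger0_norm ?addr_ge0 ?sqr_ge0// normrM.
apply: (@le_trans _ _ `|f x|); first by rewrite ler_piMr.
by have := sqr_ge0 (`|f x| - 1); rewrite -(real_normK (num_real (f x))); nra.
Qed.

Lemma continuous_cos_sum c n : continuous (cos_sum c n : R -> R).
Proof.
move=> x; apply: cvgD; first exact: cvg_cst.
apply: cvgM; first exact: cvg_cst.
apply: (@continuous_sum R _ _ _ (fun k x => c k * cos (k%:R * x))) => k y.
by apply: cvgM; [exact: cvg_cst|exact: continuous_cosM].
Qed.

Lemma integral_mul_cos_sum (g : R -> R) c n : measurable_fun setT g ->
  (forall k : nat, mu.-integrable J (EFin \o (fun x => g x * cos (k%:R * x)))) ->
  mu.-integrable J (EFin \o (fun x => g x * cos_sum c n x)) /\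
  Int (fun x => g x * cos_sum c n x) =
  2 * pi * (c 0%N * cos_coef g 0 + 2 * \sum_(1 <= k < n) c k * cos_coef g k).
Proof.
move=> mg ig.
have iZ r k : mu.-integrable J (EFin \o (fun x => r * (g x * cos (k%:R * x)))).
  have := integrableZl measurable_J r (ig k).
  by apply: eq_integrable => // x _; rewrite /= EFinM.
have pi0 : 2 * pi != 0 :> R by rewrite gt_eqF// twopi_gt0.
have key (s : seq nat) :
  mu.-integrable J (EFin \o (fun x => \sum_(k <- s) (2 * c k) * (g x * cos (k%:R * x)))) /\
  Int (fun x => \sum_(k <- s) (2 * c k) * (g x * cos (k%:R * x))) =
  2 * pi * (2 * \sum_(k <- s) c k * cos_coef g k).
  elim: s => [|k s [IH1 IH2]].
    rewrite big_nil !mulr0 (_ : (fun x => _) = fun=> 0); last by apply/funext => x; rewrite big_nil.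
    by rewrite Rintegral_cst//= mul0r; split=> //; apply: continuous_integrable => x; exact: cvg_cst.
  rewrite (_ : (fun x => _) = fun x => 2 * c k * (g x * cos (k%:R * x)) +
    \sum_(j <- s) (2 * c j) * (g x * cos (j%:R * x))); last first.
    by apply/funext => x; rewrite big_cons.
  split; first by have := integrableD measurable_J (iZ (2 * c k) k) IH1; apply: eq_integrable.
  rewrite RintegralD// RintegralZl// IH2 big_cons.
  have -> : Int (fun x => g x * cos (k%:R * x)) = 2 * pi * cos_coef g k by rewrite /cos_coef mulVKf.
  by ring.
have [k1 k2] := key (index_iota 1 n).
rewrite (_ : (fun x => g x * cos_sum c n x) = fun x => c 0%N * (g x * cos (0%:R * x)) +
  \sum_(1 <= k < n) (2 * c k) * (g x * cos (k%:R * x))); last first.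
  apply/funext => x; rewrite mulr0n mul0r cos0 mulr1 /cos_sum mulrDr mulrC; congr (_ + _).
  rewrite mulrCA mulr_sumr mulr_sumr; apply: eq_bigr => k _; ring.
split; first by have := integrableD measurable_J (iZ (c 0%N) 0%N) k1; apply: eq_integrable.
rewrite RintegralD// RintegralZl// k2.
have -> : Int (fun x => g x * cos (0%:R * x)) = 2 * pi * cos_coef g 0 by rewrite /cos_coef mulVKf.
by ring.
Qed.

Lemma integral_cos_cos (j k : nat) : Int (fun x => cos (j%:R * x) * cos (k%:R * x)) =
  pi * ((j == k)%:R + ((j == 0)%N && (k == 0)%N)%:R).
Proof.
rewrite (_ : Int _ = Int (fun x => 2^-1 * (cos ((j%:Z + k%:Z)%:~R * x) + cos ((j%:Z - k%:Z)%:~R * x)))).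
  rewrite RintegralZl//; last first.
    apply: continuous_integrable => x; apply: cvgD; exact: continuous_cosM.
  rewrite RintegralD//; [|exact/continuous_integrable/continuous_cosM|exact/continuous_integrable/continuous_cosM].
  rewrite !integral_cos_int.
  have -> : (j%:Z - k%:Z == 0) = (j == k) by lia.
  have -> : (j%:Z + k%:Z == 0) = (j == 0)%N && (k == 0)%N by lia.
  case: (j == k); case: (_ && _); rewrite ?mulr0n ?mulr1n; move: (pi) => q; by field.
apply: eq_Rintegral => x _; rewrite rmorphD rmorphB /= -!pmulrn mulrDl mulrBl cosB [cos (_ + _)]cosD; by field.
Qed.

Lemma cos_coef_cos_sum c n k : (k < n)%N || (k == 0)%N -> cos_coef (cos_sum c n) k = c k.
Proof.
move=> kn.
have pi0 : 2 * pi != 0 :> R by rewrite gt_eqF// twopi_gt0.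
have [_ h] := @integral_mul_cos_sum (fun x => cos (k%:R * x)) c n
  (continuous_measurable_fun (@continuous_cosM R k%:R))
  (fun j => continuous_integrable _ _ (fun x => cvgM (@continuous_cosM R k%:R x) (@continuous_cosM R j%:R x))).
rewrite /cos_coef; under eq_Rintegral do rewrite mulrC.
rewrite h mulKf// /cos_coef.
have -> : \sum_(1 <= j < n) c j * ((2 * pi)^-1 * Int (fun x => cos (k%:R * x) * cos (j%:R * x))) =
   if (1 <= k < n)%N then c k / 2 else 0.
  under eq_bigr do rewrite integral_cos_cos.
  transitivity (\sum_(1 <= j < n) if j == k then c k / 2 else 0).
    rewrite big_nat [RHS]big_nat; apply: eq_bigr => j /andP[j1 jn].
    rewrite [k == j]eq_sym (_ : (j == 0)%N = false) ?andbF ?addr0; last by lia.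
    case: eqP => [->|_]; last by rewrite mulr0n !mulr0.
    rewrite mulr1n; move: pi0; move: (pi) => q q0; field.
    by move: q0; rewrite mulf_eq0 negb_or => /andP[].
  rewrite -big_mkcond; case: ifP => [k1n|k1n].
    rewrite big_nat1_eq k1n//.
  by rewrite big_nat1_eq k1n.
rewrite integral_cos_cos eqxx andbT.
have [->|k0] := eqVneq k 0%N.
  by rewrite /= mulr0 addr0; move: pi0; move: (pi) => q q0; field; move: q0; rewrite mulf_eq0 negb_or => /andP[].
rewrite (negbTE k0) orbF in kn; rewrite kn (_ : (0 < k)%N = true) /=; last by lia.
by rewrite addr0 !mulr0 add0r; field.
Qed.

Let if1 k : mu.-integrable J (EFin \o (fun x => f x * cos (k%:R * x))).
Proof. by apply: integrable_product; [exact: continuous_cosM|move=> x; exact: cos_max]. Qed.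

Lemma cos_sum_distance c n : Int (fun x => (f x - cos_sum c n x) ^+ 2) =
  Int (fun x => f x ^+ 2) + 2 * pi * ((c 0%N ^+ 2 - 2 * c 0%N * a 0%N) +
    2 * \sum_(1 <= k < n) (c k ^+ 2 - 2 * c k * a k)).
Proof.
have [i1 e1] := integral_mul_cos_sum c n mf if1.
have icc (k : nat) : mu.-integrable J (EFin \o (fun x => cos_sum c n x * cos (k%:R * x))).
  apply: continuous_integrable => x; apply: cvgM; [exact: continuous_cos_sum|exact: continuous_cosM].
have [i2 e2] := integral_mul_cos_sum c n (measurable_cos_sum c n) icc.
have i3 : mu.-integrable J (EFin \o (fun x => 2 * (f x * cos_sum c n x))).
  have := integrableZl measurable_J 2 i1.
  by apply: eq_integrable => // x _; rewrite /= EFinM.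
have i4 : mu.-integrable J (EFin \o (fun x => cos_sum c n x * cos_sum c n x - 2 * (f x * cos_sum c n x))).
  by have := integrableB measurable_J i2 i3; apply: eq_integrable.
rewrite (_ : Int _ = Int (fun x => f x ^+ 2 + (cos_sum c n x * cos_sum c n x - 2 * (f x * cos_sum c n x)))); last first.
  by apply: eq_Rintegral => x _; ring.
rewrite RintegralD// RintegralB// RintegralZl// e1 e2; congr (_ + _).
rewrite cos_coef_cos_sum ?eqxx ?orbT//.
rewrite (_ : \sum_(1 <= k < n) c k * cos_coef (cos_sum c n) k = \sum_(1 <= k < n) c k ^+ 2); last first.
  rewrite big_nat [RHS]big_nat; apply: eq_bigr => k /andP[_ kn].
  by rewrite cos_coef_cos_sum ?kn// expr2.
rewrite sumrB (_ : \sum_(1 <= k < n) 2 * c k * a k = 2 * \sum_(1 <= k < n) c k * a k); last first.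
  by rewrite mulr_sumr; apply: eq_bigr => k _; rewrite mulrA.
by ring.
Qed.

(** By orthogonality the distance is a sum of separate quadratics in the [c k], each minimal at the
    Fourier coefficient. *)
Lemma cos_sum_projection c n :
  Int (fun x => (f x - cos_sum a n x) ^+ 2) <= Int (fun x => (f x - cos_sum c n x) ^+ 2).
Proof.
rewrite !cos_sum_distance lerD2l ler_wpM2l ?(ltW twopi_gt0)//.
apply: lerD; first by have := sqr_ge0 (c 0%N - a 0%N); nra.
rewrite ler_wpM2l//; apply: ler_sum => k _.
by have := sqr_ge0 (c k - a k); nra.
Qed.

(** One good cosine polynomial thus controls all sufficiently long partial sums. *)
Lemma cos_sum_projection_le c n n' : (n <= n')%N ->
  Int (fun x => (f x - cos_sum a n' x) ^+ 2) <= Int (fun x => (f x - cos_sum c n x) ^+ 2).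
Proof.
move=> nn'.
have := cos_sum_projection (fun k => if (k == 0)%N || (k < n)%N then c k else 0) n'.
by under [X in _ <= X -> _]eq_Rintegral do rewrite -(cos_sum_pad c nn').
Qed.

End Projection.

(** * Symmetry of even and odd periodic functions about pi *)

Section Reflection.
Context {R : realType}.
Local Notation mu := (@lebesgue_measure R).
Local Notation J := (`[0%R, (2 * pi)%R]%classic : set R).
Local Notation H := (`[0%R, pi]%classic : set R).

Lemma integral_reflect (D : set R) (G : R -> R) :
  measurable (D : set (measurableTypeR R)) -> measurable_fun setT G ->
  (forall x, 0 <= G x) -> (forall x, G (x + 2 * pi) = G x) ->
  (\int[mu]_(x in D) (G x)%:E =
   \int[mu]_(x in [set x | D (2 * pi - x)%R]) (G (- x)%R)%:E)%E.
Proof.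
move=> mD mG G0 G2pi; rewrite -(integral_indicM D) -(integral_indicM [set x | D (2 * pi - x)]).
have m1 : measurable_fun setT (fun x => (\1_D x * G x)%:E) by exact: measurable_scale_indic.
have p1 x : (0 <= (\1_D x * G x)%:E)%E by rewrite lee_fin mulr_ge0.
transitivity (\int[mu]_x ((\1_D (x + 2 * pi)%R * G (x + 2 * pi))%:E))%E.
  by symmetry; exact: (ge0_integralT_shift (2 * pi) m1 p1).
have m2 : measurable_fun setT (fun x : R => (\1_D (x + 2 * pi)%R * G (x + 2 * pi))%:E).
  exact: (measurableT_comp m1 (measurable_shift (2 * pi))).
transitivity (\int[mu]_x ((\1_D (- x + 2 * pi)%R * G (- x + 2 * pi))%:E))%E.
  by symmetry; exact: (ge0_integralT_opp m2 (fun x => p1 _)).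
apply: eq_integral => x _; rewrite G2pi !indicE; congr ((nat_of_bool _)%:R * _)%:E.
by rewrite [- x + _]addrC; apply/idP/idP => /set_mem h; apply: mem_set.
Qed.

(** Reduces the approximation to [0, pi], where cosine is injective; periodicity and evenness
    reflect the other half onto it. *)
Lemma integral_le_half (G : R -> R) : measurable_fun setT G -> (forall x, 0 <= G x) ->
  (forall x, G (x + 2 * pi) = G x) -> {ae mu, forall x, G (- x) = G x} ->
  (\int[mu]_(x in J) (G x)%:E <= 2%:E * \int[mu]_(x in H) (G x)%:E)%E.
Proof.
move=> mG G0 G2pi Geven.
have pi0 := @pi_gt0 R.
pose D : set R := [set` `]pi, (2 * pi)%R]].
have mH : measurable (H : set (measurableTypeR R)) by exact: measurable_itv.
have mD : measurable (D : set (measurableTypeR R)) by exact: measurable_itv.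
have mD' : measurable ([set x | D (2 * pi - x)] : set (measurableTypeR R)).
  rewrite (_ : [set x | _] = [set` `[0, pi[]); first exact: measurable_itv.
  by apply/seteqP; split=> x; rewrite /D /= !in_itv /= => /andP[? ?]; apply/andP; split; lra.
have mGE (A : set R) : measurable_fun A (fun x => (G x)%:E).
  by apply/measurable_EFinP; exact: measurable_funTS.
rewrite (_ : J = H `|` D); last first.
  apply/seteqP; split=> x; rewrite /D /= !in_itv /=.
    by move=> /andP[x0 x1]; have [xp|xp] := leP x pi; [left|right]; rewrite ?x0 ?xp.
  by move=> [|] /andP[? ?]; apply/andP; split; lra.
rewrite ge0_integral_setU//; last 2 first.
  by move=> x _; rewrite lee_fin.
  apply/disj_set2P; apply/seteqP; split=> x //; rewrite /D /= !in_itv /= => -[/andP[? ?] /andP[? ?]]; lra.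
rewrite mule_natl mule2n leeD2l// (integral_reflect mD)//.
have -> : (\int[mu]_(x in [set x | D (2 * pi - x)%R]) (G (- x)%R)%:E =
    \int[mu]_(x in [set x | D (2 * pi - x)%R]) (G x)%:E)%E.
  apply: ge0_ae_eq_integral => //.
  - apply/measurable_EFinP/measurable_funTS; exact: (measurableT_comp mG (@oppr_measurable R setT)).
  - exact: mGE.
  - by move=> x Dx; rewrite lee_fin.
  - by move=> x Dx; rewrite lee_fin.
  - by apply: (@filterS _ _ (ae_filter_ringOfSetsType mu)) Geven => x /= Gx Dx; rewrite Gx.
apply: ge0_subset_integral; [exact: mD'|exact: mH|exact: mGE|by move=> x Dx; rewrite lee_fin|].
by move=> x; rewrite /D /= !in_itv /= => /andP[? ?]; apply/andP; split; lra.
all: exact: mGE.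
Qed.

Lemma integral_odd (g : R -> R) : measurable_fun setT g ->
  (forall x, g (x + 2 * pi) = g x) -> {ae mu, forall x, g (- x) = - g x} ->
  Rintegral mu J g = 0.
Proof.
move=> mg g2pi godd.
have mJ := @measurable_J R.
have mge : measurable_fun setT (EFin \o g) by apply/measurable_EFinP.
pose gp x := Num.max (g x) 0; pose gn x := Num.max (- g x) 0.
have mgp : measurable_fun setT gp by apply: measurable_maxr.
have mgn : measurable_fun setT gn.
  by apply: measurable_maxr => //; exact: (measurableT_comp (@oppr_measurable R setT) mg).
rewrite /Rintegral integralE.
have -> : (\int[mu]_(x in J) (fun x => (g x)%:E)^\+ x = \int[mu]_(x in J) (gp x)%:E)%E.
  by apply: eq_integral => x _; rewrite funeposE /gp EFin_max.
have -> : (\int[mu]_(x in J) (fun x => (g x)%:E)^\- x = \int[mu]_(x in J) (gn x)%:E)%E.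
  by apply: eq_integral => x _; rewrite funenegE /gn EFin_max EFinN.
have -> : (\int[mu]_(x in J) (gp x)%:E = \int[mu]_(x in J) (gn x)%:E)%E.
  rewrite integral_reflect//.
  - rewrite (_ : [set x | _] = J); last first.
      by apply/seteqP; split=> x; rewrite /= !in_itv /= => /andP[? ?]; apply/andP; split; lra.
    apply: ge0_ae_eq_integral => //.
    + apply/measurable_EFinP/measurable_funTS; exact: (measurableT_comp mgp (@oppr_measurable R setT)).
    + by apply/measurable_EFinP/measurable_funTS.
    + by move=> x Jx; rewrite lee_fin /gp le_max lexx orbT.
    + by move=> x Jx; rewrite lee_fin /gn le_max lexx orbT.
    + by apply: (@filterS _ _ (ae_filter_ringOfSetsType mu)) godd => x /= gx Jx; rewrite /gp /gn gx.
  - by move=> x; rewrite /gp le_max lexx orbT.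
  - by move=> x; rewrite /gp g2pi.
(* If the common value of both parts is infinite, [fine] returns its default value 0. *)
case: (\int[mu]_(x in J) (gn x)%:E)%E => [r| |] //=; by rewrite subrr.
Qed.

End Reflection.

(** * Density of cosine polynomials among even functions *)

Section Approximation.
Context {R : realType}.
Local Notation mu := (@lebesgue_measure R).
Local Notation J := (`[0%R, (2 * pi)%R]%classic : set R).
Local Notation H := (`[0%R, pi]%classic : set R).

Let mH : measurable (H : set (measurableTypeR R)).
Proof. exact: measurable_itv. Qed.

Let H_finite : (mu H < +oo)%E.
Proof. by rewrite lebesgue_measure_itv /= lte_fin pi_gt0 ltry. Qed.

Let clip (B x : R) := Num.max (- B) (Num.min B x).

Let clip_le B x : 0 <= B -> `|clip B x| <= B.
Proof. by rewrite /clip /Num.max /Num.min => B0; rewrite ler_norml; do ! case: ifP; lra. Qed.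

Let clip_near B x : 0 <= B -> (x - clip B x) ^+ 2 <= x ^+ 2.
Proof. by rewrite /clip /Num.max /Num.min => B0; do ! case: ifP; nra. Qed.

Let clip_id B x : `|x| <= B -> clip B x = x.
Proof. by rewrite ler_norml /clip /Num.max /Num.min => /andP[? ?]; do ! case: ifP; lra. Qed.

Let clip_lip B x y : 0 <= B -> `|clip B x - clip B y| <= `|x - y|.
Proof.
rewrite /clip /Num.max /Num.min => B0; rewrite ler_norml.
have := ler_norm (x - y); have := ler_norm (y - x); rewrite (distrC y x).
by do ! case: ifP; lra.
Qed.

Let continuous_clip B : continuous (clip B).
Proof.
move=> x; rewrite /clip; apply: (@continuous_max _ _ (fun=> - B) (fun y => Num.min B y)); first exact: cvg_cst.
by apply: (@continuous_min _ _ (fun=> B) id); [exact: cvg_cst|exact: cvg_id].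
Qed.

Let measurable_clip B (g : R -> R) : measurable_fun setT g -> measurable_fun setT (fun x => clip B (g x)).
Proof.
by move=> mg; apply: measurable_maxr => //; exact: measurable_minr.
Qed.

Lemma clip_approx (f : R -> R) (e : R) : 0 < e -> measurable_fun setT f ->
  mu.-integrable H (EFin \o (fun x => f x ^+ 2)) ->
  exists2 B, 0 < B & (\int[mu]_(x in H) ((f x - clip B (f x)) ^+ 2)%:E <= e%:E)%E.
Proof.
move=> e0 mf if2.
have mfB n : measurable_fun setT (fun x => (f x - clip n.+1%:R (f x)) ^+ 2).
  by apply: measurable_funX; apply: measurable_funB => //; exact: measurable_clip.
have [||||_ _ +] := @dominated_convergence _ _ _ mu H mH
  (fun n x => ((f x - clip n.+1%:R (f x)) ^+ 2)%:E) (fun=> 0%E) (fun x => (f x ^+ 2)%:E) _ _ _ if2.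
- by move=> n; apply/measurable_EFinP/measurable_funTS; exact: mfB.
- exact: measurable_cst.
- apply/aeW => x Hx; apply: cvg_near_cst; exists (Num.bound `|f x|) => // n /= fn.
  rewrite clip_id ?subrr ?expr0n// (le_trans (ltW (archi_boundP _)))// ler_nat; exact: leq_trans fn _.
- apply/aeW => x n Hx; rewrite gee0_abs lee_fin ?sqr_ge0//; exact: clip_near.
rewrite integral0 => /fine_cvgP[fin /cvgr0_norm_lt /(_ e e0) small].
have [n _ /(_ n (leqnn n)) /= [fn hn]] := filterI fin small.
exists n.+1%:R => //; rewrite -(fineK fn) lee_fin; exact: ltW (le_lt_trans (ler_norm _) hn).
Qed.

(** [f] is truncated, approximated in L^1 by a continuous function, and that one uniformly by a
    polynomial in cosine. Clipping the continuous function at the same level turns L^1 closeness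
    into L^2 closeness: the square of a difference of size at most 2 B is at most 2 B times its
    absolute value. *)
Lemma cosine_approx (f : R -> R) (e : R) : 0 < e -> measurable_fun setT f ->
  (forall x, f (x + 2 * pi) = f x) -> even_ae f ->
  mu.-integrable J (EFin \o (fun x => f x ^+ 2)) ->
  exists c n, (\int[mu]_(x in J) ((f x - cos_sum c n x) ^+ 2)%:E <= e%:E)%E.
Proof.
move=> e0 mf f2pi fe if2.
have pi0 := @pi_gt0 R.
have if2H : mu.-integrable H (EFin \o (fun x => f x ^+ 2)).
  apply: integrableS if2; [exact: measurable_J|exact: mH|].
  by move=> x /=; rewrite !in_itv /= => /andP[? ?]; apply/andP; split; lra.
(* 18 is 2 for the two half periods, times 3 for the square of a sum of three errors, times 3 for
   their equal shares. *)
have e18 : 0 < e / 18 by rewrite divr_gt0.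
have [B B0 fB] := clip_approx e18 mf if2H.
pose g x := clip B (f x).
have mg : measurable_fun setT g by exact: measurable_clip.
have ig : mu.-integrable H (EFin \o g).
  apply: measurable_bounded_integrable => //; first exact: measurable_funTS.
  exists B; split; first exact: num_real.
  by move=> M BM x _; apply: le_trans (clip_le _ (ltW B0)) (ltW BM).
have [u [cu iu]] := approximation_continuous_integrable mH H_finite ig.
move=> /fine_cvgP[fin /cvgr0_norm_lt small].
(* Multiplied by 2 B this is again e / 18. *)
have eB : 0 < e / (36 * B) by rewrite divr_gt0// mulr_gt0.
have [n _ /(_ n (leqnn n)) /= [fn hn]] := filterI fin (small _ eB).
have {hn} gu : (\int[mu]_(z in H) (`|g z - u n z|)%:E <= (e / (36 * B))%:E)%E.
  by rewrite -(fineK fn) lee_fin; exact: ltW (le_lt_trans (ler_norm _) hn).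
pose phi x := clip B (u n x).
have cphi : continuous phi by move=> x; exact: (@continuous_comp _ _ _ (u n) (clip B) x (cu n x) (@continuous_clip B (u n x))).
(* A uniform error, squared and integrated over a length pi, contributes e / 18. *)
pose dl := Num.sqrt (e / (18 * pi)).
have dl2 : dl ^+ 2 = e / (18 * pi) by rewrite sqr_sqrtr// divr_ge0 ?mulr_ge0 ?ltW.
have dl0 : 0 < dl by rewrite sqrtr_gt0 divr_gt0 ?mulr_gt0.
have [p hp] := weierstrass_cos dl0 cphi.
have [c [m pm]] := cosine_polynomial_horner p.
exists c, m.
have mu1 : measurable_fun setT (u n) by exact: continuous_measurable_fun.
have mF : measurable_fun setT (fun x => (f x - cos_sum c m x) ^+ 2).
  by apply: measurable_funX; apply: measurable_funB => //; exact: measurable_cos_sum.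
apply: (le_trans (integral_le_half mF _ _ _)).
- by move=> x; exact: sqr_ge0.
- by move=> x; rewrite f2pi cos_sum_periodic.
- by apply: (@filterS _ _ (ae_filter_ringOfSetsType mu)) fe => x fx; rewrite fx -!pm cosN.
have m1 : measurable_fun H (fun x => ((f x - g x) ^+ 2)%:E).
  by apply/measurable_EFinP/measurable_funTS; apply: measurable_funX; exact: measurable_funB.
have m2 : measurable_fun H (fun x => (`|g x - u n x|)%:E).
  apply/measurable_EFinP/measurable_funTS.
  exact: (measurableT_comp (@normr_measurable R setT) (measurable_funB mg mu1)).
have m3 : measurable_fun H (fun x => (dl ^+ 2)%:E : \bar R) by exact: measurable_cst.
have m2' : measurable_fun H (fun x => (2 * B)%:E * (`|g x - u n x|)%:E)%E by exact: measurable_funeM.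
pose bound (x : R) : \bar R := (3%:E * (((f x - g x) ^+ 2)%:E + ((2 * B)%:E * (`|g x - u n x|)%:E + (dl ^+ 2)%:E)))%E.
have B20 : 0 <= 2 * B by rewrite mulr_ge0 ?ltW.
have le1 : (\int[mu]_(x in H) ((f x - cos_sum c m x) ^+ 2)%:E <= \int[mu]_(x in H) bound x)%E.
  apply: ge0_le_integral => //.
  - by move=> x _; rewrite lee_fin sqr_ge0.
  - by apply/measurable_EFinP/measurable_funTS.
  - by apply: measurable_funeM; apply: emeasurable_funD => //; apply: emeasurable_funD.
  move=> x; rewrite /= in_itv /= => xH.
  have -> : bound x = (3 * ((f x - g x) ^+ 2 + (2 * B * `|g x - u n x| + dl ^+ 2)))%:E by [].
  rewrite lee_fin -pm.
  have h1 := hp x xH.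
  have h2 : `|g x - phi x| <= `|g x - u n x| 
    by rewrite /phi -{1}(@clip_id B (g x) (clip_le (f x) (ltW B0))); exact: (@clip_lip B (g x) (u n x) (ltW B0)).
  have h3 : `|g x - phi x| <= 2 * B.
    apply: le_trans (ler_normB _ _) _; rewrite mulr_natl mulr2n; apply: lerD; apply: clip_le; exact: ltW.
  have h4 : (g x - phi x) ^+ 2 <= 2 * B * `|g x - u n x|.
    by rewrite -(real_normK (num_real (g x - phi x))) expr2; apply: ler_pM.
  have h5 : (phi x - p.[cos x]) ^+ 2 <= dl ^+ 2.
    by rewrite -(real_normK (num_real (phi x - _))) ler_pXn2r// nnegrE ltW.
  set A := f x - g x in h1 h2 *; set C := g x - phi x in h1 h2 h4 *.
  set D := phi x - p.[cos x] in h1 h2 h5 *.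
  have -> : f x - p.[cos x] = A + C + D by rewrite /A /C /D; ring.
  by have := sqr_ge0 (A - C); have := sqr_ge0 (A - D); have := sqr_ge0 (C - D); nra.
apply: (@le_trans _ _ (2%:E * \int[mu]_(x in H) bound x)%E).
  by apply: lee_wpmul2l.
rewrite /bound ge0_integralZl//; last 2 first.
- by apply: emeasurable_funD => //; apply: emeasurable_funD.
- by move=> x _; rewrite !adde_ge0// ?mule_ge0// lee_fin ?sqr_ge0.
rewrite ge0_integralD//; last 3 first.
- by move=> x _; rewrite lee_fin sqr_ge0.
- by move=> x _; rewrite adde_ge0// ?mule_ge0// lee_fin ?sqr_ge0.
- by apply: emeasurable_funD.
rewrite ge0_integralD//; last 2 first.
- by move=> x _; rewrite mule_ge0.
- by move=> x _; rewrite lee_fin sqr_ge0.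
rewrite ge0_integralZl//.
have -> : (\int[mu]_(x in H) (dl ^+ 2)%:E = (dl ^+ 2)%:E * pi%:E)%E.
  have muH : mu H = pi%:E by rewrite lebesgue_measure_itv /= lte_fin pi0 -EFinD subr0.
  by rewrite -muH; exact: integral_cst.
apply: (@le_trans _ _ (2%:E * (3%:E * ((e / 18)%:E +
    ((2 * B)%:E * (e / (36 * B))%:E + (dl ^+ 2)%:E * pi%:E))))%E).
  do 2 (apply: lee_wpmul2l => //); apply: leeD => //; apply: leeD => //.
  by apply: lee_wpmul2l.
rewrite dl2; suff: 2 * (3 * (e / 18 + (2 * B * (e / (36 * B)) + e / (18 * pi) * pi))) <= e by rewrite -lee_fin.
move: (pi) pi0 => q q0.
rewrite le_eqVlt (_ : _ == _)//; apply/eqP; field.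
by rewrite !gt_eqF.
Qed.

End Approximation.

Section FourierSeries.
Context {R : realType}.
Local Notation mu := (@lebesgue_measure R).
Local Notation J := (`[0%R, (2 * pi)%R]%classic : set R).
Variables (f : R -> R).
Hypotheses (f2 : L2_circle f) (fe : even_ae f).

Lemma cos_series_cvg (M : nat) (e : R) : 0 < e -> exists2 n, (M < n)%N &
  (\int[mu]_(x in J) ((f x - cos_sum (cos_coef f) n x) ^+ 2)%:E <= e%:E)%E.
Proof.
move=> e0; have [mf f2pi if2] := f2.
have [c [n cn]] := cosine_approx e0 mf f2pi fe if2.
have isq c' n' : mu.-integrable J (EFin \o (fun x => (f x - cos_sum c' n' x) ^+ 2)).
  have ic : mu.-integrable J (EFin \o (fun x => cos_sum c' n' x ^+ 2)).
    apply: continuous_integrable => x; rewrite /GRing.exp /=.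
    by apply: cvgM; exact: continuous_cos_sum.
  have := integrableD (@measurable_J R) if2 ic.
  move=> /(integrableZl (@measurable_J R) 2); apply: le_integrable; first exact: measurable_J.
    apply/measurable_EFinP/measurable_funTS; apply: measurable_funX; apply: measurable_funB => //.
    exact: measurable_cos_sum.
  move=> x _.
  suff: `|(f x - cos_sum c' n' x) ^+ 2| <= `|2 * (f x ^+ 2 + cos_sum c' n' x ^+ 2)| by rewrite -lee_fin.
  rewrite [leLHS]ger0_norm ?sqr_ge0// [leRHS]ger0_norm; last by rewrite mulr_ge0// addr_ge0 ?sqr_ge0.
  by have := sqr_ge0 (f x + cos_sum c' n' x); nra.
exists (maxn n M.+1); first by rewrite leq_max ltnSn orbT.
have := cos_sum_projection_le mf if2 c (leq_maxl n M.+1).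
have fin c' n' : (\int[mu]_(x in J) ((f x - cos_sum c' n' x) ^+ 2)%:E)%E \is a fin_num.
  exact: (integrable_fin_num (@measurable_J R) (isq c' n')).
rewrite /Rintegral -lee_fin !fineK ?fin// => h.
exact: le_trans h cn.
Qed.

(** The imaginary part is the integral of the almost everywhere odd function f(x) sin(-k x), hence
    zero. *)
Lemma fourier_coef_norm (k : int) : Normc.normc (fourier_coef f k) ^+ 2 = cos_coef f `|k| ^+ 2.
Proof.
have [mf f2pi if2] := f2.
have e1 : Rintegral mu J (fun x => complex.Re ((f x)%:C * expi (- (k%:~R * x)))%C) =
   Rintegral mu J (fun x => f x * cos (`|k|%N%:R * x)).
  apply: eq_Rintegral => x _; rewrite /expi /= mul0r subr0 cosN.
  by case: (intP k) => [|n|n]; rewrite ?mulr0n //= ?mulrNz ?mulNr ?cosN //= abszN.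
have e2 : Rintegral mu J (fun x => complex.Im ((f x)%:C * expi (- (k%:~R * x)))%C) = 0.
  transitivity (Rintegral mu J (fun x => f x * sin ((- k)%:~R * x))).
    by apply: eq_Rintegral => x _; rewrite /expi /= mul0r addr0 rmorphN mulNr.
  apply: integral_odd.
  - apply: measurable_funM => //; exact: continuous_measurable_fun (@continuous_sinM R (- k)%:~R).
  - by move=> x; rewrite f2pi mulrDr sinD cos_int2pi sin_int2pi mulr0 mulr1 addr0.
  - apply: (@filterS _ _ (ae_filter_ringOfSetsType mu)) fe => x fx.
    by rewrite fx mulrN sinN mulrN.
rewrite /fourier_coef /cintegral e1 e2 /cos_coef /=.
by rewrite !mul0r mulr0 subr0 addr0 expr0n addr0 sqr_sqrtr ?sqr_ge0.
Qed.

Lemma fourier_energy_cos N :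
  fourier_energy f N = 2 * \sum_(1 <= k < N.+1) (k%:R * cos_coef f k) ^+ 2.
Proof.
pose F k := (k%:R * cos_coef f k) ^+ 2.
have -> : fourier_energy f N = \sum_(0 <= i < N.*2.+1) F (`|i%:Z - N%:Z|%N).
  rewrite /fourier_energy big_mkord; apply: eq_bigr => i _ /=.
  by rewrite fourier_coef_norm /F [RHS]exprMn mulrC -intr_norm -abszE -pmulrn.
rewrite (@big_cat_nat _ _ _ N)//=; [|lia].
rewrite mulr_natl mulr2n; congr (_ + _).
  rewrite big_nat_rev /= big_add1 /=; apply: eq_big_nat => i /andP[_ iN].
  by congr F; lia.
rewrite -{1}[N]add0n big_addn (_ : N.*2.+1 - N = N.+1)%N; last by lia.
rewrite big_nat_recl//= {1}/F subrr mulr0n mul0r expr0n add0r big_add1 /=.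
apply: eq_big_nat => i _; congr F; lia.
Qed.

End FourierSeries.

(** * Slow variation and the limit theorem *)

Section SlowVariation.
Context {R : realType} (a : nat -> R).

Definition energy N := \sum_(1 <= k < N.+1) (k%:R * a k) ^+ 2.
Local Notation W := energy.

Lemma energy_cat m n : (m <= n)%N ->
  W n = W m + \sum_(m.+1 <= k < n.+1) (k%:R * a k) ^+ 2.
Proof. by move=> mn; rewrite /energy -big_cat_nat. Qed.

Lemma energy_le m n : (m <= n)%N -> W m <= W n.
Proof. by move=> mn; rewrite (energy_cat mn) lerDl sumr_ge0// => k _; exact: sqr_ge0. Qed.

Lemma energy_ge0 n : 0 <= W n.
Proof. by rewrite sumr_ge0// => k _; exact: sqr_ge0. Qed.

Hypothesis slow : slowly_varying (fun N => 2 * W N).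
Hypothesis energy_dvg : W N @[N --> \oo] --> +oo.

Lemma energy_gt0 : \forall N \near \oo, 0 < W N.
Proof. by case: slow => + _; apply: filterS => N; rewrite pmulr_rgt0. Qed.

Lemma energy_ratio m : (0 < m)%N -> W (N %/ m) / W N @[N --> \oo] --> (1 : R).
Proof.
move=> m0; case: slow => _ /(_ m%:R^-1).
have mR : (0 : R) < m%:R by rewrite ltr0n.
rewrite invr_gt0 => /(_ mR); rewrite (_ : (fun N => _) = fun N => W (N %/ m) / W N)//.
apply/funext => N; rewrite (_ : Num.truncn _ = N %/ m)%N; last first.
  apply: truncn_def; rewrite ler_pdivlMl// ltr_pdivrMl// -!natrM ler_nat ltr_nat.
  by rewrite mulnC leq_trunc_div /= mulnC ltn_ceil.
by rewrite -mulf_div divff// mul1r.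
Qed.

Lemma energy_ratio_near m e : (0 < m)%N -> 0 < e ->
  \forall N \near \oo, W N - W (N %/ m) <= e * W N.
Proof.
move=> m0 e0; have := energy_ratio m0 => /cvgrPdist_le /(_ e e0).
apply: filterS2 energy_gt0 => N WN.
move=> /(le_trans (ler_norm _)); rewrite lerBlDl -lerBlDr ler_pdivlMr// mulrBl mul1r.
by rewrite lerBlDr -lerBlDl.
Qed.

(** Slow variation at 2 N bounds the increment relative to W (2 N). Half the tolerance forces W (2
    N) <= 2 W N, which makes the bound relative to W N. *)
Lemma energy_doubling e : 0 < e -> e <= 1 ->
  \forall N \near \oo, W (2 * N) - W N <= e * W N.
Proof.
move=> e0 e1; have e20 : 0 < e / 2 by rewrite divr_gt0.
have [N0 _ h] := @energy_ratio_near 2 (e / 2) isT e20.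
exists N0 => // N /= N0N; have := h (2 * N)%N; rewrite /= mulKn// => /(_ _).
have /[swap] /[apply] : (N0 <= 2 * N)%N by lia.
move: (energy_ge0 N) (energy_ge0 (2 * N)); move: (W N) (W (2 * N)) => w w2 w0 w20 hw.
have w2w : w2 <= 2 * w by nra.
by apply: le_trans hw _; nra.
Qed.

Lemma block_le c m n : (forall k, (m < k < n)%N -> c ^+ 2 <= k%:R ^+ 2) ->
  c ^+ 2 * \sum_(m.+1 <= k < n) a k ^+ 2 <= \sum_(m.+1 <= k < n) (k%:R * a k) ^+ 2.
Proof.
move=> h; rewrite mulr_sumr big_nat [leRHS]big_nat; apply: ler_sum => k kn.
by rewrite exprMn ler_wpM2r ?sqr_ge0// h.
Qed.

(** Passing from N to 2 N multiplies N^2 by 4 but W by at most 2, so the part beyond 2 N costs at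
    most e W N, and so does the first block. *)
Lemma tail_dyadic e : 0 < e -> e <= 1 -> exists2 N0, (0 < N0)%N & forall j N, (N0 <= N)%N ->
  N%:R ^+ 2 * \sum_(N.+1 <= k < (2 ^ j * N).+1) a k ^+ 2 <= 2 * e * W N.
Proof.
move=> e0 e1; have [N0 _ hN0] := energy_doubling e0 e1.
exists N0.+1 => // j; elim: j => [|j IH] N N0N.
  by rewrite mul1n big_geq// mulr0 mulr_ge0 ?energy_ge0//; lra.
have NN : (N <= 2 * N)%N by lia.
have N2N : (2 * N <= 2 ^ j.+1 * N)%N by rewrite leq_mul2r expnS leq_pmulr ?orbT// expn_gt0.
rewrite (@big_cat_nat _ _ _ (2 * N).+1)//= mulrDr.
have h1 : N%:R ^+ 2 * \sum_(N.+1 <= k < (2 * N).+1) a k ^+ 2 <= W (2 * N) - W N.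
  rewrite (energy_cat NN) addrC addKr; apply: block_le => k /andP[Nk _].
  by rewrite ler_pXn2r ?nnegrE// ler_nat ltnW.
have h2 := hN0 N (ltnW N0N).
have := IH (2 * N)%N (leq_trans N0N NN).
rewrite mulnA -expnSr natrM exprMn.
set S := \sum_(_ <= _ < _) _; set Q := N%:R ^+ 2 * _ in h1 *.
have S0 : 0 <= S by rewrite sumr_ge0// => k _; exact: sqr_ge0.
rewrite /= in h2; have := energy_ge0 N; have := energy_ge0 (2 * N).
move: (W (2 * N)) (W N) (N%:R ^+ 2) h1 h2 => w2 w n2 h1 h2 w20 w0 h3.
have h4 : n2 * S <= 2 * e * w2 / 4 by rewrite ler_pdivlMr//; lra.
suff : e * w2 <= 2 * e * w by lra.
have w2w : w2 <= 2 * w by nra.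
by nra.
Qed.

(* The factor m is the ratio between N and the cut-off: below N the tail is at
   most m^2 (W N - W (N %/ m)), beyond N it is controlled dyadically. *)
Lemma tail_small m e : (0 < m)%N -> 0 < e -> \forall N \near \oo,
  forall n, N%:R ^+ 2 * \sum_((N %/ m).+1 <= k < n) a k ^+ 2 <= e * W N.
Proof.
move=> m0 e0.
have mR : (0 : R) < m%:R by rewrite ltr0n.
pose e1 := Num.min 1 (e / 4).
have e10 : 0 < e1 by rewrite lt_min ltr01 divr_gt0.
have e11 : e1 <= 1 by rewrite ge_min lexx.
have e1e : 4 * e1 <= e by rewrite -ler_pdivlMl// mulrC ge_min lexx orbT.
have [N0 N00 dy] := tail_dyadic e10 e11.
(* Between N / m and N, replacing N^2 by k^2 loses a factor m^2. *)
have e20 : 0 < e / (2 * m%:R ^+ 2) by rewrite divr_gt0// mulr_gt0// exprn_gt0.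
have [N1 _ ra] := energy_ratio_near m0 e20.
exists (maxn N0 N1) => // N /=; rewrite geq_max => /andP[N0N N1N] n.
have MN := leq_div N m.
have NN : (N <= 2 ^ n * N)%N by rewrite leq_pmull// expn_gt0.
(* An arbitrary endpoint [n] is pushed to the dyadic one 2^n N, which exceeds it. *)
apply: (@le_trans _ _ (N%:R ^+ 2 * \sum_((N %/ m).+1 <= k < (maxn n (2 ^ n * N)).+1) a k ^+ 2)).
  rewrite ler_wpM2l ?sqr_ge0//.
  have [nM|Mn] := leqP n (N %/ m).+1.
    by rewrite big_geq// sumr_ge0// => k _; exact: sqr_ge0.
  rewrite [leRHS](@big_cat_nat _ _ _ n)//=; [|exact: ltnW|by rewrite ltnW// ltnS leq_maxl].
  by rewrite lerDl sumr_ge0// => k _; exact: sqr_ge0.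
have -> : maxn n (2 ^ n * N) = (2 ^ n * N)%N.
  apply/maxn_idPr; apply: leq_trans (ltnW (ltn_expl n (leqnn 2))) _.
  by rewrite leq_pmulr//; exact: leq_trans N00 N0N.
rewrite (@big_cat_nat _ _ _ N.+1)//= mulrDr.
have h1 := dy n N N0N.
have h2 : (N%:R / m%:R) ^+ 2 * \sum_((N %/ m).+1 <= k < N.+1) a k ^+ 2 <= W N - W (N %/ m).
  rewrite (energy_cat MN) addrC addKr; apply: block_le => k /andP[Mk _].
  rewrite ler_pXn2r ?nnegrE ?divr_ge0 ?ler0n// ler_pdivrMr// -natrM ler_nat.
  by apply: leq_trans (ltnW (ltn_ceil N m0)) _; rewrite leq_mul2r Mk orbT.
have h3 := ra N N1N; rewrite /= in h3.
have {h2 h3} h4 := le_trans h2 h3.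
rewrite expr_div_n mulrAC ler_pdivrMr ?exprn_gt0// in h4.
have h5 : e / (2 * m%:R ^+ 2) * W N * m%:R ^+ 2 = e / 2 * W N by field; rewrite gt_eqF.
rewrite h5 in h4; have := energy_ge0 N => W0.
have h6 : 2 * e1 * W N <= e / 2 * W N by rewrite ler_wpM2r//; lra.
lra.
Qed.

(** The k-th term is part of the increment of W from k / 2 to k. For large k slow variation makes
    that increment small; the finitely many other terms are absorbed by the divergence of W. *)
Lemma max_term_small e : 0 < e -> \forall N \near \oo,
  forall k, (0 < k <= N)%N -> (k%:R * a k) ^+ 2 <= e * W N.
Proof.
move=> e0; have [K _ hK] := @energy_ratio_near 2 e isT e0.
have /cvgryPge /(_ (e^-1 * W K)) [N1 _ hN1] := energy_dvg.
have term k : (0 < k)%N -> (k%:R * a k) ^+ 2 <= W k - W (k %/ 2).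
  move=> k0; have kk : (k %/ 2 < k)%N by rewrite ltn_Pdiv.
  rewrite (energy_cat (leq_div k 2)) addrC addKr big_nat_recr// lerDr sumr_ge0// => i _; exact: sqr_ge0.
exists (maxn K N1) => // N /=; rewrite geq_max => /andP[KN N1N] k /andP[k0 kN].
apply: le_trans (term k k0) _.
have [Kk|kK] := leqP K k.
  by apply: le_trans (hK k Kk) _; rewrite ler_wpM2l ?(ltW e0)// energy_le.
apply: (@le_trans _ _ (W K)).
  by have := energy_ge0 (k %/ 2); have := energy_le (ltnW kK); lra.
by have := hN1 N N1N; rewrite /= ler_pdivrMl.
Qed.

End SlowVariation.

Section NormalizedMoments.
Context {R : realType} (a : nat -> R).
Hypothesis slow : slowly_varying (fun N => 2 * energy a N).
Hypothesis energy_dvg : energy a N @[N --> \oo] --> +oo.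

Definition normalized N k := a k / Num.sqrt (energy a N).

Lemma normalized_sqr N k : (k%:R * normalized N k) ^+ 2 = (k%:R * a k) ^+ 2 / energy a N.
Proof.
by rewrite /normalized mulrA exprMn exprVn sqr_sqrtr ?energy_ge0.
Qed.

(** For [j = 0] this is the energy ratio; higher powers are at most the largest normalized term
    times the sum of squares. *)
Lemma normalized_power_sum m j : (0 < m)%N ->
  \sum_(1 <= k < (N %/ m).+1) (k%:R * normalized N k) ^+ j.+2 @[N --> \oo] --> ((j == 0)%N%:R : R).
Proof.
move=> m0; have s2 N : \sum_(1 <= k < (N %/ m).+1) (k%:R * normalized N k) ^+ 2 =
    energy a (N %/ m) / energy a N.
  by rewrite /energy mulr_suml; apply: eq_bigr => k _; exact: normalized_sqr.
case: j => [|j].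
  by under eq_fun do rewrite s2; exact: energy_ratio.
apply/cvgr0Pnorm_le => e e0.
pose e1 := Num.min 1 e.
have e10 : 0 < e1 by rewrite lt_min ltr01.
have e11 : e1 <= 1 by rewrite ge_min lexx.
have e1e : e1 <= e by rewrite ge_min lexx orbT.
have := max_term_small slow energy_dvg (exprn_gt0 2 e10).
apply: filterS2 (energy_gt0 slow) => N WN small.
apply: (@le_trans _ _ (\sum_(1 <= k < (N %/ m).+1) e1 * (k%:R * normalized N k) ^+ 2)).
  apply: le_trans (ler_norm_sum _ _ _) _; rewrite big_nat [leRHS]big_nat.
  apply: ler_sum => k /andP[k0 kN].
  have {}kN : (k <= N)%N by apply: leq_trans (leq_div N m).
  have ke : `|k%:R * normalized N k| <= e1.
    rewrite -(ler_pXn2r (n := 2))// ?nnegrE ?(ltW e10)// real_normK ?num_real//.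
    by rewrite normalized_sqr ler_pdivrMr// small// k0.
  rewrite normrX -(real_normK (num_real (k%:R * _))); move: (`|_|) (normr_ge0 (k%:R * normalized N k)) ke => y y0 ye.
  rewrite (_ : y ^+ j.+3 = y * y ^+ j * y ^+ 2); last by rewrite -exprS -exprD addn2.
  rewrite ler_wpM2r ?sqr_ge0// -[leRHS]mulr1 ler_pM ?exprn_ge0// exprn_ile1//.
  exact: le_trans ye e11.
rewrite -mulr_sumr s2; apply: le_trans e1e; rewrite ler_piMr ?(ltW e10)//.
by rewrite ler_pdivrMr// mul1r energy_le// leq_div.
Qed.

Variables (d : nat -> measure_display) (T : forall N, measurableType (d N))
  (P : forall N, probability (T N) R) (theta : forall N, {RV (P N) >-> N.-tuple R}).
Hypothesis cue : forall N, cue_angles (theta N).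
Local Notation mu m N n := (power_moment (theta N) (N %/ m) (normalized N) n).
Local Notation mix m N j n := (mixed_moment (theta N) (N %/ m) (normalized N) j n).

(** In the limit only the sum of squares, which tends to 1, survives in [mixed_momentS]: what
    remains is the Gaussian recursion. The condition [n < m] keeps the degrees within reach of that
    recursion for the cut-off N / m. *)
Lemma normalized_moments m n : (n < m)%N ->
  [/\ mu m N n @[N --> \oo] --> gaussian_moment n,
      mix m N 0 n @[N --> \oo] --> (gaussian_moment n.+1 : R) &
      forall j, mix m N j.+1 n @[N --> \oo] --> (0 : R)].
Proof.
elim: n => [|n IH] nm.
  split.
  - by under eq_fun do rewrite power_moment0; exact: cvg_cst.
  - under eq_fun do rewrite (mixed_moment0 (@cue _) _ _ (leq_div _ _)).
    exact: cvg_cst.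
  - move=> j; under eq_fun do rewrite (mixed_moment0 (@cue _) _ _ (leq_div _ _)).
    exact: cvg_cst.
have [IH1 IH2 IH3] := IH (ltnW nm).
have m0 : (0 < m)%N by exact: leq_ltn_trans nm.
have mS j N : mix m N j n.+1 = n.+1%:R * (mix m N j.+1 n +
     (\sum_(1 <= k < (N %/ m).+1) (k%:R * normalized N k) ^+ j.+2) * mu m N n).
  apply: (mixed_momentS (@cue N)).
  by apply: leq_trans (leq_trunc_div N m); rewrite mulnC leq_mul2l nm orbT.
have cS j : mix m N j n.+1 @[N --> \oo] --> (n.+1%:R * (0 + (j == 0)%N%:R * gaussian_moment n) : R).
  under eq_fun do rewrite mS; apply: cvgMr; apply: cvgD; first exact: IH3.
  by apply: cvgM => //; exact: normalized_power_sum.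
split.
- by under eq_fun do rewrite power_momentS.
- by rewrite gaussian_momentSS; have := cS 0%N; rewrite add0r mul1r.
- by move=> j; have := cS j.+1; rewrite mul0r addr0 mulr0.
Qed.

End NormalizedMoments.

(** Supplies the tail bound needed for square integrability of the statistic at every [N], small
    ones included. *)
Lemma coef_square_bounded (R : realType) (a : nat -> R) :
  slowly_varying (fun N => 2 * energy a N) ->
  exists L, forall n, \sum_(1 <= k < n) a k ^+ 2 <= L.
Proof.
move=> slow; have [N0 _ tail] := tail_small slow (m := 1) isT ltr01.
pose N := N0.+1; have := tail N (leqnSn N0); rewrite divn1 mul1r => h.
exists (\sum_(1 <= k < N.+1) a k ^+ 2 + energy a N / N%:R ^+ 2) => n.
have [nN|Nn] := leqP n N.+1.
  apply: (@le_trans _ _ (\sum_(1 <= k < N.+1) a k ^+ 2)); last first.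
    by rewrite lerDl divr_ge0 ?sqr_ge0// energy_ge0.
  have [n1|n1] := leqP 1 n; last by rewrite big_geq ?sumr_ge0// => [k _|]; [exact: sqr_ge0|lia].
  by rewrite [leRHS](@big_cat_nat _ _ _ n)//= lerDl sumr_ge0// => k _; exact: sqr_ge0.
rewrite (@big_cat_nat _ _ _ N.+1)//=; last exact: ltnW.
by rewrite lerD2l ler_pdivlMr ?exprn_gt0// mulrC.
Qed.

Theorem theorem1p2 (R : realType) (f : R -> R)
  (d : nat -> measure_display) (T : forall N : nat, measurableType (d N))
  (P : forall N : nat, probability (T N) R)
  (theta : forall N : nat, {RV (P N) >-> N.-tuple R}) :
  L2_circle f ->
  even_ae f ->
  slowly_varying (fourier_energy f) ->
  fourier_energy f N @[N --> \oo] --> +oo ->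
  (forall N : nat, cue_angles (theta N)) ->
  cvg_in_distribution P
    (fun N w =>
       (pair_stat f (theta N w) -
          fine ('E_(P N)[fun w' => pair_stat f (theta N w')])) /
       Num.sqrt (2 * fourier_energy f N))
    (normal_prob 0 1).
Proof.
move=> f2 fe slow dvg cue.
pose a := cos_coef f.
have fE : fourier_energy f = fun N => 2 * energy a N.
  by apply/funext => N; exact: fourier_energy_cos.
rewrite fE in slow dvg *.
have {}dvg : energy a N @[N --> \oo] --> +oo.
  apply/cvgryPge => A; move/cvgryPge : dvg => /(_ (2 * A)).
  by apply: filterS => N; rewrite ler_pM2l.
have [mf f2pi if2] := f2.
(* The Fourier energy counts both signs of k and is twice [energy]; with the 2 of the normalization
   the root is 2 sqrt(W_N). *)
pose r N := (2 * Num.sqrt (energy a N))^-1.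
pose S N w := pair_stat f (theta N w).
pose X N w := r N * (S N w - Rintegral (P N) setT (S N)).
have XE N w : (pair_stat f (theta N w) - fine ('E_(P N)[fun w' => pair_stat f (theta N w')])) /
    Num.sqrt (2 * (2 * energy a N)) = X N w.
  rewrite /X /r unlock mulrC; congr (_^-1 * _).
  rewrite mulrA sqrtrM; last by rewrite mulr_ge0.
  by rewrite -expr2 sqrtr_sqr ger0_norm.
have sS N : square_integrable (P N) (S N).
  have [L aL] := coef_square_bounded slow.
  exact: (pair_stat_tail (@cue N) mf f2pi if2 (cos_series_cvg f2 fe 0) aL).1.
have sX N : square_integrable (P N) (X N).
  have sE := bounded_square_integrable (P N) (bounded_rv_cst (T N) (Rintegral (P N) setT (S N))).
  exact: (square_integrableZ (r N) (square_integrableB (sS N) sE)).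
move=> h ch hb.
under eq_fun do under eq_Rintegral do rewrite XE.
apply: (moment_clt sX _ ch) => //; last first.
  move: hb => [B [_ /(_ (`|B| + 1))]]; rewrite (le_lt_trans (ler_norm B)) ?ltrDl// => /(_ isT) hB.
  by exists (`|B| + 1) => x; exact: hB.
move=> K; pose m := K.+1.
pose Y N w := \sum_(1 <= k < (N %/ m).+1) normalized a N k * (sq_power_sum k (theta N w) - k%:R).
exists Y; split.
- by move=> N; exact: bounded_Y.
- by move=> j jK; have [] := normalized_moments slow dvg cue (n := j) (m := m) jK.
apply/cvgr0Pnorm_le => e e0.
(* The variance bound 24 N^2 L, with L as below, is 4 e W_N, and r^2 equals 1 / (4 W_N). *)
have e60 : 0 < e / 6 by rewrite divr_gt0.
have := tail_small slow (m := m) isT e60.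
apply: filterS3 (energy_gt0 slow) (nbhs_infty_gt 0) => N WN N0 tail.
pose L := e / 6 * energy a N / N%:R ^+ 2.
have aL n : \sum_((N %/ m).+1 <= k < n) a k ^+ 2 <= L.
  by rewrite /L ler_pdivlMr ?exprn_gt0 ?ltr0n// mulrC.
pose Z w := S N w - Rintegral (P N) setT (S N) -
  2 * \sum_(1 <= k < (N %/ m).+1) a k * (sq_power_sum k (theta N w) - (moment N [:: k])%:~R).
have : Rintegral (P N) setT (fun w => Z w ^+ 2) <= 24 * N%:R ^+ 2 * L.
  exact: (pair_stat_tail (@cue N) mf f2pi if2 (cos_series_cvg f2 fe (N %/ m)) aL).2.
have sW : 0 < Num.sqrt (energy a N) by rewrite sqrtr_gt0.
have XY w : (X N w - Y N w) ^+ 2 = r N ^+ 2 * Z w ^+ 2.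
  rewrite -exprMn; congr (_ ^+ 2); rewrite /Z mulrBr -/(S N w); congr (_ - _).
  have r2 : r N * 2 = (Num.sqrt (energy a N))^-1 by rewrite /r; field; rewrite gt_eqF.
  rewrite mulrA r2 mulr_sumr /Y big_nat [RHS]big_nat; apply: eq_bigr => k /andP[k1 kM].
  (* Up to [N] the mean min(k, N) of the squared power sum is [k], the centring used in [Y]. *)
  have kN : (k <= N)%N by apply: leq_trans (leq_div N m).
  by rewrite moment1// (minn_idPl kN) -pmulrn mulrA; congr (_ * _); rewrite /normalized mulrC.
have sXY := square_integrableB (sX N) (bounded_square_integrable (P N) (bounded_Y (theta N) (N %/ m) (normalized a N))).
have r0 : r N != 0 by rewrite invr_eq0 mulf_neq0// gt_eqF.
have -> : Rintegral (P N) setT (fun w => Z w ^+ 2) = (r N ^+ 2)^-1 * Rintegral (P N) setT (fun w => (X N w - Y N w) ^+ 2).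
  rewrite -RintegralZl//; last exact: sXY.2.
  by apply: eq_Rintegral => w _; rewrite XY mulKf// expf_neq0.
rewrite ler_pdivrMl ?exprn_gt0 ?invr_gt0 ?mulr_gt0// => h1.
rewrite ger0_norm; last by apply: Rintegral_ge0 => w _; exact: sqr_ge0.
apply: le_trans h1 _; rewrite /r /L exprVn exprMn sqr_sqrtr ?(ltW WN)//.
rewrite le_eqVlt (_ : _ == _)//; apply/eqP; field.
by rewrite (gt_eqF WN) pnatr_eq0 -lt0n N0.
Qed.
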